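(* Let $\Phi$ be an $N$-function whose Matuszewska-Orlicz indices satisfy $1<\alpha_\Phi\le\beta_\Phi<\infty$. Suppose that $a\in M_{\langle\Phi\rangle}$ and that for each $\tau\in[-\pi,\pi)$ there exists $a_\tau\in M_{[\Phi]}$ such that $\operatorname{dist}_\tau(a,a_\tau)=0$ and the discrete Wiener-Hopf operator $T(a_\tau)$ is Fredholm on $\ell^\Phi(\mathbb{Z}_+)$. Then the discrete Wiener-Hopf operator $T(a)$ is Fredholm on $\ell^\Phi(\mathbb{Z}_+)$.
   Context: An $N$-function is a continuous, increasing, convex function $\Phi:[0,\infty)\to[0,\infty)$ with $\Phi(t)=0$ iff $t=0$, $\lim_{t\to0^+}\Phi(t)/t=0$ and $\lim_{t\to\infty}\Phi(t)/t=\infty$. The Orlicz sequence space $\ell^\Phi(\mathbb{Z})$ consists of all $f=\{f_n\}:\mathbb{Z}\to\mathbb{C}$ with $\varrho_\Phi(f/\lambda):=\sum_{n\in\mathbb{Z}}\Phi(|f_n/\lambda|)<\infty$ for some $\lambda>0$, normed by $\|f\|_{\ell^\Phi(\mathbb{Z})}:=\inf\{\lambda>0:\varrho_\Phi(f/\lambda)\le1\}$. Indices: for $t>0$ let $M(t,\Phi):=\sup_{0<u<\infty}\Phi(tu)/\Phi(u)\in(0,\infty]$. The Matuszewska-Orlicz indices are $\alpha_\Phi:=\sup_{0<t<1}\frac{\ln M(t,\Phi)}{\ln t}$ and $\beta_\Phi:=\inf_{t>1}\frac{\ln M(t,\Phi)}{\ln t}$. If $1<\alpha_\Phi\le\beta_\Phi<\infty$,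 then $\ell^\Phi(\mathbb{Z})$ is reflexive and separable. Multipliers: $\mathcal{P}'$ is the space of $2\pi$-periodic distributions, $\{\widehat a_j\}_{j\in\mathbb{Z}}$ are the Fourier coefficients of $a\in\mathcal{P}'$ (for an integrable function, $\widehat a_j=\frac1{2\pi}\int_{-\pi}^{\pi}a(x)e^{-ijx}dx$), and $S_0(\mathbb{Z})$ is the set of finitely supported sequences. For $\varphi\in S_0(\mathbb{Z})$, $(a*\varphi)_j:=\sum_{k}\widehat a_{j-k}\varphi_k$. $M_\Phi$ is the set of all $a\in\mathcal{P}'$ such that $a*\varphi\in\ell^\Phi(\mathbb{Z})$ for all $\varphi\in S_0(\mathbb{Z})$ and $\|a\|_{M_\Phi}:=\sup\{\|a*\varphi\|_{\ell^\Phi(\mathbb{Z})}/\|\varphi\|_{\ell^\Phi(\mathbb{Z})}:\varphi\in S_0(\mathbb{Z}),\varphi\ne0\}<\infty$. When $\ell^\Phi(\mathbb{Z})$ is reflexive, $M_\Phi\subset L^\infty(-\pi,\pi)$ (essentially bounded $2\pi$-periodic functions) with $\|a\|_{L^\infty(-\pi,\pi)}\le\|a\|_{M_\Phi}$, so elements of $M_\Phi$ are regarded as such functions. Discrete Wiener-Hopf operator: let $\mathbb{Z}_+=\{0,1,2,\dots\}$, $(P\varphi)_j=\varphi_j$ for $j\in\mathbb{Z}_+$ and $(P\varphi)_j=0$ otherwise, $\ell^\Phi(\mathbb{Z}_+):=P\ell^\Phi(\mathbb{Z})$. When $\ell^\Phi(\mathbb{Z})$ is separable, $S_0(\mathbb{Z}_+):=PS_0(\mathbb{Z})$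 is dense in $\ell^\Phi(\mathbb{Z}_+)$, and for $a\in M_\Phi$, $T(a)$ is the bounded extension to $\ell^\Phi(\mathbb{Z}_+)$ of $\varphi\mapsto P(a*\varphi)$, $\varphi\in S_0(\mathbb{Z}_+)$. A bounded operator is Fredholm if its kernel has finite dimension and its range has finite codimension. The functions $\Phi_\theta$: for $0<\theta<2\min\{1/\beta_\Phi,1-1/\alpha_\Phi\}$ (which forces $\theta<1$) let $\Psi_\theta(0)=0$, $\Psi_\theta(t):=\left(\Phi^{-1}(t)\,t^{-\theta/2}\right)^{1/(1-\theta)}$ for $t>0$; let $\widetilde\Psi_\theta$ be the least concave majorant of $\Psi_\theta$, i.e. the pointwise infimum of all concave functions $F:[0,\infty)\to[0,\infty)$ with $F(t)=0$ iff $t=0$ and $F\ge\Psi_\theta$; and let $\Phi_\theta:=\widetilde\Psi_\theta^{-1}$ (inverse function). Each $\Phi_\theta$ is an $N$-function with $1<\alpha_{\Phi_\theta}\le\beta_{\Phi_\theta}<\infty$, and $M_{\Phi_\theta}\subset M_\Phi$. Define $$M_{[\Phi]}:=\bigcap_{0<\theta<2\min\{1/\beta_\Phi,1-1/\alpha_\Phi\}}M_{\Phi_\theta},\qquad M_{\langle\Phi\rangle}:=\bigcup_{0<\theta<2\min\{1/\beta_\Phi,1-1/\alpha_\Phi\}}M_{\Phi_\theta}.$$ Local distance: for $a,b\in L^\infty(-\pi,\pi)$ and $\tau\in[-\pi,\pi)$, $\operatorname{dist}_\tau(a,b):=\inf_{u\in\mathcal{U}_\tau}\|a|_u-b|_u\|_{L^\infty(u)}$,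 where $\mathcal{U}_\tau$ is the family of all open finite intervals $u\subset\mathbb{R}$ containing $\tau$. *)

(* Defs.v *)
From HB Require Import structures.
From mathcomp Require Import all_boot all_order all_algebra.
From mathcomp Require Import all_classical all_reals all_analysis.
From mathcomp Require Import ess_sup_inf complex.

Set Implicit Arguments.
Unset Strict Implicit.
Unset Printing Implicit Defensive.

Import Order.TTheory GRing.Theory Num.Theory.
Import numFieldNormedType.Exports.

Local Open Scope classical_set_scope.
Local Open Scope complex_scope.
Local Open Scope ring_scope.

Local Notation normc := ComplexField.Normc.normc.

Section NFunctions.
Context {R : realType}.
Implicit Types (Phi F : R -> R) (t theta : R).

(* A function [0, +oo[ -> [0, +oo[ is a total F : R -> R; only its values on
   [0, +oo[ are constrained, and only these are used below. *)
Definition nonneg_half F : Prop := forall t, 0 <= t -> 0 <= F t.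

Definition zero_only_at0 F : Prop := forall t, 0 <= t -> (F t = 0 <-> t = 0).

Record N_function Phi : Prop := {
  N_ge0 : nonneg_half Phi;
  N_continuous : {within `[0, +oo[, continuous Phi};
  N_increasing : {in `[0, +oo[ &, {homo Phi : s t / s < t}};
  N_convex : convex_function (`[0, +oo[%classic : set R) Phi;
  N_eq0 : zero_only_at0 Phi;
  N_cvg0 : Phi t / t @[t --> 0^'+] --> 0;
  N_cvgy : Phi t / t @[t --> +oo] --> +oo }.

Local Open Scope ereal_scope.

Definition MO_fun Phi t : \bar R :=
  ereal_sup [set (Phi (t * u) / Phi u)%:E | u in `]0%R, +oo[ ].

Definition alpha_index Phi : \bar R :=
  ereal_sup [set lne (MO_fun Phi t) / (ln t)%:E | t in `]0%R, 1%R[ ].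

Definition beta_index Phi : \bar R :=
  ereal_inf [set lne (MO_fun Phi t) / (ln t)%:E | t in `]1%R, +oo[ ].

Local Close Scope ereal_scope.

(* [fine] is harmless: this is only used when 1 < alpha <= beta < +oo. *)
Definition theta_max Phi : R :=
  2 * Num.min (fine (beta_index Phi))^-1 (1 - (fine (alpha_index Phi))^-1).

Definition half_inverse F : R -> R := 'pinv_(fun=> 0) `[0, +oo[ F.

Definition Psi_theta Phi theta t : R :=
  if t == 0 then 0
  else (half_inverse Phi t * t `^ (- (theta / 2))) `^ (1 - theta)^-1.

Definition concave_half F : Prop :=
  convex_function (`[0, +oo[%classic : set R) (fun t => - F t).

Definition concave_majorants F : set (R -> R) :=
  [set G | [/\ concave_half G, nonneg_half G, zero_only_at0 G &
               forall t, 0 <= t -> F t <= G t]].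

Definition least_concave_majorant F t : R :=
  inf [set G t | G in concave_majorants F].

Definition Phi_theta Phi theta : R -> R :=
  half_inverse (least_concave_majorant (Psi_theta Phi theta)).

End NFunctions.

Section OrliczSequences.
Context {R : realType}.
Implicit Types (Phi : R -> R) (f : int -> R[i]) (lambda : R).
Local Open Scope ereal_scope.

Definition modular Phi f lambda : \bar R :=
  \esum_(n in [set: int]) (Phi (normc (f n / lambda%:C)))%:E.

Definition lPhi Phi : set (int -> R[i]) :=
  [set f | exists2 lambda, (0 < lambda)%R & modular Phi f lambda < +oo].

(* Equal to +oo outside lPhi Phi, where the infimum is over the empty set. *)
Definition lPhi_norm Phi f : \bar R :=
  ereal_inf [set lambda%:E | lambda in
    [set lambda | (0 < lambda)%R /\ modular Phi f lambda <= 1]].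

End OrliczSequences.

Section Sequences.
Context {R : realType}.
Implicit Types (Phi : R -> R) (phi : int -> R[i]).

Definition S0 : set (int -> R[i]) := [set phi | finite_set [set k | phi k != 0]].

Definition Pplus phi : int -> R[i] := fun j => if 0 <= j then phi j else 0.

Definition S0plus : set (int -> R[i]) := Pplus @` S0.

Definition lPhi_plus Phi : set (int -> R[i]) := Pplus @` lPhi Phi.

End Sequences.

Section PeriodicDistributions.
Context {R : realType}.
Implicit Types (g h f : R -> R[i]) (u : (R -> R[i]) -> R[i]).

Definition periodic2pi g : Prop := forall x, g (x + 2 * pi) = g x.

(* The n-th derivative, taken on the real and imaginary parts. *)
Definition cderiven n g : R -> R[i] := fun x =>
  derive1n n (fun y => complex.Re (g y)) x
    +i* derive1n n (fun y => complex.Im (g y)) x.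

Definition smooth g : Prop := forall n x,
  derivable (derive1n n (fun y => complex.Re (g y))) x 1 /\
  derivable (derive1n n (fun y => complex.Im (g y))) x 1.

Definition test_function : set (R -> R[i]) :=
  [set g | periodic2pi g /\ smooth g].

(* A linear functional on the 2pi-periodic smooth functions, continuous for the
   seminorms sup |g^(n)|. Only its values on test functions matter. *)
Definition periodic_distribution : set ((R -> R[i]) -> R[i]) :=
  [set u |
    (forall (c : R[i]) g h, test_function g -> test_function h ->
       u (fun x => c * g x + h x) = c * u g + u h) /\
    (exists (N : nat) (C : R), forall g (B : R), test_function g ->
       (forall n x, (n <= N)%N -> normc (cderiven n g x) <= B) ->
       normc (u g) <= C * B)].

(* x |-> exp(- i j x) *)
Definition expmi (j : int) : R -> R[i] := fun x =>
  cos (j%:~R * x) +i* - sin (j%:~R * x).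

Definition fourier_coef u (j : int) : R[i] := ((2 * pi)^-1)%:C * u (expmi j).

Local Notation mu := (@lebesgue_measure R).

Definition Linfty_norm (D : set R) h : \bar R :=
  ess_sup mu (EFin \o ((fun x => normc (h x)) \_ D)).

Definition Linfty_periodic : set (R -> R[i]) :=
  [set f | [/\ periodic2pi f,
    measurable_fun setT (fun x => complex.Re (f x)),
    measurable_fun setT (fun x => complex.Im (f x)) &
    (Linfty_norm setT f < +oo)%E]].

(* f induces the distribution g |-> \int_(-pi)^pi f g; its Fourier coefficients
   are then (2 pi)^-1 \int_(-pi)^pi f(x) exp(- i j x) dx. *)
Definition represents f u : Prop := forall g, test_function g ->
  u g =
    (\int[mu]_(x in `[- pi, pi]) complex.Re (f x * g x))
      +i* (\int[mu]_(x in `[- pi, pi]) complex.Im (f x * g x)).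

Definition local_dist (tau : R) f h : \bar R :=
  ereal_inf [set Linfty_norm `]c.1, c.2[ (fun x => f x - h x) |
    c in [set c : R * R | c.1 < tau < c.2]].

(* The local distance between distributions that are L^oo functions. The
   representing functions are unique almost everywhere, so that this is the
   infimum of a single value; it is +oo if a or b is not an L^oo function. *)
Definition dist_at (tau : R) (a b : (R -> R[i]) -> R[i]) : \bar R :=
  ereal_inf [set d | exists f h,
    [/\ Linfty_periodic f /\ represents f a,
        Linfty_periodic h /\ represents h b & d = local_dist tau f h]].

End PeriodicDistributions.

Section Multipliers.
Context {R : realType}.
Implicit Types (Phi : R -> R) (a : (R -> R[i]) -> R[i]) (phi : int -> R[i]).

Definition conv a phi : int -> R[i] := fun j =>
  \sum_(k \in [set: int]) fourier_coef a (j - k) * phi k.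

Definition mult_norm Phi a : \bar R :=
  ereal_sup [set (lPhi_norm Phi (conv a phi) / lPhi_norm Phi phi)%E |
    phi in S0 `\ (fun=> 0)].

Definition multiplier Phi : set ((R -> R[i]) -> R[i]) :=
  [set a | [/\ periodic_distribution a,
    forall phi, S0 phi -> lPhi Phi (conv a phi) &
    (mult_norm Phi a < +oo)%E]].

Definition multiplier_square Phi : set ((R -> R[i]) -> R[i]) :=
  \bigcap_(theta in `]0, theta_max Phi[) multiplier (Phi_theta Phi theta).

Definition multiplier_angle Phi : set ((R -> R[i]) -> R[i]) :=
  \bigcup_(theta in `]0, theta_max Phi[) multiplier (Phi_theta Phi theta).

End Multipliers.

Section WienerHopf.
Context {R : realType}.
Implicit Types (Phi : R -> R) (X : set (int -> R[i]))
  (T : (int -> R[i]) -> (int -> R[i])) (phi psi : int -> R[i]).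

(* Operators on a subspace X of sequences are total maps; only their values on
   X are constrained and used. *)
Definition bounded_linear_op Phi X T : Prop :=
  [/\ forall phi, X phi -> X (T phi),
      forall (c : R[i]) phi psi, X phi -> X psi ->
        T (fun j => c * phi j + psi j) = (fun j => c * T phi j + T psi j) &
      exists C : R, forall phi, X phi ->
        (lPhi_norm Phi (T phi) <= C%:E * lPhi_norm Phi phi)%E].

Definition is_wiener_hopf Phi a T : Prop :=
  bounded_linear_op Phi (lPhi_plus Phi) T /\
  forall phi, S0plus phi -> T phi = Pplus (conv a phi).

Definition lin_comb n (c : 'I_n -> R[i]) (v : 'I_n -> int -> R[i]) :
    int -> R[i] :=
  fun j => \sum_(i < n) c i * v i j.

Definition finite_dim_kernel X T : Prop :=
  exists n (v : 'I_n -> int -> R[i]),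
    forall phi, X phi -> T phi = (fun=> 0) -> exists c, phi = lin_comb c v.

Definition finite_codim_range X T : Prop :=
  exists n (w : 'I_n -> int -> R[i]), (forall i, X (w i)) /\
    forall psi, X psi -> exists phi c, X phi /\
      psi = (fun j => T phi j + lin_comb c w j).

Definition fredholm X T : Prop :=
  finite_dim_kernel X T /\ finite_codim_range X T.

(* The bounded extension T(a) is unique because S0plus is dense. *)
Definition wiener_hopf_fredholm Phi a : Prop :=
  exists2 T, is_wiener_hopf Phi a T & fredholm (lPhi_plus Phi) T.

End WienerHopf.

(* Main.v *)
(**
Modulo finite rank operators on [E = l^Phi(Z_+)], where Fredholm means invertible,
the shifts [U], [V] are inverse to each other and commute with every Toeplitz
operator.  The elements [p_s], Toeplitz with symbol [cos^2 ((x - s) / 2)], have norm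
at most 1, and the average of [p_s^d] over the [(d + 1)]-st roots of unity
[exp (i s)] is a central binomial multiple of 1.  If [B_s] inverts [T(a_s)] and
[T(a - a_s) p_s^N] is small, then so is [(B_s T(a) - 1) p_s^N], and it stays small
when [s] moves a little; compactness and a truncated Neumann series glue the [B_s]
to an inverse of [T(a)] up to an error of norm at most 1/2.

The smallness comes from interpolation.  [Phi] is equivalent to the Calderon
product of [Phi_theta] and [t^2], with exponents [1 - theta] and [theta].  On
[l^(Phi_theta)] convolution with [(a - a_s) p_s^N] is bounded uniformly in [N], as
[a - a_s] is a multiplier there.  On [l^2] its norm is the supremum of the symbol,
which is small near [s] because [dist_s(a, a_s) = 0] and far from [s] because of
the factor [p_s^N].
*)
Require Import Defs.
From HB Require Import structures.
From mathcomp Require Import all_boot all_order all_algebra.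
From mathcomp Require Import generic_quotient ring_quotient.
From mathcomp Require Import all_classical all_reals all_analysis.
From mathcomp Require Import complex ess_sup_inf measurable_realfun.
From mathcomp Require Import ring lra zify.

Set Implicit Arguments.
Unset Strict Implicit.
Unset Printing Implicit Defensive.

Import Order.TTheory GRing.Theory Num.Theory.
Import numFieldNormedType.Exports.

Local Open Scope classical_set_scope.
Local Open Scope complex_scope.
Local Open Scope ring_scope.

Local Notation normc := ComplexField.Normc.normc.

(** The finite rank operators do not form a closed ideal, so the quotient by them is not a Banach
    algebra. It carries only upper bounds [ess_le], and infinite procedures such as inverting
    [1 + f] take place after lifting to the complete space.

    The bumps must have norm at most 1 on every translation invariant space in play, since
    arbitrarily high powers of them occur. This holds because the coefficients 1/4, 1/2, 1/4 have
    absolute sum 1. Powers of bumps replace a partition of unity: normalising their average costs a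
    factor linear in d, as binomial(2d, d) is at least 4^d / (2d + 1), while for d = N m the m-th
    powers of the local errors contribute (1/2)^m.

    A small supremum of the symbol does not make the multiplier norm on [l^Phi] small; this is why a
    second space with a uniform bound is needed. A single theta serves everywhere: [a] selects it by
    lying in the union, and every local representative lies in the intersection. The upper limit on
    theta is exactly what makes [Psi_theta] quasi-concave up to constants, hence equivalent to its
    concave majorant. *)

Section ComplexNumbers.
Context {R : realType}.
Implicit Types (z w : R[i]) (x y : R).

Lemma normc_ge0 z : 0 <= normc z.
Proof. by case: z => a b; rewrite /= sqrtr_ge0. Qed.

Lemma normcD z w : normc (z + w) <= normc z + normc w.
Proof. exact: le_normcD. Qed.

Lemma normc_sum (I : Type) (s : seq I) (F : I -> R[i]) :
  normc (\sum_(i <- s) F i) <= \sum_(i <- s) normc (F i).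
Proof.
elim: s => [|i s IH]; first by rewrite !big_nil ComplexField.Normc.normc0.
by rewrite !big_cons (le_trans (normcD _ _))// lerD2l.
Qed.

Lemma normcM z w : normc (z * w) = normc z * normc w.
Proof. exact: ComplexField.Normc.normcM. Qed.

Lemma normcX z n : normc (z ^+ n) = normc z ^+ n.
Proof.
elim: n => [|n IH]; first by rewrite !expr0 ComplexField.Normc.normc1.
by rewrite !exprS normcM IH.
Qed.

Lemma normc_real x : normc x%:C = `|x|.
Proof. by rewrite /= expr0n /= addr0 sqrtr_sqr. Qed.

Lemma normc_eq0 z : (normc z == 0) = (z == 0).
Proof.
apply/eqP/eqP => [|->]; first exact: ComplexField.Normc.eq0_normc.
exact: ComplexField.Normc.normc0.
Qed.

Lemma sqr_normcE z : normc z ^+ 2 = complex.Re z ^+ 2 + complex.Im z ^+ 2.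
Proof. by case: z => a b /=; rewrite sqr_sqrtr// addr_ge0 ?sqr_ge0. Qed.

Lemma Re_le_normc z : `|complex.Re z| <= normc z.
Proof.
rewrite -(@ler_pXn2r _ 2)// ?nnegrE ?normc_ge0// real_normK ?num_real//.
by rewrite sqr_normcE lerDl sqr_ge0.
Qed.

Lemma Im_le_normc z : `|complex.Im z| <= normc z.
Proof.
rewrite -(@ler_pXn2r _ 2)// ?nnegrE ?normc_ge0// real_normK ?num_real//.
by rewrite sqr_normcE lerDr sqr_ge0.
Qed.

Lemma normc_le_ReIm z : normc z <= `|complex.Re z| + `|complex.Im z|.
Proof.
rewrite -(@ler_pXn2r _ 2)// ?nnegrE ?normc_ge0// ?addr_ge0// sqr_normcE.
rewrite sqrrD !real_normK ?num_real// -addrA lerD2l lerDr.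
by rewrite mulrn_wge0 // mulr_ge0.
Qed.

Definition cis x : R[i] := cos x +i* sin x.

Lemma cis0 : cis 0 = 1.
Proof. by rewrite /cis cos0 sin0. Qed.

Lemma cisD x y : cis (x + y) = cis x * cis y.
Proof. by rewrite /cis cosD sinD; simpc; congr (_ +i* _); rewrite addrC. Qed.

Lemma cisN x : cis (- x) = (cis x)^-1.
Proof.
have e : cis x * cis (- x) = 1 by rewrite -cisD subrr cis0.
have xu : cis x \is a GRing.unit.
  by apply/unitrP; exists (cis (- x)); rewrite mulrC e.
by apply: (mulrI xu); rewrite e mulrV.
Qed.

Lemma cis_neq0 x : cis x != 0.
Proof.
apply/eqP => e; have := cisD x (- x).
by rewrite subrr cis0 e mul0r => /eqP; rewrite oner_eq0.
Qed.

Lemma normc_cis x : normc (cis x) = 1.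
Proof. by rewrite /= cos2Dsin2 sqrtr1. Qed.

Lemma cisX x n : cis x ^+ n = cis (x *+ n).
Proof.
by elim: n => [|n IH]; rewrite ?mulr0n ?cis0// exprS IH mulrS cisD.
Qed.

Lemma cis2pi : cis (pi *+ 2) = 1.
Proof. by rewrite /cis cos2pi sin2pi. Qed.

Lemma cis_neq1 x : 0 < x < pi *+ 2 -> cis x != 1.
Proof.
move=> /andP[x0 x2]; apply/eqP => -[+ _].
have -> : cos x = 1 - sin (x / 2) ^+ 2 *+ 2.
  by rewrite {1}(_ : x = x / 2 *+ 2) ?cos_mulr2n ?cos2sin2 ?mulrnDl; [ring|lra].
have /gt_eqF : 0 < sin (x / 2) ^+ 2.
  by rewrite exprn_gt0// sin_gt0_pi// divr_gt0//=; lra.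
by move=> + e; move/eqP; apply; lra.
Qed.

(** A geometric sum: the ratio is an M-th root of unity, and it differs from 1 because [0 < |k| < M]
    keeps its angle strictly between 0 and 2 pi up to sign. *)
Lemma sum_cis_root (M : nat) (k : int) : k != 0 -> (`|k| < M)%N ->
  \sum_(l < M) cis (pi *+ 2 * k%:~R / M%:R) ^+ l = 0.
Proof.
move=> k0 kM; set z := cis _.
have M0 : (M%:R : R) != 0 by rewrite pnatr_eq0; lia.
have M0' : (0 < M%:R :> R) by rewrite ltr0n; lia.
have pi2 : 0 < pi *+ 2 :> R by rewrite pmulrn_lgt0// pi_gt0.
have zM : z ^+ M = 1.
  rewrite /z cisX -[_ *+ M]mulr_natr divfK//.
  case: k {k0 kM z} => k.
    by rewrite -pmulrn mulr_natr -cisX cis2pi expr1n.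
  by rewrite NegzE mulrNz mulrN cisN -pmulrn mulr_natr -cisX cis2pi expr1n invr1.
have z1 : z != 1.
  rewrite /z; case: k {zM z} k0 kM => k k0 kM.
    apply: cis_neq1; rewrite -pmulrn; apply/andP; split.
      rewrite divr_gt0// mulr_gt0// ltr0n; lia.
    rewrite ltr_pdivrMr// ltr_pM2l// ltr_nat; lia.
  rewrite NegzE mulrNz mulrN mulNr cisN invr_eq1; apply: cis_neq1.
  rewrite -pmulrn; apply/andP; split.
    by rewrite divr_gt0// mulr_gt0// ltr0n.
  rewrite ltr_pdivrMr// ltr_pM2l// ltr_nat; lia.
have := subrX1 z M; rewrite zM subrr => /esym/eqP.
by rewrite mulf_eq0 subr_eq0 (negPf z1) => /eqP.
Qed.

Lemma cis_near (x e : R) : 0 < e -> \forall y \near x, normc (cis y - cis x) < e.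
Proof.
move=> e0; have e20 : 0 < e / 2 by rewrite divr_gt0.
near=> y; apply: (le_lt_trans (normc_le_ReIm _)).
rewrite (splitr e) ltrD//=; near: y.
  have /cvgrPdist_lt /(_ _ e20) := @continuous_cos R x.
  by apply: filterS => y; rewrite distrC.
have /cvgrPdist_lt /(_ _ e20) := @continuous_sin R x.
by apply: filterS => y; rewrite distrC.
Unshelve. all: by end_near.
Qed.

End ComplexNumbers.

(** The central coefficient is the largest of the 2d + 1 that sum to 4^d. The induction uses the
    ratio 2 (2d + 1) / (d + 1) of consecutive central coefficients. The bound makes the
    normalisation of averaged bumps cost only a linear factor. *)
Lemma central_bin_ge (d : nat) : (4 ^ d <= d.*2.+1 * 'C(d.*2, d))%N.
Proof.
elim: d => // d IH.
have e1 := mul_bin_diag d.*2.+2 d.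
have e2 := mul_bin_down d.*2.+1 d.
have e3 : (d.*2.+1 - d = d.+1)%N by lia.
rewrite e3 /= in e2; rewrite /= in e1; rewrite doubleS expnS.
set x := 'C(_, _) in IH e2; set y := 'C(_, _) in e1 e2; set z := 'C(_, _) in e1 *.
rewrite -(leq_pmul2l (ltn0Sn d)).
have -> : (d.+1 * (d.*2.+2.+1 * z) = d.*2.+3 * (2 * (d.*2.+1 * x)))%N.
  by rewrite mulnCA -e1 e2 -doubleS -mul2n -!mulnA.
nia.
Qed.

(** * A local principle in a ring with an invertible shift *)

Section LocalInverse.
Context {R : realType} {Q : pzRingType} (sc : {rmorphism R[i] -> Q}).
(** [small x c] abstracts an upper bound c for a submultiplicative seminorm of x. The ring is kept
    abstract because the result is applied twice, to the quotient algebra for left inverses and to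
    its opposite for right inverses. *)
Variable small : Q -> R -> Prop.
Hypothesis scC : forall c x, sc c * x = x * sc c.
Hypothesis small_le : forall x c d, small x c -> c <= d -> small x d.
Hypothesis smallD : forall x y c d, small x c -> small y d ->
  small (x + y) (c + d).
Hypothesis smallM : forall x y c d, small x c -> small y d ->
  small (x * y) (c * d).
Hypothesis small_sc : forall c, small (sc c) (normc c).
Hypothesis small_ex : forall x, exists2 c, 0 <= c & small x c.
Variables U V : Q.
Hypothesis UV1 : U * V = 1.
Hypothesis VU1 : V * U = 1.
Hypothesis small_U : small U 1.
Hypothesis small_V : small V 1.

(* The trigonometric polynomial cos((x - s) / 2) ^ 2 in the shift V, with
   w = exp(i s). *)
Definition bump (w : R[i]) : Q := sc (w / 4%:R) * U * (1 + sc w^-1 * V) ^+ 2.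

Let small0 : small 0 0.
Proof. by have := small_sc 0; rewrite rmorph0 ComplexField.Normc.normc0. Qed.

Let small1 : small 1 1.
Proof. by have := small_sc 1; rewrite rmorph1 ComplexField.Normc.normc1. Qed.

Lemma small_sum (I : Type) (s : seq I) (F : I -> Q) (c : I -> R) :
  (forall i, small (F i) (c i)) ->
  small (\sum_(i <- s) F i) (\sum_(i <- s) c i).
Proof.
by move=> h; elim: s => [|i s IH]; rewrite ?big_nil// !big_cons; exact: smallD.
Qed.

Lemma smallX x c n : small x c -> small (x ^+ n) (c ^+ n).
Proof. by move=> h; elim: n => [//|n IH]; rewrite !exprS; exact: smallM. Qed.

Let commUV : GRing.comm U V.
Proof. by rewrite /GRing.comm UV1 VU1. Qed.

Lemma comm_sc c x : GRing.comm (sc c) x.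
Proof. exact: scC. Qed.

Lemma comm_bump (x : Q) w : GRing.comm x U -> GRing.comm x V ->
  GRing.comm x (bump w).
Proof.
move=> xU xV; apply: commrM; first by apply: commrM xU; exact/commr_sym/comm_sc.
apply: commrX; apply: commrD (commr1 _) _.
by apply: commrM xV; exact/commr_sym/comm_sc.
Qed.

Lemma bumpE w : w != 0 ->
  bump w = sc (w / 4%:R) * U + sc 2^-1 + sc (w^-1 / 4%:R) * V.
Proof.
move=> w0; set c := sc w^-1.
have e1 : U * (1 + c * V) = U + c.
  by rewrite mulrDr mulr1 mulrA -[U * c]comm_sc -mulrA UV1 mulr1.
have e2 : (U + c) * (1 + c * V) = U + (c + c) + c * c * V.
  by rewrite mulrDl e1 mulrDr mulr1 !mulrA !addrA.
rewrite /bump -mulrA expr2 [U * _]mulrA e1 e2 !mulrDr -!rmorphM/= -rmorphD/=.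
rewrite mulrA -!rmorphM/=.
by congr (_ * _ + sc _ + sc _ * _); field.
Qed.

(** As [bump w] is a monomial in [U] times a square, its d-th power is a binomial expansion of
    degree 2d; the index k = d is the constant Fourier mode. *)
Lemma bump_exp w d : w != 0 -> bump w ^+ d =
  \sum_(k < d.*2.+1) sc ((w / 4%:R) ^+ d * w^-1 ^+ k *+ 'C(d.*2, k)) *
    (U ^+ d * V ^+ k).
Proof.
move=> w0; have cV : GRing.comm (sc w^-1) V by exact: comm_sc.
have cUV : GRing.comm U (1 + sc w^-1 * V).
  by apply: commrD (commr1 _) _; apply: commrM => //; exact/commr_sym/comm_sc.
rewrite /bump exprMn_comm; last first.
  by apply/commr_sym/commrM; [exact/commr_sym/comm_sc|exact/commr_sym/commrX].
rewrite exprMn_comm; last exact: comm_sc.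
rewrite -exprM mul2n (exprDn_comm _ (commr_sym (commr1 _))) mulr_sumr.
apply: eq_bigr => k _; rewrite expr1n mul1r exprMn_comm// -!rmorphXn/=.
rewrite raddfMn/= rmorphM/= mulrnAr [in RHS]mulrnAl; congr (_ *+ _).
rewrite -!mulrA; congr (_ * _).
by rewrite !mulrA; congr (_ * _); rewrite [RHS]scC.
Qed.

(** The bound is exact: (1/4) (1 + 1)^2 = 1, so powers of bumps never grow. *)
Lemma small_bump w : normc w = 1 -> small (bump w) 1.
Proof.
move=> w1; rewrite /bump.
have nwV : normc w^-1 = 1 by rewrite ComplexField.Normc.normcV w1 invr1.
have -> : 1 = normc (w / 4%:R) * 1 * (1 + normc w^-1 * 1) ^+ 2 :> R.
  rewrite normcM ComplexField.Normc.normcV w1 nwV mul1r !mulr1.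
  have -> : (4%:R : R[i]) = 4%:R%:C by rewrite rmorph_nat.
  by rewrite normc_real ger0_norm// (_ : 1 + 1 = 2 :> R)//; field.
by apply: smallM; [apply: smallM|apply: smallX; apply: smallD => //; apply: smallM].
Qed.

Lemma small_bumpX w n : normc w = 1 -> small (bump w ^+ n) 1.
Proof. by move=> w1; have := smallX n (small_bump w1); rewrite expr1n. Qed.

Lemma normc1_neq0 (w : R[i]) : normc w = 1 -> w != 0.
Proof. by move=> w1; rewrite -normc_eq0 w1 oner_eq0. Qed.

Lemma small_bumpB v w : normc v = 1 -> normc w = 1 ->
  small (bump v - bump w) (normc (v - w)).
Proof.
move=> v1 w1; have v0 := normc1_neq0 v1; have w0 := normc1_neq0 w1.
rewrite !bumpE//.
have -> : sc (v / 4%:R) * U + sc 2^-1 + sc (v^-1 / 4%:R) * V -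
    (sc (w / 4%:R) * U + sc 2^-1 + sc (w^-1 / 4%:R) * V) =
    sc ((v - w) / 4%:R) * U + sc ((v^-1 - w^-1) / 4%:R) * V.
  have h (a b c a' c' : Q) : a + b + c - (a' + b + c') = (a - a') + (c - c').
    by rewrite opprD addrACA opprD [a + b + _]addrACA subrr addr0.
  by rewrite h -!mulrBl -!rmorphB/= -!mulrBl.
have n4 : normc (4%:R : R[i]) = 4%:R.
  have -> : (4%:R : R[i]) = 4%:R%:C by rewrite rmorph_nat.
  by rewrite normc_real ger0_norm.
apply: small_le (smallD (smallM (small_sc _) small_U)
  (smallM (small_sc _) small_V)) _.
have -> : v^-1 - w^-1 = (w - v) * (v^-1 * w^-1) by field; rewrite v0 w0.
rewrite !normcM !ComplexField.Normc.normcV v1 w1 n4.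
have -> : normc (w - v) = normc (v - w) by rewrite -opprB normcN.
by have := normc_ge0 (v - w); lra.
Qed.

Lemma small_bumpXB v w n : normc v = 1 -> normc w = 1 ->
  small (bump v ^+ n - bump w ^+ n) (n%:R * normc (v - w)).
Proof.
move=> v1 w1; elim: n => [|n IH]; first by rewrite subrr mul0r.
(* Telescoping, with all powers bounded by 1, gives a Lipschitz constant linear in n. *)
have -> : bump v ^+ n.+1 - bump w ^+ n.+1 =
    (bump v - bump w) * bump v ^+ n + bump w * (bump v ^+ n - bump w ^+ n).
  by rewrite mulrBl mulrBr -!exprS subrKA.
apply: small_le (smallD (smallM (small_bumpB v1 w1) (small_bumpX n v1))
  (smallM (small_bump w1) IH)) _.
by rewrite mulr1 mul1r -[n.+1]addn1 natrD mulrDl mul1r addrC.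
Qed.

(* Averaging over the (d+1)-st roots of unity keeps the constant Fourier
   coefficient of bump ^ d, a central binomial coefficient. *)
Lemma sum_bump_exp d : let M := d.+1 in
  \sum_(l < M) bump (cis (pi *+ 2 / M%:R *+ l)) ^+ d =
  sc (M%:R * 4%:R ^- d *+ 'C(d.*2, d)).
Proof.
move=> M.
under eq_bigr => l _ do rewrite (bump_exp d (cis_neq0 _)).
rewrite exchange_big/=.
have dlt : (d < d.*2.+1)%N by lia.
(* The term k = d survives with [U ^+ d * V ^+ d = 1]. Any other k carries the frequency d - k, of
   absolute value at most d < M, and is killed by the average over roots of unity. *)
rewrite (bigD1 (Ordinal dlt))//= [X in _ + X]big1 ?addr0 => [|k kd].
  rewrite -mulr_suml -raddf_sum/= -exprMn_comm// UV1 expr1n mulr1; congr (sc _).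
  rewrite (eq_bigr (fun=> 4%:R ^- d *+ 'C(d.*2, d))); last first.
    by move=> l _; rewrite -exprMn mulrAC mulfV ?cis_neq0// mul1r exprVn.
  rewrite sumr_const card_ord mulrnAC; congr (_ *+ _).
  by rewrite -[LHS]mulr_natl.
rewrite -mulr_suml -raddf_sum/= [X in sc X](_ : _ = 0) ?rmorph0 ?mul0r//.
under eq_bigr => l _ do rewrite exprMn mulrAC.
rewrite sumrMnl -mulr_suml.
have kd0 : (d%:Z - k%:Z != 0)%R.
  by apply: contra kd => /eqP e; apply/eqP/val_inj => /=; lia.
have kdM : (`|(d%:Z - k%:Z)%R| < M)%N by have := ltn_ord k; rewrite /M; lia.
rewrite (_ : \sum_(i < M) _ = 0) ?mul0r ?mul0rn//.
rewrite -[RHS](@sum_cis_root R M _ kd0 kdM); apply: eq_bigr => l _.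
rewrite -cisN !cisX -cisD; congr cis.
rewrite [in RHS]mulrAC mulrzr mulrzBr -!pmulrn mulrnBl mulNrn.
by rewrite mulrnAC [_ *+ k *+ l]mulrnAC.
Qed.

(** With [X = B A - 1] and [P] a bump, the truncated Neumann sum satisfies [(\sum_(k < m) (- X) ^+
    k) * (B A) = 1 - (- X) ^+ m]. Multiplying by [P ^+ (N m)] turns the error into
    [(X P ^+ N) ^+ m], so each centre contributes at most 2^-m, against about N m centres. *)
Lemma left_inverse_of_local (A : Q) :
    GRing.comm A U -> GRing.comm A V ->
    (forall t, t \in `[0, pi *+ 2] -> exists B N,
       [/\ GRing.comm B U, GRing.comm B V &
          small ((B * A - 1) * bump (cis t) ^+ N) 4%:R^-1]) ->
  exists L, small (L * A - 1) 2^-1.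
Proof.
move=> AU AV loc.
pose Pr (N : nat) (t : R) := exists B,
  [/\ GRing.comm B U, GRing.comm B V &
     small ((B * A - 1) * bump (cis t) ^+ N) 2^-1].
(* The exponent has to be the same for all centres. The local bound 1/4 leaves room to move the
   centre at the price 1/2, and raising the exponent costs nothing because bumps have norm at most
   1; compactness then yields one [N]. *)
have [N PrN] : exists N, forall t, t \in `[0, pi *+ 2] -> Pr N t.
  have /compact_near_coveringP := @segment_compact R 0 (pi *+ 2).
  move=> /(_ nat \oo Pr _) [|n _ h]; last first.
    by exists n => t tI; apply: h => //=.
  move=> t tI; have [|B [N [BU BV hB]]] := loc t; first by [].
  have [C C0 hC] := small_ex (B * A - 1).
  (* Chosen so that moving the centre by less than [e] changes the product by at most C N e <=
     1/4. *)
  pose e := (4%:R * (C + 1) * (N%:R + 1))^-1 : R.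
  have e0 : 0 < e by rewrite invr_gt0 !mulr_gt0// ltr_wpDl.
  exists ([set s | normc (cis s - cis t) < e], [set n | (N <= n)%N]) => /=.
    by split; [exact: cis_near|exact: nbhs_infty_ge].
  move=> [s n] /= [se Nn]; exists B; split => //.
  rewrite -(subnKC Nn) exprD mulrA.
  have -> : bump (cis s) ^+ N = bump (cis t) ^+ N +
      (bump (cis s) ^+ N - bump (cis t) ^+ N) by rewrite addrC subrK.
  rewrite mulrDr.
  apply: small_le (smallM (smallD hB (smallM hC
    (small_bumpXB N (normc_cis s) (normc_cis t))))
    (small_bumpX _ (normc_cis s))) _.
  rewrite mulr1; have : C * (N%:R * normc (cis s - cis t)) <= 4%:R^-1.
    have eE : 4%:R^-1 = (C + 1) * ((N%:R + 1) * e).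
      by rewrite /e; field; rewrite !gt_eqF// ltr_wpDl.
    rewrite eE; apply: ler_pM => //; rewrite ?mulr_ge0 ?normc_ge0 ?lerDl//.
    by apply: ler_pM; rewrite ?normc_ge0 ?lerDl// ltW.
  lra.
have [m hm] : exists m, 2 * (N * m).+1%:R * 2^-1 ^+ m <= 2^-1 :> R.
  have [m hm] : exists m : nat, (4 * (N * m).+1 <= 2 ^ m)%N.
    (* With m = 2k one has 4 (N m + 1) <= k (k + 1) <= 2^k 2^k = 2^m. *)
    pose k := (8 * N + 4)%N; exists (2 * k)%N; rewrite mul2n -addnn expnD.
    apply: (@leq_trans ((8 * N + 4) * k.+1)); first by rewrite /k; nia.
    by apply: leq_mul; [exact: ltnW (ltn_expl _ _)|exact: ltn_expl].
  exists m; move: hm; rewrite -(ler_nat R) natrM natrX => hm.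
  rewrite exprVn ler_pdivrMr ?exprn_gt0//.
  by move: hm; set x := _%:R; set y := 2 ^+ m; lra.
have [B hB] : exists B : R -> Q, forall t, t \in `[0, pi *+ 2] ->
   [/\ GRing.comm (B t) U, GRing.comm (B t) V &
     small ((B t * A - 1) * bump (cis t) ^+ N) 2^-1].
  have /choice[B hB] : forall t, exists B, t \in `[0, pi *+ 2] -> 
   [/\ GRing.comm B U, GRing.comm B V &
     small ((B * A - 1) * bump (cis t) ^+ N) 2^-1].
    move=> t; have [/PrN[B ?]|] := boolP (t \in `[0, pi *+ 2]); first by exists B.
    by exists 0.
  by exists B.
pose d := (N * m)%N; pose M := d.+1.
pose t (l : 'I_M) : R := pi *+ 2 / M%:R *+ l.
have tI l : t l \in `[0, pi *+ 2].
  have pi2 : 0 < pi *+ 2 :> R by rewrite pmulrn_lgt0// pi_gt0.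
  rewrite in_itv/= /t -[_ *+ l]mulr_natr mulr_ge0 ?divr_ge0 ?(ltW pi2)//=.
  rewrite mulrAC ler_pdivrMr ?ltr0n// ler_pM2l// ler_nat ltnW//.
pose X l := B (t l) * A - 1.
pose P l := bump (cis (t l)).
(* Commutation is what allows [X ^+ m * P ^+ (N * m)] to be rewritten as [(X * P ^+ N) ^+ m]. *)
have XP l : GRing.comm (X l) (P l).
  have [BU BV _] := hB _ (tI l).
  apply: comm_bump.
    by apply/commr_sym/commrB; [apply: commrM; exact/commr_sym|exact: commr1].
  by apply/commr_sym/commrB; [apply: commrM; exact/commr_sym|exact: commr1].
have smallXP l : small (X l ^+ m * P l ^+ d) (2^-1 ^+ m).
  rewrite exprM -exprMn_comm; last exact/commrX/XP.
  by apply: smallX; have [] := hB _ (tI l).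
pose c := (M%:R * 4%:R ^- d *+ 'C(d.*2, d))^-1 : R[i].
have c_inv : c * (M%:R * 4%:R ^- d *+ 'C(d.*2, d)) = 1.
  have b0 : (0 < 'C(d.*2, d))%N by rewrite bin_gt0; lia.
  by rewrite mulVf// -mulr_natr !mulf_neq0 ?invr_eq0 ?expf_neq0 ?pnatr_eq0 -?lt0n.
(* By the central binomial bound the mean value is at least M / (2d + 1), and 2d + 1 < 2M. *)
have nc : normc c <= 2.
  have -> : c = ((M%:R * 4%:R ^- d *+ 'C(d.*2, d))^-1 : R)%:C.
    rewrite /c fmorphV rmorphMn rmorphM fmorphV rmorphXn !rmorph_nat.
    by [].
  have := central_bin_ge d; rewrite -(ler_nat R) natrM natrX => hb.
  have p4 : 0 < 4%:R ^+ d :> R by rewrite exprn_gt0.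
  have hx : 2^-1 <= M%:R * 4%:R ^- d *+ 'C(d.*2, d) :> R.
    rewrite -[_ *+ 'C(_, _)]mulr_natr mulrAC ler_pdivlMr//.
    have b0 : 0 <= 'C(d.*2, d)%:R :> R by [].
    have e : d.*2.+1%:R + 1 = 2 * M%:R :> R.
      by rewrite -natr1 /M -[d.+1%:R]natr1 -muln2 natrM; ring.
    by move: hb b0 e; set x := 'C(_, _)%:R; set y := _%:R; set z := M%:R; nra.
  have hx0 : 0 < M%:R * 4%:R ^- d *+ 'C(d.*2, d) :> R by apply: lt_le_trans hx.
  rewrite normc_real ger0_norm ?invr_ge0 ?(ltW hx0)//.
  by rewrite -[leRHS]invrK lef_pV2 ?posrE ?invr_gt0.
have sP : \sum_(l < M) sc c * P l ^+ d = 1.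
  by rewrite -mulr_sumr sum_bump_exp -rmorphM/= c_inv rmorph1.
pose L := \sum_(l < M) sc c * ((\sum_(k < m) (- X l) ^+ k) * P l ^+ d * B (t l)).
exists L.
have LA : L * A - 1 = \sum_(l < M) sc (- c) * ((- X l) ^+ m * P l ^+ d).
  rewrite -{1}sP mulr_suml -sumrB; apply: eq_bigr => l _.
  rewrite -!mulrA -mulrBr rmorphN/= mulNr -mulrN; congr (_ * _).
  have -> : B (t l) * A = 1 - - X l by rewrite opprK /X addrC subrK.
  have c1 : GRing.comm (P l ^+ d) (1 - - X l).
    by apply/commr_sym/commrX/commr_sym/commrB;[exact: commr1|apply/commrN/commr_sym/XP].
  rewrite c1 mulrA.
  have -> : (\sum_(k < m) (- X l) ^+ k) * (1 - - X l) = 1 - (- X l) ^+ m.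
    have /commr_sym -> : GRing.comm (1 - - X l) (\sum_(k < m) (- X l) ^+ k).
      apply: commr_sum => k _; apply: commrX; apply/commr_sym/commrB => //.
      exact: commr1.
    by rewrite -opprB mulNr -subrX1 opprB.
  by rewrite mulrBl mul1r addrAC subrr add0r.
rewrite LA; apply: small_le (small_sum _ _) _.
  move=> l; apply: smallM (small_sc _) _; rewrite exprNn -mulrA.
  have sN : small (-1) 1.
    have := small_sc (-1); rewrite rmorphN rmorph1 normcN.
    by rewrite ComplexField.Normc.normc1.
  exact: smallM (smallX m sN) (smallXP l).
rewrite normcN sumr_const card_ord expr1n mul1r -[_ *+ M]mulr_natl.
apply: le_trans _ hm; rewrite mulrCA -mulrA; apply: ler_wpM2r.
  by rewrite mulr_ge0 ?exprn_ge0// invr_ge0.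
exact: nc.
Qed.

End LocalInverse.

(** * Bounded operators modulo finite rank *)

Structure banach (R : realType) := Banach {
  bcar :> lmodType R[i];
  bnorm : bcar -> R;
  bnorm_ge0 : forall x, 0 <= bnorm x;
  bnorm_eq0 : forall x, bnorm x = 0 -> x = 0;
  bnormZ : forall (c : R[i]) x, bnorm (c *: x) = normc c * bnorm x;
  bnormD : forall x y, bnorm (x + y) <= bnorm x + bnorm y;
  bcomplete : forall u : nat -> bcar,
    (forall e, 0 < e ->
       exists n, forall m k, (n <= m)%N -> (n <= k)%N -> bnorm (u m - u k) < e) ->
    exists l, forall e, 0 < e -> exists n, forall m, (n <= m)%N -> bnorm (u m - l) < e }.

Section BoundedOperators.
Context {R : realType} {E : banach R}.
Implicit Types (x y : E) (s : seq E).
Local Notation N := (@bnorm R E).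

Lemma bnorm0 : N 0 = 0.
Proof. by rewrite -(scale0r (0 : E)) bnormZ ComplexField.Normc.normc0 mul0r. Qed.

Lemma bnormN x : N (- x) = N x.
Proof. by rewrite -scaleN1r bnormZ normcN ComplexField.Normc.normc1 mul1r. Qed.

Lemma bnormB x y : N (x - y) = N (y - x).
Proof. by rewrite -bnormN opprB. Qed.

Record bop := Bop {
  bfun :> E -> E;
  bop_linear : forall c x y, bfun (c *: x + y) = c *: bfun x + bfun y;
  bop_bounded : exists2 C, 0 <= C & forall x, N (bfun x) <= C * N x }.

Implicit Types (f g h : bop).

Lemma bopP f g : (forall x, f x = g x) -> f = g.
Proof.
case: f g => f lf bf [g lg bg] /= /funext fg; subst g.
by congr Bop; exact: Prop_irrelevance.
Qed.

Lemma bop0 f : f 0 = 0.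
Proof.
have := bop_linear f (-1) 0 0.
by rewrite scaler0 addr0 scaleN1r addNr.
Qed.

Lemma bopD f x y : f (x + y) = f x + f y.
Proof. by have := bop_linear f 1 x y; rewrite !scale1r. Qed.

Lemma bopZ f c x : f (c *: x) = c *: f x.
Proof. by have := bop_linear f c x 0; rewrite !addr0 bop0 addr0. Qed.

Lemma bopN f x : f (- x) = - f x.
Proof. by rewrite -scaleN1r bopZ scaleN1r. Qed.

Lemma bopB f x y : f (x - y) = f x - f y.
Proof. by rewrite bopD bopN. Qed.

Definition opnorm_le f c := 0 <= c /\ forall x, N (f x) <= c * N x.

Lemma opnorm_ex f : exists c, opnorm_le f c.
Proof. by have [c c0 h] := bop_bounded f; exists c. Qed.

Lemma bop_zero_subproof : exists2 C, 0 <= C & forall x, N (0 : E) <= C * N x.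
Proof. by exists 0 => // x; rewrite mul0r bnorm0. Qed.

Definition bop_zero : bop :=
  @Bop (fun=> 0) (fun c x y => esym (etrans (addr0 _) (scaler0 _ c))) bop_zero_subproof.

Fact bop_opp_subproof f :
  (forall c x y, - f (c *: x + y) = c *: - f x + - f y) /\
  exists2 C, 0 <= C & forall x, N (- f x) <= C * N x.
Proof.
split=> [c x y|]; first by rewrite bop_linear opprD scalerN.
by have [c c0 h] := bop_bounded f; exists c => // x; rewrite bnormN.
Qed.

Definition bop_opp f : bop :=
  Bop (bop_opp_subproof f).1 (bop_opp_subproof f).2.

Fact bop_add_subproof f g :
  (forall c x y, f (c *: x + y) + g (c *: x + y) =
     c *: (f x + g x) + (f y + g y)) /\
  exists2 C, 0 <= C & forall x, N (f x + g x) <= C * N x.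
Proof.
split=> [c x y|]; first by rewrite !bop_linear scalerDr addrACA.
have [c c0 h] := bop_bounded f; have [d d0 h'] := bop_bounded g.
exists (c + d) => [|x]; first exact: addr_ge0.
by rewrite (le_trans (bnormD _ _))// mulrDl lerD.
Qed.

Definition bop_add f g : bop :=
  Bop (bop_add_subproof f g).1 (bop_add_subproof f g).2.

Fact bop_scal_subproof (a : R[i]) :
  (forall c x y, a *: (c *: x + y) = c *: (a *: x) + a *: y) /\
  exists2 C, 0 <= C & forall x, N (a *: x) <= C * N x.
Proof.
split=> [c x y|]; first by rewrite scalerDr !scalerA mulrC.
by exists (normc a) => [|x]; rewrite ?normc_ge0// bnormZ.
Qed.

Definition bop_scal a : bop :=
  Bop (bop_scal_subproof a).1 (bop_scal_subproof a).2.

Fact bop_mul_subproof f g :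
  (forall c x y, f (g (c *: x + y)) = c *: f (g x) + f (g y)) /\
  exists2 C, 0 <= C & forall x, N (f (g x)) <= C * N x.
Proof.
split=> [c x y|]; first by rewrite !bop_linear.
have [c c0 h] := bop_bounded f; have [d d0 h'] := bop_bounded g.
exists (c * d) => [|x]; first exact: mulr_ge0.
by rewrite (le_trans (h _))// -mulrA ler_wpM2l.
Qed.

Definition bop_mul f g : bop :=
  Bop (bop_mul_subproof f g).1 (bop_mul_subproof f g).2.

HB.instance Definition _ := gen_eqMixin bop.
HB.instance Definition _ := gen_choiceMixin bop.

Fact bop_addA : associative bop_add.
Proof. by move=> f g h; apply: bopP => x /=; rewrite addrA. Qed.
Fact bop_addC : commutative bop_add.
Proof. by move=> f g; apply: bopP => x /=; rewrite addrC. Qed.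
Fact bop_add0 : left_id bop_zero bop_add.
Proof. by move=> f; apply: bopP => x /=; rewrite add0r. Qed.
Fact bop_addN : left_inverse bop_zero bop_opp bop_add.
Proof. by move=> f; apply: bopP => x /=; rewrite addNr. Qed.

HB.instance Definition _ :=
  GRing.isZmodule.Build bop bop_addA bop_addC bop_add0 bop_addN.

Fact bop_mulA : associative bop_mul.
Proof. by move=> f g h; apply: bopP. Qed.
Fact bop_mul1l : left_id (bop_scal 1) bop_mul.
Proof. by move=> f; apply: bopP => x /=; rewrite scale1r. Qed.
Fact bop_mul1r : right_id (bop_scal 1) bop_mul.
Proof. by move=> f; apply: bopP => x /=; rewrite scale1r. Qed.
Fact bop_mulDl : left_distributive bop_mul +%R.
Proof. by move=> f g h; apply: bopP. Qed.
Fact bop_mulDr : right_distributive bop_mul +%R.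
Proof. by move=> f g h; apply: bopP => x; rewrite /= bopD. Qed.

HB.instance Definition _ := GRing.Zmodule_isPzRing.Build bop
  bop_mulA bop_mul1l bop_mul1r bop_mulDl bop_mulDr.

Lemma bop1E x : (1 : bop) x = x.
Proof. exact: scale1r. Qed.

Lemma bop_subE f g x : (f - g) x = f x - g x.
Proof. by []. Qed.

(* The span of s, in a form suited to induction on s. *)
Fixpoint spanned s x : Prop :=
  if s is v :: s' then exists c : R[i], spanned s' (x - c *: v) else x = 0.

Lemma spanned0 s : spanned s 0.
Proof. by elim: s => //= v s IH; exists 0; rewrite scale0r subr0. Qed.

Lemma spanned_lin s c x y : spanned s x -> spanned s y -> spanned s (c *: x + y).
Proof.
elim: s x y => /= [x y -> ->|v s IH x y [a hx] [b hy]].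
  by rewrite scaler0 addr0.
exists (c * a + b).
have -> : c *: x + y - (c * a + b) *: v = c *: (x - a *: v) + (y - b *: v).
  by rewrite scalerBr scalerA addrACA scalerDl opprD.
exact: IH.
Qed.

Lemma spannedD s x y : spanned s x -> spanned s y -> spanned s (x + y).
Proof. by move=> hx hy; have := spanned_lin 1 hx hy; rewrite scale1r. Qed.

Lemma spannedZ s c x : spanned s x -> spanned s (c *: x).
Proof. by move=> hx; have := spanned_lin c hx (spanned0 s); rewrite addr0. Qed.

Lemma spannedN s x : spanned s x -> spanned s (- x).
Proof. by rewrite -scaleN1r; exact: spannedZ. Qed.

Lemma spanned_cat s t x y : spanned s x -> spanned t y -> spanned (s ++ t) (x + y).
Proof.
elim: s x => /= [x ->|v s IH x [c h] ht]; first by rewrite add0r.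
by exists c; rewrite addrAC; apply: IH.
Qed.

Lemma spanned_map f s x : spanned s x -> spanned (map f s) (f x).
Proof.
elim: s x => /= [x ->|v s IH x [c h]]; first exact: bop0.
by exists c; rewrite -bopZ -bopB; exact: IH.
Qed.

Definition finite_rank f : Prop := exists s, forall x, spanned s (f x).

Definition frank_pred : {pred bop} := fun f => `[< finite_rank f >].

Fact frank_zmod_closed : zmod_closed frank_pred.
Proof.
split; first by apply/asboolP; exists [::] => x.
move=> f g /asboolP[s hs] /asboolP[t ht]; apply/asboolP; exists (s ++ t) => x.
by apply: spanned_cat => //; exact: spannedN.
Qed.

HB.instance Definition _ := GRing.isZmodClosed.Build bop frank_pred frank_zmod_closed.

(** The analogue of the Calkin algebra for finite rank instead of compact operators. [Quotient.quot]
    supplies only the additive group; the product is defined below on representatives. *)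
Definition calkin : Type := Quotient.quot frank_pred.
HB.instance Definition _ := GRing.Zmodule.on calkin.

Definition cl (f : bop) : calkin :=
  (\pi_(Quotient.quot frank_pred) f)%qT.

Lemma clP f g : cl f = cl g <-> finite_rank (f - g).
Proof.
split=> [/eqP|h]; first by rewrite -Quotient.idealrBE => /asboolP.
by apply/eqP; rewrite -Quotient.idealrBE; apply/asboolP.
Qed.

Lemma cl_surj (X : calkin) : exists f, cl f = X.
Proof. by exists (repr X); rewrite /cl reprK. Qed.

Lemma clB : {morph cl : f g / f - g}.
Proof. by move=> f g; rewrite /cl raddfB. Qed.

Lemma clD : {morph cl : f g / f + g}.
Proof. by move=> f g; rewrite /cl raddfD. Qed.

Lemma finite_rankMl f g : finite_rank f -> finite_rank (g * f).
Proof. by move=> [s hs]; exists (map g s) => x; exact: spanned_map. Qed.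

Lemma finite_rankMr f g : finite_rank f -> finite_rank (f * g).
Proof. by move=> [s hs]; exists s => x; exact: hs. Qed.

Lemma finite_rankD f g : finite_rank f -> finite_rank g -> finite_rank (f + g).
Proof.
by move=> [s hs] [t ht]; exists (s ++ t) => x; exact: spanned_cat.
Qed.

Definition calkin_mul (X Y : calkin) : calkin :=
  cl (repr X * repr Y).

Lemma cl_repr (X : calkin) : cl (repr X) = X.
Proof. exact: reprK. Qed.

Lemma cl_mulE f g : calkin_mul (cl f) (cl g) = cl (f * g).
Proof.
apply/clP; set f' := repr _; set g' := repr _.
have -> : f' * g' - f * g = f' * (g' - g) + (f' - f) * g.
  by rewrite mulrBr mulrBl subrKA.
apply: finite_rankD.
  by apply: finite_rankMl; apply/clP; rewrite cl_repr.
by apply: finite_rankMr; apply/clP; rewrite cl_repr.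
Qed.

Fact calkin_mulA : associative calkin_mul.
Proof.
move=> X Y Z; have [f <-] := cl_surj X; have [g <-] := cl_surj Y.
by have [h <-] := cl_surj Z; rewrite !cl_mulE mulrA.
Qed.
Fact calkin_mul1l : left_id (cl 1) calkin_mul.
Proof. by move=> X; have [f <-] := cl_surj X; rewrite cl_mulE mul1r. Qed.
Fact calkin_mul1r : right_id (cl 1) calkin_mul.
Proof. by move=> X; have [f <-] := cl_surj X; rewrite cl_mulE mulr1. Qed.
Fact calkin_mulDl : left_distributive calkin_mul +%R.
Proof.
move=> X Y Z; have [f <-] := cl_surj X; have [g <-] := cl_surj Y.
by have [h <-] := cl_surj Z; rewrite -clD !cl_mulE mulrDl clD.
Qed.
Fact calkin_mulDr : right_distributive calkin_mul +%R.
Proof.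
move=> X Y Z; have [f <-] := cl_surj X; have [g <-] := cl_surj Y.
by have [h <-] := cl_surj Z; rewrite -clD !cl_mulE mulrDr clD.
Qed.

HB.instance Definition _ := GRing.Zmodule_isPzRing.Build calkin
  calkin_mulA calkin_mul1l calkin_mul1r calkin_mulDl calkin_mulDr.

Lemma clM : {morph cl : f g / f * g}.
Proof. by move=> f g; rewrite -cl_mulE. Qed.

Lemma cl1 : cl 1 = 1.
Proof. by []. Qed.

Lemma clX f n : cl (f ^+ n) = cl f ^+ n.
Proof. by elim: n => [|n IH]; rewrite ?expr0 ?cl1// !exprS clM IH. Qed.

Definition calkin_scal (c : R[i]) : calkin := cl (bop_scal c).

Fact calkin_scal_additive : zmod_morphism calkin_scal.
Proof.
move=> c d; rewrite /calkin_scal -clB; congr cl; apply: bopP => x /=.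
by rewrite scalerBl.
Qed.

Fact calkin_scal_multiplicative : monoid_morphism calkin_scal.
Proof.
split; first by [].
move=> c d; rewrite /calkin_scal -clM; congr cl; apply: bopP => x /=.
by rewrite scalerA.
Qed.

HB.instance Definition _ := GRing.isZmodMorphism.Build R[i] calkin calkin_scal
  calkin_scal_additive.
HB.instance Definition _ := GRing.isMonoidMorphism.Build R[i] calkin calkin_scal
  calkin_scal_multiplicative.

Lemma calkin_scalC c X : calkin_scal c * X = X * calkin_scal c.
Proof.
have [f <-] := cl_surj X; rewrite /calkin_scal -!clM; congr cl.
by apply: bopP => x /=; rewrite bopZ.
Qed.

(** An upper bound for the quotient seminorm, realised by an actual representative; stating it this
    way avoids an infimum and its epsilons. *)
Definition ess_le (X : calkin) (c : R) : Prop :=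
  exists2 f, cl f = X & opnorm_le f c.

Lemma ess_le_cl f c : opnorm_le f c -> ess_le (cl f) c.
Proof. by exists f. Qed.

Lemma ess_le_trans X c d : ess_le X c -> c <= d -> ess_le X d.
Proof.
move=> [f fX [c0 h]] cd; exists f => //; split; first exact: le_trans cd.
by move=> x; rewrite (le_trans (h x))// ler_wpM2r// bnorm_ge0.
Qed.

Lemma ess_leD X Y c d : ess_le X c -> ess_le Y d -> ess_le (X + Y) (c + d).
Proof.
move=> [f <- [c0 hf]] [g <- [d0 hg]]; exists (f + g); first exact: clD.
split=> [|x]; first exact: addr_ge0.
by rewrite (le_trans (bnormD _ _))// mulrDl lerD.
Qed.

Lemma ess_leM X Y c d : ess_le X c -> ess_le Y d -> ess_le (X * Y) (c * d).
Proof.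
move=> [f <- [c0 hf]] [g <- [d0 hg]]; exists (f * g); first exact: clM.
split=> [|x]; first exact: mulr_ge0.
by rewrite (le_trans (hf _))// -mulrA ler_wpM2l.
Qed.

Lemma ess_le_scal c : ess_le (calkin_scal c) (normc c).
Proof.
by exists (bop_scal c) => //; split=> [|x]; rewrite ?normc_ge0//= bnormZ.
Qed.

Lemma ess_le_ex X : exists2 c, 0 <= c & ess_le X c.
Proof.
have [f <-] := cl_surj X; have [c [c0 h]] := opnorm_ex f.
by exists c => //; exists f.
Qed.

End BoundedOperators.
Arguments bop {R} E.
Arguments calkin {R} E.

(** * Successive approximation, the open mapping theorem and Neumann inversion *)

Section OpenMapping.
Context {R : realType} {E : banach R}.
Implicit Types (x y : E) (s : seq E) (f g h T : bop E).
Local Notation N := (@bnorm R E).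

Lemma le_of_le_add_eps (a b : R) : (forall e, 0 < e -> a <= b + e) -> a <= b.
Proof. by move=> h; apply/ler_addgt0Pr. Qed.

(** The radii at least halve, so the closed balls of centre [y n] and radius [r n] are nested and
    shrink to one point. This one limit argument serves iterative solving, the Baire argument and
    extension by density. *)
Lemma nested_limit (y : nat -> E) (r : nat -> R) :
    (forall n, 0 <= r n) -> (forall n, N (y n.+1 - y n) <= r n / 2) ->
    (forall n, r n.+1 <= r n / 2) ->
  exists l, forall n, N (l - y n) <= r n.
Proof.
move=> r0 hy hr.
have tri k n : N (y (n + k)%N - y n) <= r n.
  elim: k n => [|k IH] n; first by rewrite addn0 subrr bnorm0.
  rewrite -(subrKA (y n.+1)) (le_trans (bnormD _ _))// [leRHS]splitr.
  by rewrite lerD// addnS -addSn (le_trans (IH _)).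
have rn n : r n <= r 0%N * 2^-1 ^+ n.
  elim: n => [|n IH]; first by rewrite expr0 mulr1.
  rewrite (le_trans (hr _))// exprSr mulrA ler_wpM2r//.
have r_small e : 0 < e -> exists n, r n < e.
  move=> e0; have [n hn] : exists n : nat, r 0%N / e < n%:R.
    by exists (Num.bound (r 0%N / e)); exact: archi_boundP (divr_ge0 (r0 _) (ltW e0)).
  exists n; apply: le_lt_trans (rn n) _; rewrite exprVn ltr_pdivrMr ?exprn_gt0//.
  rewrite -ltr_pdivrMl// mulrC (lt_trans hn)// -natrX ltr_nat; exact: ltn_expl.
have [e e0|l hl] := bcomplete (u := y).
  have [n hn] := r_small (e / 2) (divr_gt0 e0 (ltr0n _ 2)).
  exists n => m k nm nk; rewrite -(subnKC nm) -(subnKC nk).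
  rewrite -(subrKA (y n)) (splitr e).
  apply: le_lt_trans (bnormD _ _) _; rewrite [N (y n - _)]bnormB.
  by rewrite ltrD// (le_lt_trans (tri _ _)).
exists l => n; apply: le_of_le_add_eps => e /hl[m hm].
rewrite -(subrKA (y (n + m)%N)) (le_trans (bnormD _ _))// addrC lerD//.
by rewrite bnormB ltW// hm// leq_addl.
Qed.

(** An approximate solution with relative error 1/2 is iterated on the residue; the corrections form
    a geometric series, whence the factor 2. *)
Lemma approx_surjective (T : bop E) (K : R) : 0 <= K ->
    (forall y, exists2 x, N x <= K * N y & N (y - T x) <= N y / 2) ->
  forall y, exists2 x, T x = y & N x <= 2 * K * N y.
Proof.
move=> K0 H y; have [h [h1 h2]] : exists h : E -> E,
    (forall y, N (h y) <= K * N y) /\ (forall y, N (y - T (h y)) <= N y / 2).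
  have /choice[h hP] : forall y, exists x, N x <= K * N y /\ N (y - T x) <= N y / 2.
    by move=> z; have [x] := H z; exists x.
  by exists h; split=> z; have [] := hP z.
pose Y := fix Y n := if n is m.+1 then Y m - T (h (Y m)) else y.
pose X := fix X n := if n is m.+1 then X m + h (Y m) else 0.
have NY n : N (Y n) <= N y * 2^-1 ^+ n.
  elim: n => [|n IH]; first by rewrite expr0 mulr1.
  by rewrite /= (le_trans (h2 _))// exprSr mulrA ler_wpM2r.
have XY n : y - T (X n) = Y n.
  elim: n => [|n IH]; first by rewrite /= bop0 subr0.
  by rewrite /= bopD opprD addrA IH.
pose r n : R := 2 * K * N y * 2^-1 ^+ n.
have r0 n : 0 <= r n by rewrite /r !mulr_ge0 ?bnorm_ge0// exprn_ge0// invr_ge0.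
have hr n : r n.+1 <= r n / 2 by rewrite /r exprSr mulrA.
have hX n : N (X n.+1 - X n) <= r n / 2.
  rewrite /= addrAC subrr add0r (le_trans (h1 _))//.
  apply: (le_trans (ler_wpM2l K0 (NY n))).
  by rewrite le_eqVlt /r; apply/orP; left; apply/eqP; field.
have [l hl] := nested_limit r0 hX hr.
exists l; last by have := hl 0%N; rewrite /= subr0 /r expr0 mulr1.
have [C [C0 hC]] := opnorm_ex T.
apply/eqP; rewrite eq_sym -subr_eq0; apply/eqP/bnorm_eq0/eqP.
rewrite eq_le bnorm_ge0 andbT; apply: le_of_le_add_eps => e e0; rewrite add0r.
pose D := N y + C * (2 * K * N y).
have D0 : 0 <= D by rewrite addr_ge0 ?mulr_ge0 ?bnorm_ge0.
have [n hn] : exists n : nat, D / e < n%:R.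
  by exists (Num.bound (D / e)); exact: archi_boundP (divr_ge0 D0 (ltW e0)).
rewrite -(subrKA (T (X n))) XY -bopB (le_trans (bnormD _ _))//.
apply: (@le_trans _ _ (D * 2^-1 ^+ n)).
  rewrite /D mulrDl lerD// (le_trans (hC _))// -[C * _ * _]mulrA ler_wpM2l//.
  by rewrite bnormB (le_trans (hl _)).
rewrite exprVn ler_pdivrMr ?exprn_gt0// -ler_pdivrMl// mulrC ltW// (lt_le_trans hn)//.
by rewrite -natrX ler_nat ltnW// ltn_expl.
Qed.

(** Otherwise every ball contains a smaller one at positive distance from the image of the n-th ball
    of the domain. The limit of the nested balls so obtained would be [T x] for some x, which lies
    in one of the excluded images. *)
Lemma baire_ball (T : bop E) : (forall y, exists x, T x = y) ->
  exists n : nat, exists y0 : E, exists2 r : R, 0 < r &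
    forall y, N (y - y0) < r -> forall e, 0 < e ->
      exists2 x, N x <= n%:R & N (y - T x) < e.
Proof.
move=> surj; apply: contrapT => contra.
have step n (y0 : E) (r : R) : exists p : E * R, 0 < r ->
    [/\ N (p.1 - y0) <= r / 2, 0 < p.2, p.2 <= r / 2 &
       forall x, N x <= n%:R -> p.2 < N (p.1 - T x)].
  have [r0|] := boolP (0 < r); last by exists (0, 0).
  apply: contrapT => no; apply: contra; exists n, y0, (r / 2); first exact: divr_gt0.
  move=> y hy e e0; apply: contrapT => no'; apply: no.
  (* Half of [e] keeps the whole new ball away from the image, since all image points are at
     distance at least [e] from its centre. *)
  exists (y, Num.min (r / 2) (e / 2)) => _ /=; split => //.
  - exact: ltW.
  - by rewrite lt_min !divr_gt0.
  - by rewrite ge_min lexx.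
  - move=> x xn; rewrite gt_min; apply/orP; right.
    apply: (@lt_le_trans _ _ e); first lra.
    by rewrite leNgt; apply/negP => h; apply: no'; exists x.
have /choice[st hst] : forall q : nat * (E * R), exists p : E * R, 0 < q.2.2 ->
    [/\ N (p.1 - q.2.1) <= q.2.2 / 2, 0 < p.2, p.2 <= q.2.2 / 2 &
       forall x, N x <= q.1%:R -> p.2 < N (p.1 - T x)].
  by move=> [n [y0 r]] /=; exact: step.
pose p := fix p n := if n is m.+1 then st (m, p m) else (0 : E, 1 : R).
have p0 n : 0 < (p n).2.
  by elim: n => [|n IH] //=; have [] := hst (n, p n) IH.
have [l hl] := @nested_limit (fun n => (p n).1) (fun n => (p n).2)
  (fun n => ltW (p0 n)) (fun n => let: And4 h _ _ _ := hst (n, p n) (p0 n) in h)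
  (fun n => let: And4 _ _ h _ := hst (n, p n) (p0 n) in h).
have [x xl] := surj l.
pose n := Num.bound (N x).
have xn : N x <= n%:R by rewrite ltW// archi_boundP// bnorm_ge0.
have [_ _ _ /(_ x xn)] := hst (n, p n) (p0 n).
by rewrite xl ltNge bnormB (hl n.+1).
Qed.

Lemma open_mapping (T : bop E) : (forall y, exists x, T x = y) ->
  exists2 C, 0 <= C & forall y, exists2 x, T x = y & N x <= C * N y.
Proof.
move=> /baire_ball[n [y0 [r r0 hball]]].
(* After scaling [y] to norm r/2, it is approximated by [T (x1 - x2)] with [x1], [x2] of norm at
   most n. Scaling back gives 2n (2 |y| / r), and the two errors r/8 add up to half of r/2. *)
pose K : R := 4%:R * n%:R / r.
have K0 : 0 <= K by rewrite divr_ge0 ?mulr_ge0// ltW.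
exists (2 * K); first by rewrite mulr_ge0.
apply: approx_surjective => // y.
have [->|y0'] := eqVneq y 0.
  by exists 0; rewrite ?bop0 ?subrr bnorm0 ?mulr0 ?mul0r.
have Ny : 0 < N y.
  rewrite lt_neqAle bnorm_ge0 andbT eq_sym; apply: contra y0' => /eqP.
  by move/bnorm_eq0 => ->.
pose a : R := r / (2 * N y).
have aNy : a * N y = r / 2 by rewrite /a; field; rewrite gt_eqF.
have a0 : 0 < a by rewrite divr_gt0// mulr_gt0.
have na : normc a%:C = a by rewrite normc_real ger0_norm// ltW.
have naV : normc (a^-1)%:C = a^-1 by rewrite normc_real ger0_norm// invr_ge0 ltW.
have e0 : 0 < r / 8%:R by rewrite divr_gt0.
have [|x1 hx1 hy1] := hball (y0 + a%:C *: y) _ _ e0.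
  by rewrite addrAC subrr add0r bnormZ na aNy; lra.
have [|x2 hx2 hy2] := hball y0 _ _ e0; first by rewrite subrr bnorm0.
exists ((a^-1)%:C *: (x1 - x2)).
  rewrite bnormZ naV (@le_trans _ _ (a^-1 * (n%:R + n%:R)))//.
    rewrite ler_wpM2l// ?invr_ge0 ?(ltW a0)// (le_trans (bnormD _ _))//.
    by rewrite bnormN lerD.
  rewrite /a /K le_eqVlt; apply/orP; left; apply/eqP.
  by field; rewrite !gt_eqF.
have -> : y = (a^-1)%:C *: (a%:C *: y).
  by rewrite scalerA -rmorphM/= mulVf ?gt_eqF// scale1r.
rewrite bopZ -scalerBr [leLHS]bnormZ naV [N (_ *: (_ *: _))]bnormZ naV.
rewrite -mulrA ler_wpM2l ?invr_ge0 ?(ltW a0)// bnormZ na aNy.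
have -> : a%:C *: y - T (x1 - x2) =
    (y0 + a%:C *: y - T x1) - (y0 - T x2).
  rewrite bopB; set u := _ *: y; set v := T x1; set w := T x2.
  by rewrite !opprB [y0 + u]addrC [u + y0 - v]addrAC [w - y0]addrC [RHS]addrA addrK
    [w - v]addrC addrA.
apply: le_trans (bnormD _ _) _; rewrite bnormN.
by move: hy1 hy2; set u := N _; set v := N _; lra.
Qed.

(** For the equation [(1 + f) x = z] the choice x = z already has relative error 1/2, so the
    iteration above gives surjectivity with constant 2; injectivity is the norm estimate. *)
Lemma neumann_inverse f : opnorm_le f 2^-1 ->
  exists g, (1 + f) * g = 1 /\ g * (1 + f) = 1.
Proof.
move=> [_ hf].
have inj x : (1 + f) x = 0 -> x = 0.
  move=> /= /eqP; rewrite scale1r addr_eq0 => /eqP e; apply: bnorm_eq0; apply/eqP.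
  have := hf x; rewrite -[N (f x)]bnormN -e; have := bnorm_ge0 x.
  by rewrite eq_le => -> ?; rewrite andbT; lra.
have /choice[h hP] : forall y, exists x, (1 + f) x = y /\ N x <= 2 * N y.
  move=> y.
  have H z : exists2 x, N x <= 1 * N z & N (z - (1 + f) x) <= N z / 2.
    exists z; first by rewrite mul1r.
    rewrite /= scale1r opprD addrA subrr add0r bnormN (le_trans (hf _))//.
    by rewrite mulrC.
  have [x xy hx] := approx_surjective ler01 H y.
  by exists x; split => //; rewrite mulr1 in hx.
have injB x y : (1 + f) x = (1 + f) y -> x = y.
  by move=> e; apply/eqP; rewrite -subr_eq0; apply/eqP/inj; rewrite bopB e subrr.
have hlin c x y : h (c *: x + y) = c *: h x + h y.
  by apply: injB; rewrite bop_linear !(hP _).1.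
have hbd : exists2 C, 0 <= C & forall x, N (h x) <= C * N x.
  by exists 2 => // x; exact: (hP x).2.
exists (Bop hlin hbd); split; apply: bopP => x; rewrite bop1E.
  exact: (hP x).1.
by apply: injB; exact: (hP _).1.
Qed.

End OpenMapping.

(** * Fredholm operators and shifts *)

Section Fredholm.
Context {R : realType} {E : banach R}.
Implicit Types (x y : E) (s : seq E) (f g h T : bop E).
Local Notation N := (@bnorm R E).

Definition fin_ker T : Prop := exists s, forall x, T x = 0 -> spanned s x.
Definition cofin_range T : Prop := exists s, forall y, exists x, spanned s (y - T x).

(** Each further vector v enlarges the preimage by at most one dimension, namely by a single [x0]
    with [T x0] congruent to v modulo the previous span, if there is one. *)
Lemma spanned_preimage T : fin_ker T ->
  forall s, exists t, forall x, spanned s (T x) -> spanned t x.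
Proof.
move=> kerT; elim=> [|v s [t ht]]; first exact: kerT.
have [[x0 hx0]|no] := pselect (exists x0, spanned s (T x0 - v)).
  exists (x0 :: t) => x /= [c hc]; exists c; apply: ht.
  have -> : T (x - c *: x0) = (T x - c *: v) + (- c) *: (T x0 - v).
    by rewrite bopB bopZ scaleNr scalerBr opprB addrA subrK.
  by apply: spannedD hc _; exact: spannedZ.
exists t => x /= [c hc]; apply: ht.
have [c0|c0] := eqVneq c 0; first by rewrite c0 scale0r subr0 in hc.
case: no; exists (c^-1 *: x).
have -> : T (c^-1 *: x) - v = c^-1 *: (T x - c *: v).
  by rewrite bopZ scalerBr scalerA mulVf// scale1r.
exact: spannedZ.
Qed.

(** On the kernel of [T] the invertible operator [1 + f] coincides with the finite rank operator
    [f - (l * T - 1)]. *)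
Lemma fin_ker_of_left_inverse T : (exists X, ess_le (X * cl T - 1) 2^-1) -> fin_ker T.
Proof.
move=> [X]; have [l <-] := cl_surj X; rewrite -clM -cl1 -clB => -[f fE fle].
have /clP[s hs] := fE.
have [g [_ gf]] := neumann_inverse fle.
exists (map g s) => x Tx0.
have -> : x = g ((f - (l * T - 1)) x).
  have -> : (f - (l * T - 1)) x = (1 + f) x.
    by rewrite /= Tx0 bop0 scale1r add0r opprK addrC.
  by have := congr1 (fun h : bop E => h x) gf; rewrite bop1E.
by apply: spanned_map.
Qed.

Lemma cofin_range_of_right_inverse T :
  (exists X, ess_le (cl T * X - 1) 2^-1) -> cofin_range T.
Proof.
move=> [X]; have [r <-] := cl_surj X; rewrite -clM -cl1 -clB => -[f fE fle].
have /clP[s hs] := fE.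
have [g [fg _]] := neumann_inverse fle.
exists s => y; exists (r (g y)).
have -> : y - T (r (g y)) = (f - (T * r - 1)) (g y).
  have e : (1 + f) (g y) = y.
    by have := congr1 (fun h : bop E => h y) fg; rewrite bop1E.
  rewrite -{1}e /= !scale1r opprD opprK addrA [f _ - _]addrC -addrA [f _ + _]addrC.
  by rewrite addrC.
exact: hs.
Qed.

(** Abstract one-sided shifts: [V] is the forward shift, [U] the backward shift, [ev] the coordinate
    at 0 and [e0] the first unit vector. All coordinates are then of the form [ev] after a power of
    [U]. *)
Variables U V : bop E.
Variable ev : E -> R[i].
Variable e0 : E.
Hypothesis UV1 : U * V = 1.
Hypothesis U_le1 : opnorm_le U 1.
Hypothesis V_le1 : opnorm_le V 1.
Hypothesis ev_linear : forall c x y, ev (c *: x + y) = c * ev x + ev y.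
Hypothesis ev_bounded : exists2 C, 0 <= C & forall x, normc (ev x) <= C * N x.
Hypothesis shift_decomp : forall x, x - V (U x) = ev x *: e0.
Hypothesis ev_e0 : ev e0 = 1.
Hypothesis ev_sep : forall x, (forall j, ev ((U ^+ j) x) = 0) -> x = 0.

Let evZ c x : ev (c *: x) = c * ev x.
Proof.
have e00 : ev 0 = 0.
  by have := ev_linear (-1) 0 0; rewrite scaler0 addr0 mulN1r addNr.
by have := ev_linear c x 0; rewrite !addr0 e00 addr0.
Qed.

Let evD x y : ev (x + y) = ev x + ev y.
Proof. by have := ev_linear 1 x y; rewrite scale1r mul1r. Qed.

Let UVK x : U (V x) = x.
Proof. by have := congr1 (fun h : bop E => h x) UV1; rewrite bop1E. Qed.

Let Ue0 : U e0 = 0.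
Proof.
by have := congr1 U (shift_decomp e0); rewrite ev_e0 scale1r bopB UVK subrr.
Qed.

Let evV x : ev (V x) = 0.
Proof.
have := shift_decomp (V x); rewrite UVK subrr => /esym/(congr1 ev).
by rewrite evZ ev_e0 mulr1 => ->; rewrite -[in LHS](scale0r e0) evZ mul0r.
Qed.

Definition coord j x : R[i] := ev ((U ^+ j) x).

Fact rank1_subproof (w : E) j :
  (forall c x y, coord j (c *: x + y) *: w = c *: (coord j x *: w) + coord j y *: w) /\
  exists2 C, 0 <= C & forall x, N (coord j x *: w) <= C * N x.
Proof.
rewrite /coord; split=> [c x y|].
  by rewrite bop_linear ev_linear scalerDl scalerA.
have [C C0 hC] := ev_bounded; have [D [D0 hD]] := opnorm_ex (U ^+ j).
exists (C * D * N w) => [|x]; first by rewrite !mulr_ge0 ?bnorm_ge0.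
rewrite bnormZ mulrAC ler_wpM2r ?bnorm_ge0// (le_trans (hC _))//.
by rewrite -mulrA ler_wpM2l.
Qed.

Definition rank1 w j : bop E := Bop (rank1_subproof w j).1 (rank1_subproof w j).2.

Lemma finite_rank1 w j : finite_rank (rank1 w j).
Proof. by exists [:: w] => x /=; exists (coord j x); rewrite subrr. Qed.

Lemma coordZ j c x : coord j (c *: x) = c * coord j x.
Proof. by rewrite /coord bopZ evZ. Qed.

Lemma coordD j x y : coord j (x + y) = coord j x + coord j y.
Proof. by rewrite /coord bopD evD. Qed.

(* Coordinate functionals separate points, so that finite-dimensional subspaces
   are complemented without the Hahn-Banach theorem. *)
Lemma coordinate_projection n (K : set E) s : (size s <= n)%N ->
    K 0 -> (forall c x y, K x -> K y -> K (c *: x + y)) ->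
    K `<=` spanned s ->
  exists p, [/\ finite_rank p, forall x, K (p x) & forall x, K x -> p x = x].
Proof.
elim: n K s => [|n IH] K [|v s] //= sn K0 Klin Ks.
- by exists 0; split => [|//|x /Ks ->//]; exists [::].
- by exists 0; split => [|//|x /Ks ->//]; exists [::].
have [Ks'|/existsNP[k0 /not_implyP[Kk0 nk0]]] := pselect (K `<=` spanned s).
  exact: (IH K s).
have [c ck0] := Ks _ Kk0.
have c0 : c != 0.
  by apply/eqP => c0; apply: nk0; move: ck0; rewrite c0 scale0r subr0.
have /existsNP[j /eqP j0] : ~ forall j, coord j k0 = 0.
  by move=> /ev_sep k00; apply: nk0; rewrite k00; exact: spanned0.
pose k := (coord j k0)^-1 *: k0.
have Kk : K k by have := Klin (coord j k0)^-1 _ _ Kk0 K0; rewrite addr0.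
have jk : coord j k = 1 by rewrite coordZ mulVf.
pose Q := 1 - rank1 k j.
have QE x : Q x = x - coord j x *: k by rewrite /= scale1r.
have [p [frp Kp pK]] : exists p, [/\ finite_rank p,
    forall x, K (p x) /\ coord j (p x) = 0 &
    forall x, K x /\ coord j x = 0 -> p x = x].
  (* [Q] projects along [k] onto the kernel of [coord j]. An x in [K] with vanishing j-th coordinate
     equals [Q (x - a *: k)] with [x - a *: k] in the span of [s], so [map Q s], which is one vector
     shorter, suffices. *)
  apply: (IH [set x | K x /\ coord j x = 0] (map Q s)).
  - by rewrite size_map.
  - by split => //; rewrite -(scale0r k) coordZ mul0r.
  - move=> a x y [Kx jx] [Ky jy]; split; first exact: Klin.
    by rewrite coordD coordZ jx jy mulr0 addr0.
  - move=> x [Kx jx]; have [d hd] := Ks _ Kx.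
    pose a := d * c^-1 * coord j k0.
    have hy : spanned s (x - a *: k).
      have -> : x - a *: k = (x - d *: v) + (- (d * c^-1)) *: (k0 - c *: v).
        rewrite /a /k scalerA -mulrA divff// mulr1 scaleNr scalerBr opprB addrA.
        by rewrite scalerA -mulrA mulVf// mulr1 subrK.
      by apply: spannedD hd _; exact: spannedZ.
    have := spanned_map Q hy; congr spanned.
    rewrite QE coordD jx add0r -scaleNr coordZ jk mulr1 scaleNr opprK.
    by rewrite subrK.
exists (rank1 k j + p * Q); split.
- by apply: finite_rankD; [exact: finite_rank1|exact: finite_rankMr].
- by move=> x /=; apply: Klin => //; exact: (Kp _).1.
- move=> x Kx; rewrite (_ : (_ + _ : bop E) x = coord j x *: k + p (Q x))//.
  rewrite pK; first by rewrite QE addrC subrK.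
  split; last by rewrite QE coordD -scaleNr coordZ jk mulr1 subrr.
  by rewrite QE addrC -scaleNr; exact: Klin.
Qed.

Lemma fin_ker_shiftX n : fin_ker (U ^+ n).
Proof.
have kerU : fin_ker U.
  exists [:: e0] => x Ux /=; exists (ev x).
  by rewrite -shift_decomp Ux bop0 subr0 subrr.
elim: n => [|n [s hs]]; first by exists [::] => x; rewrite expr0 bop1E.
have [t ht] := spanned_preimage kerU s.
by exists t => x; rewrite exprSr => h; apply: ht; exact: hs.
Qed.

(* The missing directions w of the range are fed from the first coordinates,
   which the shift U ^+ n frees. *)
Lemma surjective_shift_perturbation T s :
    (forall y, exists x, spanned s (y - T x)) ->
  exists n f, finite_rank f /\ forall y, exists x, (T * U ^+ n + f) x = y.
Proof.
elim: s T => [|w s IH] T hT.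
  exists 0%N, 0; split=> [|y]; first by exists [::].
  have [x /eqP] := hT y; rewrite subr_eq0 => /eqP ->.
  by exists x; rewrite expr0 mulr1 addr0.
have [y|n [f [ff surj]]] := IH (T * U + rank1 w 0).
  have [x0 [c hc]] := hT y; exists (V x0 + c *: e0).
  suff -> : (T * U + rank1 w 0) (V x0 + c *: e0) = T x0 + c *: w.
    by rewrite opprD addrA.
  rewrite /= /coord expr0 bop1E bopD UVK bopZ Ue0 scaler0 addr0.
  by rewrite evD evV add0r evZ ev_e0 mulr1.
exists n.+1, (rank1 w 0 * U ^+ n + f); split.
  by apply: finite_rankD ff; apply: finite_rankMr; exact: finite_rank1.
move=> y; have [x <-] := surj y; exists x.
by rewrite exprS mulrA addrA -mulrDl.
Qed.

(** The open mapping theorem provides bounded preimages [h y] without linearity. Subtracting their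
    component in the kernel selects the unique preimage annihilated by the projection, which
    therefore depends linearly on y. *)
Lemma right_inverse_of_surjective T : fin_ker T ->
  (forall y, exists x, T x = y) -> exists g, T * g = 1.
Proof.
move=> [s hs] surj.
have [p [fp Kp pK]] : exists p, [/\ finite_rank p,
    forall x, T (p x) = 0 & forall x, T x = 0 -> p x = x].
  apply: (@coordinate_projection (size s) [set x | T x = 0] s) => //=.
    exact: bop0.
  by move=> c x y Tx Ty; rewrite bop_linear Tx Ty scaler0 addr0.
have [C C0 hC] := open_mapping surj.
have /choice[h hP] : forall y, exists x, T x = y /\ N x <= C * N y.
  by move=> y; have [x] := hC y; exists x.
pose g y := h y - p (h y).
have Tg y : T (g y) = y by rewrite bopB Kp subr0 (hP y).1.
have pg y : p (g y) = 0 by rewrite bopB [p (p _)]pK// subrr.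
have uniq x x' : T x = T x' -> p x = 0 -> p x' = 0 -> x = x'.
  move=> e px px'; apply/eqP; rewrite -subr_eq0; apply/eqP.
  by rewrite -[LHS]pK ?bopB ?px ?px' ?e subrr.
have glin c x y : g (c *: x + y) = c *: g x + g y.
  by apply: uniq => //; rewrite bop_linear ?Tg// !pg scaler0 addr0.
have [D [D0 hD]] := opnorm_ex p.
have gbd : exists2 M, 0 <= M & forall x, N (g x) <= M * N x.
  exists ((1 + D) * C) => [|x]; first by rewrite mulr_ge0// addr_ge0.
  rewrite (le_trans (bnormD _ _))// bnormN (@le_trans _ _ ((1 + D) * N (h x)))//.
    by rewrite mulrDl mul1r lerD.
  by rewrite -mulrA ler_wpM2l ?addr_ge0// (hP x).2.
by exists (Bop glin gbd); apply: bopP => x; rewrite bop1E; exact: Tg.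
Qed.

(** A right inverse g of the surjective perturbation [T * U ^+ n + f] gives [B = U ^+ n * g] with
    [T B - 1 = - f g]. On the other side, [T (B T - 1) = (T B - 1) T] has finite rank, and a
    finite-dimensional kernel lets this descend to [B T - 1]. *)
Lemma calkin_inverse T : fin_ker T -> cofin_range T ->
  exists B, B * cl T = 1 /\ cl T * B = 1.
Proof.
move=> kerT [s hs].
have [n [f [ff surj]]] := surjective_shift_perturbation hs.
have kerT' : fin_ker (T * U ^+ n + f).
  have [t ht] := ff.
  have [t1 ht1] := spanned_preimage kerT t.
  have [t2 ht2] := spanned_preimage (fin_ker_shiftX n) t1.
  exists t2 => x hx; apply: ht2; apply: ht1.
  have /= /eqP := hx; rewrite addr_eq0 => /eqP ->; exact: spannedN.
have [g hg] := right_inverse_of_surjective kerT' surj.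
pose B := U ^+ n * g; exists (cl B).
have TB : T * B - 1 = - f * g.
  by rewrite -hg mulrDl mulrA opprD addrA subrr add0r mulNr.
have fTB : finite_rank (T * B - 1).
  rewrite TB; apply: finite_rankMr.
  by have [t ht] := ff; exists t => x; exact: spannedN.
split; rewrite -clM -cl1; apply/clP => //.
have [t ht] := fTB; have [t' ht'] := spanned_preimage kerT t.
exists t' => x; apply: ht'.
have -> : T ((B * T - 1) x) = (T * B - 1) (T x).
  by rewrite /= !scale1r bopB.
exact: ht.
Qed.

Let cUV : cl U * cl V = 1.
Proof. by rewrite -clM UV1 cl1. Qed.

Let cVU : cl V * cl U = 1.
Proof.
rewrite -clM -cl1; apply/esym/clP; exists [:: e0] => x /=.
by exists (ev x); rewrite scale1r shift_decomp subrr.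
Qed.

Let comm_inv (T : calkin E) : cl U * T * cl V = T ->
  GRing.comm T (cl U) /\ GRing.comm T (cl V).
Proof.
move=> e; rewrite /GRing.comm -{1 4}e; split.
  by rewrite -!mulrA cVU mulr1.
by rewrite !mulrA cVU mul1r.
Qed.

Let ess_U : ess_le (cl U) 1. Proof. exact: ess_le_cl. Qed.
Let ess_V : ess_le (cl V) 1. Proof. exact: ess_le_cl. Qed.

(** A right inverse is a left inverse in the opposite ring. The scalars are re-read there, and
    [bump_op] shows that the bumps are the same elements, because the classes of the two shifts
    commute. *)
Let scal_op (c : R[i]) : (calkin E)^c := calkin_scal c.

Let scal_op_additive : zmod_morphism scal_op.
Proof. exact: calkin_scal_additive. Qed.

Let scal_op_multiplicative : monoid_morphism scal_op.
Proof.
split; first by [].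
move=> c d; rewrite mulrC; exact: (calkin_scal_multiplicative (E := E)).2 d c.
Qed.

HB.instance Definition _ := GRing.isZmodMorphism.Build R[i] (calkin E)^c scal_op
  scal_op_additive.
HB.instance Definition _ := GRing.isMonoidMorphism.Build R[i] (calkin E)^c scal_op
  scal_op_multiplicative.

Let converse_exp (X : calkin E) n : (X : (calkin E)^c) ^+ n = X ^+ n :> calkin E.
Proof. by elim: n => [//|n IH]; rewrite exprS exprSr -IH. Qed.

Let bump_op w : bump scal_op (cl U) (cl V) w = bump calkin_scal (cl U) (cl V) w.
Proof.
pose s c : calkin E := calkin_scal c.
rewrite /bump [LHS](_ : _ = (1 + cl V * s w^-1) ^+ 2 * (cl U * s (w / 4%:R)) :> calkin E)//.
rewrite -[cl U * _]calkin_scalC -[cl V * _]calkin_scalC.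
have sC c X : GRing.comm (s c) X by exact: calkin_scalC.
apply/esym; apply: (@commrX _ (s (w / 4%:R) * cl U)).
apply: commrD; first exact: commr1.
apply: commrM; first exact: commr_sym.
apply: commr_sym; apply: commrM; first exact: commr_sym.
by rewrite /GRing.comm cUV cVU.
Qed.

Local Notation cbump t := (bump calkin_scal (cl U) (cl V) (cis t)).

Theorem toeplitz_local_principle (A : bop E) (At : R -> bop E) :
    U * A * V = A -> (forall t, - pi <= t < pi -> U * At t * V = At t) ->
    (forall t, - pi <= t < pi -> fin_ker (At t) /\ cofin_range (At t)) ->
    (forall t, - pi <= t < pi -> forall e, 0 < e -> exists n,
       ess_le (cl (A - At t) * cbump t ^+ n) e) ->
  fin_ker A /\ cofin_range A.
Proof.
move=> UAV UAtV Atfred loc.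
have cT (T : bop E) : U * T * V = T -> GRing.comm (cl T) (cl U) /\ GRing.comm (cl T) (cl V).
  by move=> e; apply: comm_inv; rewrite -!clM e.
have [cAU cAV] := cT _ UAV.
have inv t : t \in `[0, pi *+ 2] -> exists B n,
    [/\ GRing.comm B (cl U), GRing.comm B (cl V),
      ess_le ((B * cl A - 1) * cbump t ^+ n) 4%:R^-1 &
      ess_le (cbump t ^+ n * (cl A * B - 1)) 4%:R^-1].
  move=> tI.
  (* The covering argument runs over the compact interval [0, 2 pi], the hypotheses over [- pi, pi);
     only [cis t] matters, which is periodic. *)
  have [t' ht' ->] : exists2 t', - pi <= t' < pi & cis t = cis t'.
    have pi0 := pi_gt0 R; move: tI; rewrite in_itv/= => /andP[t0 t2].
    have [tpi|tpi] := ltP t pi; first by exists t => //; rewrite tpi andbT; lra.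
    exists (t - pi *+ 2); first by apply/andP; split; lra.
    by rewrite cisD cisN cis2pi invr1 mulr1.
  have [kerT ranT] := Atfred t' ht'.
  have [B [BT TB]] := calkin_inverse kerT ranT.
  have [cTU cTV] := cT _ (UAtV t' ht').
  (* An inverse commutes with everything its original commutes with, so [B] commutes with the shifts
     although it need not be a Toeplitz operator. *)
  have cB (X : calkin E) : GRing.comm (cl (At t')) X -> GRing.comm B X.
    move=> c; rewrite /GRing.comm -[B * X]mulr1 -TB mulrA -[B * X * _]mulrA -c.
    by rewrite mulrA BT mul1r.
  have [c c0 hc] := ess_le_ex B.
  have eps0 : 0 < (4%:R * (c + 1))^-1 by rewrite invr_gt0 mulr_gt0// ltr_wpDl.
  have [n hn] := loc t' ht' _ eps0.
  have cDbump : GRing.comm (cl (A - At t')) (cbump t' ^+ n).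
    by rewrite clB; apply: commrX; apply: comm_bump;
      (try exact: calkin_scalC); apply/commr_sym/commrB; exact/commr_sym.
  have ce : c * (4%:R * (c + 1))^-1 <= 4%:R^-1.
    rewrite ler_pdivrMr ?mulr_gt0 ?ltr_wpDl//; lra.
  exists B, n; split; [exact: cB|exact: cB| |].
    (* Since [B] inverts the class of [At t'], only the difference [A - At t'] remains, and its
       localised bound gets multiplied by that of [B]. *)
    have -> : B * cl A - 1 = B * cl (A - At t') by rewrite clB mulrBr BT.
    by rewrite -mulrA; apply: ess_le_trans (ess_leM hc hn) ce.
  have -> : cl A * B - 1 = cl (A - At t') * B by rewrite clB mulrBl TB.
  rewrite mulrA -cDbump; apply: ess_le_trans (ess_leM hn hc) _.
  by rewrite mulrC.
split.
  apply: fin_ker_of_left_inverse.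
  apply: (@left_inverse_of_local R (calkin E) calkin_scal ess_le
    _ _ _ _ _ _ (cl U) (cl V)) => //.
  - exact: calkin_scalC.
  - exact: ess_le_trans.
  - exact: ess_leD.
  - exact: ess_leM.
  - exact: ess_le_scal.
  - exact: ess_le_ex.
  - by move=> t /inv[B [n [? ? ? _]]]; exists B, n.
apply: cofin_range_of_right_inverse.
(* In the opposite ring the conclusion reads as an approximate right inverse of [A]. *)
apply: (@left_inverse_of_local R (calkin E)^c scal_op ess_le
  _ _ _ _ _ _ (cl U) (cl V) _ _ _ _ (cl A)) => //.
- by move=> c X; exact/esym/calkin_scalC.
- exact: ess_le_trans.
- exact: ess_leD.
- by move=> X Y c d hX hY; rewrite mulrC; exact: ess_leM.
- exact: ess_le_scal.
- exact: ess_le_ex.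
- move=> t /inv[B [n [BU BV _ h]]]; exists B, n; split => //.
  by rewrite bump_op converse_exp.
Qed.

End Fredholm.

(** * Orlicz sequence spaces *)

Section Luxemburg.
Context {R : realType}.
Implicit Types (F : R -> R) (f g : int -> R[i]) (l m : R).

(** The common ground of [Phi], [Phi_theta Phi theta] and the square, so that all three norms are
    handled at once. *)
Record young F : Prop := {
  young0 : F 0 = 0;
  young_gt0 : forall t, 0 < t -> 0 < F t;
  young_le : forall s t, 0 <= s -> s <= t -> F s <= F t;
  young_convex : forall l x y, 0 <= l -> l <= 1 -> 0 <= x -> 0 <= y ->
    F (l * x + (1 - l) * y) <= l * F x + (1 - l) * F y }.

(** Bounds all finite partial sums, which keeps the modular inside the reals; [modular_leP] connects
    it with the sum in the extended reals. *)
Definition modular_le F (g : int -> R) (c : R) : Prop :=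
  forall s : seq int, uniq s -> \sum_(n <- s) F (g n) <= c.

Definition admissible F f : set R :=
  [set l | 0 < l /\ modular_le F (fun n => normc (f n) / l) 1].

Definition inL F f : Prop := exists l, admissible F f l.

(** The Luxemburg norm as a real number. Outside the space it takes the default value 0 of an
    infimum over the empty set, hence it is paired with [inL] below. *)
Definition lux F f : R := inf (admissible F f).

Variable F : R -> R.
Hypothesis yF : young F.

Lemma young_ge0 t : 0 <= t -> 0 <= F t.
Proof. by move=> t0; rewrite -(young0 yF) young_le. Qed.

Lemma young_scale l t : 0 <= l -> l <= 1 -> 0 <= t -> F (l * t) <= l * F t.
Proof.
move=> l0 l1 t0; have := young_convex yF l0 l1 t0 (lexx 0).
by rewrite mulr0 addr0 (young0 yF) mulr0 addr0.
Qed.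

Lemma modular_le_mono (g h : int -> R) c : (forall n, 0 <= g n) ->
  (forall n, g n <= h n) -> modular_le F h c -> modular_le F g c.
Proof.
move=> g0 gh hc s us; apply: le_trans (hc s us); apply: ler_sum => n _.
exact: young_le.
Qed.

Lemma normc_div_ge0 f l n : 0 < l -> 0 <= normc (f n) / l.
Proof. by move=> l0; rewrite divr_ge0 ?normc_ge0// ltW. Qed.

Lemma admissible_le f l m : l <= m -> admissible F f l -> admissible F f m.
Proof.
move=> lm [l0 h]; have m0 := lt_le_trans l0 lm; split=> //.
apply: modular_le_mono h => n; first exact: normc_div_ge0.
by rewrite ler_wpM2l ?normc_ge0// lef_pV2.
Qed.

Lemma lux_ge0 f : 0 <= lux F f.
Proof.
have [h|h] := pselect (admissible F f !=set0); last first.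
  by rewrite /lux (_ : admissible F f = set0) ?inf0//; exact/nonemptyPn.
by apply: lb_le_inf => // l [/ltW].
Qed.

Lemma lux_le f l : admissible F f l -> lux F f <= l.
Proof. by move=> h; apply: ge_inf => //; exists 0 => m [/ltW]. Qed.

Lemma lux_lt f l : inL F f -> lux F f < l -> admissible F f l.
Proof.
by move=> h hl; have [m hm /ltW ml] := inf_lt h hl; exact: admissible_le hm.
Qed.

Lemma admissibleD f g l m : admissible F f l -> admissible F g m ->
  admissible F (fun n => f n + g n) (l + m).
Proof.
move=> [l0 hf] [m0 hg]; have lm0 := addr_gt0 l0 m0; split=> // s us.
(* With this weight (f + g) / (l + m) is the convex combination of f / l and g / m. *)
pose t := l / (l + m).
have t0 : 0 <= t by rewrite divr_ge0 ?ltW.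
have t1 : t <= 1 by rewrite ler_pdivrMr// mul1r lerDl ltW.
apply: (@le_trans _ _ (\sum_(n <- s)
    (t * F (normc (f n) / l) + (1 - t) * F (normc (g n) / m)))).
  apply: ler_sum => n _.
  apply: (le_trans _ (young_convex yF t0 t1 (normc_div_ge0 _ _ l0)
    (normc_div_ge0 _ _ m0))).
  apply: young_le => //; first exact: (@normc_div_ge0 (fun n => f n + g n)).
  have -> : t * (normc (f n) / l) + (1 - t) * (normc (g n) / m) =
      (normc (f n) + normc (g n)) / (l + m).
    by rewrite /t; field; rewrite !gt_eqF.
  by rewrite ler_wpM2r ?normcD// invr_ge0 ltW.
rewrite big_split/= -!mulr_sumr.
have := ler_wpM2l t0 (hf s us).
have := @ler_wpM2l _ (1 - t) _ _ _ (hg s us); rewrite subr_ge0 => /(_ t1).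
lra.
Qed.

Lemma admissibleZ (c : R[i]) f l : c != 0 -> admissible F f l ->
  admissible F (fun n => c * f n) (normc c * l).
Proof.
move=> c0 [l0 h]; have nc0 : 0 < normc c.
  by rewrite lt_neqAle normc_ge0 andbT eq_sym normc_eq0.
split; first exact: mulr_gt0.
move=> s us; rewrite (eq_bigr (fun n => F (normc (f n) / l))); first exact: h.
by move=> n _; rewrite normcM; congr F; field; rewrite !gt_eqF.
Qed.

Lemma admissible0 l : 0 < l -> admissible F (fun=> 0) l.
Proof.
move=> l0; split=> // s _; rewrite big1 ?ler01// => n _.
by rewrite ComplexField.Normc.normc0 mul0r (young0 yF).
Qed.

Lemma inL0 : inL F (fun=> 0).
Proof. by exists 1; exact: admissible0. Qed.

Lemma inLD f g : inL F f -> inL F g -> inL F (fun n => f n + g n).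
Proof. by move=> [l hl] [m hm]; exists (l + m); exact: admissibleD. Qed.

Lemma inLZ c f : inL F f -> inL F (fun n => c * f n).
Proof.
have [->|c0] := eqVneq c 0.
  by move=> _; under eq_fun do rewrite mul0r; exact: inL0.
by move=> [l hl]; exists (normc c * l); exact: admissibleZ.
Qed.

Lemma inL_lin c f g : inL F f -> inL F g -> inL F (fun n => c * f n + g n).
Proof. by move=> hf hg; apply: inLD hg; exact: inLZ. Qed.

Lemma luxD f g : inL F f -> inL F g ->
  lux F (fun n => f n + g n) <= lux F f + lux F g.
Proof.
move=> hf hg; apply: le_of_le_add_eps => e e0.
have e20 : 0 < e / 2 by rewrite divr_gt0.
have -> : lux F f + lux F g + e = (lux F f + e / 2) + (lux F g + e / 2).
  by rewrite addrACA -splitr.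
by apply: lux_le; apply: admissibleD; apply: lux_lt; rewrite // ltrDl.
Qed.

Lemma lux0 : lux F (fun=> 0) = 0.
Proof.
apply/eqP; rewrite eq_le lux_ge0 andbT; apply: le_of_le_add_eps => e e0.
by rewrite add0r lux_le//; exact: admissible0.
Qed.

Let luxZ_le c f : inL F f -> lux F (fun n => c * f n) <= normc c * lux F f.
Proof.
have [->|c0] := eqVneq c 0.
  move=> _; under eq_fun do rewrite mul0r.
  by rewrite lux0 ComplexField.Normc.normc0 mul0r.
have nc0 : 0 < normc c.
  by rewrite lt_neqAle normc_ge0 andbT eq_sym normc_eq0.
move=> hf; apply: le_of_le_add_eps => e e0.
have -> : normc c * lux F f + e = normc c * (lux F f + e / normc c).
  by field; rewrite gt_eqF.
by apply/lux_le/admissibleZ => //; apply: lux_lt; rewrite // ltrDl divr_gt0.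
Qed.

Lemma luxZ c f : inL F f -> lux F (fun n => c * f n) = normc c * lux F f.
Proof.
move=> hf; apply/eqP; rewrite eq_le luxZ_le//=.
have [->|c0] := eqVneq c 0; first by rewrite ComplexField.Normc.normc0 mul0r lux_ge0.
have nc0 : 0 < normc c.
  by rewrite lt_neqAle normc_ge0 andbT eq_sym normc_eq0.
have := luxZ_le c^-1 (inLZ c hf).
under eq_fun do rewrite mulKf//.
by rewrite ComplexField.Normc.normcV mulrC ler_pdivlMr// mulrC.
Qed.

(** If [F t <= 1] then t is at most 1 or, by convexity, [t * F 1 <= F t <= 1]; the sum covers both
    cases. Coordinates are thus bounded functionals. *)
Definition coord_const : R := 1 + (F 1)^-1.

Lemma coord_const_gt0 : 0 < coord_const.
Proof. by rewrite ltr_wpDr// invr_ge0 ltW// (young_gt0 yF). Qed.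

Lemma admissible_coord f l n : admissible F f l -> normc (f n) <= coord_const * l.
Proof.
move=> [l0 h]; have F1 := young_gt0 yF (@ltr01 R).
have := h [:: n] isT; rewrite big_seq1; set t := _ / l => Ft.
rewrite -ler_pdivrMr// -/t /coord_const.
have [t1|/ltW t1] := leP t 1.
  by rewrite (le_trans t1)// lerDl invr_ge0 ltW.
have t0 : 0 < t by exact: lt_le_trans ltr01 t1.
have : F 1 <= t^-1 * F t.
  rewrite -{1}(mulVf (lt0r_neq0 t0)); apply: young_scale; rewrite ?invr_ge0 ?(ltW t0)//.
  by rewrite invf_le1.
rewrite ler_pdivlMl// => h1; apply: (@le_trans _ _ (F 1)^-1).
  by rewrite -[leRHS]mul1r ler_pdivlMr// (le_trans h1).
by rewrite lerDr.
Qed.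

Lemma lux_coord f n : inL F f -> normc (f n) <= coord_const * lux F f.
Proof.
move=> hf; have K0 := coord_const_gt0; apply: le_of_le_add_eps => e e0.
have -> : coord_const * lux F f + e = coord_const * (lux F f + e / coord_const).
  by field; rewrite gt_eqF.
by apply: admissible_coord; apply: lux_lt; rewrite // ltrDl divr_gt0.
Qed.

Lemma lux_eq0 f : inL F f -> lux F f = 0 -> forall n, f n = 0.
Proof.
move=> hf h n; have := lux_coord n hf; rewrite h mulr0 => fn.
by apply/eqP; rewrite -normc_eq0 eq_le fn normc_ge0.
Qed.

Lemma modular_leP f l c : 0 < l ->
  (modular F f l <= c%:E)%E <-> modular_le F (fun n => normc (f n) / l) c.
Proof.
move=> l0; rewrite /modular /modular_le.
have nl n : normc (f n / l%:C) = normc (f n) / l.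
  by rewrite normcM ComplexField.Normc.normcV normc_real gtr0_norm.
split=> [h s us|h].
  rewrite -lee_fin -sumEFin; apply: le_trans h.
  apply: esum_ge; exists [set` s]; first by split => //; exact: finite_seq.
  by rewrite -fsbig_seq//; under [leRHS]eq_bigr do rewrite nl.
apply: ge_ereal_sup => _ [X [finX _] <-].
rewrite fsbig_finite//= sumEFin lee_fin.
by under eq_bigr do rewrite nl; apply: h; exact: finmap.fset_uniq.
Qed.

Lemma inLP f : lPhi F f <-> inL F f.
Proof.
split=> [[l l0 fin]|[l [l0 h]]]; last first.
  exists l => //; apply: le_lt_trans (ltry 1).
  exact/modular_leP.
have m0 : (0 <= modular F f l)%E.
  by apply: esum_ge0 => n _; rewrite lee_fin young_ge0// normc_ge0.
have mE : modular F f l = (fine (modular F f l))%:E.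
  by rewrite fineK// ge0_fin_numE.
set M := fine _ in mE; have M0 : 0 <= M by rewrite fine_ge0.
have /(modular_leP f M l0) hM : (modular F f l <= M%:E)%E by rewrite mE.
(* Convexity and [F 0 = 0] let the factor 1 / (M + 1) out of [F], which brings a finite modular M
   below 1. *)
exists ((M + 1) * l); have M1 : 0 < M + 1 by rewrite ltr_wpDl.
split; first exact: mulr_gt0.
move=> s us; apply: (@le_trans _ _ (\sum_(n <- s) (M + 1)^-1 * F (normc (f n) / l))).
  apply: ler_sum => n _; rewrite invfM [_^-1 * _]mulrC mulrA [X in F X]mulrC.
  apply: young_scale; last exact: normc_div_ge0.
    by rewrite invr_ge0 ltW.
  by rewrite invf_le1// lerDr.
rewrite -mulr_sumr ler_pdivrMl// mulr1 (le_trans (hM s us))//.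
by rewrite lerDl.
Qed.

Lemma lPhi_normE f : inL F f -> lPhi_norm F f = (lux F f)%:E.
Proof.
move=> hf; rewrite /lPhi_norm /lux.
have -> : [set l | 0 < l /\ (modular F f l <= 1)%E] = admissible F f.
  apply/seteqP; split=> l /= [l0 h]; split => //; exact/(modular_leP f 1 l0).
rewrite ereal_inf_EFin//; exists 0 => l [/ltW]//.
Qed.

End Luxemburg.

(** * Extension of a bounded operator from a dense subspace *)

Section DenseExtension.
Context {R : realType} {E : banach R}.
Local Notation N := (@bnorm R E).
Variables (D : set E) (T0 : E -> E) (C : R).
Hypothesis C0 : 0 <= C.
Hypothesis D_lin : forall c x y, D x -> D y -> D (c *: x + y).
Hypothesis D_dense : forall x e, 0 < e -> exists2 d, D d & N (x - d) <= e.
Hypothesis T0_lin : forall c x y, D x -> D y -> T0 (c *: x + y) = c *: T0 x + T0 y.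
Hypothesis T0_le : forall x, D x -> N (T0 x) <= C * N x.

(** The closure of the graph of [T0]. The bound makes it single-valued, and completeness makes it
    total, so it is the graph of the extension. *)
Let G x y := forall e, 0 < e -> exists d, [/\ D d, N (x - d) <= e & N (y - T0 d) <= e].

Let G_le x y : G x y -> N y <= C * N x.
Proof.
move=> h; apply: le_of_le_add_eps => e e0.
have C1 : 0 < C + 1 by rewrite ltr_wpDl.
have [d [Dd xd yd]] := h (e / (C + 1)) (divr_gt0 e0 C1).
rewrite -(subrK (T0 d) y) (le_trans (bnormD _ _))//.
apply: (le_trans (lerD yd (T0_le Dd))).
have : N d <= N x + e / (C + 1).
  by rewrite -(subrK x d) addrC (le_trans (bnormD _ _))// lerD2l bnormB.
move=> /(ler_wpM2l C0) h'.
have -> : C * N x + e = e / (C + 1) + C * (N x + e / (C + 1)).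
  by field; rewrite gt_eqF.
by rewrite lerD2l.
Qed.

Let G_lin c x y x' y' : G x y -> G x' y' -> G (c *: x + x') (c *: y + y').
Proof.
move=> h h' e e0; have c1 : 0 < normc c + 1 by rewrite ltr_wpDl// normc_ge0.
have e1 := divr_gt0 e0 c1.
have [d [Dd xd yd]] := h _ e1; have [d' [Dd' xd' yd']] := h' _ e1.
have eE : e = normc c * (e / (normc c + 1)) + e / (normc c + 1).
  by field; rewrite gt_eqF.
have comb (u v u' v' : E) : N (u - v) <= e / (normc c + 1) ->
    N (u' - v') <= e / (normc c + 1) -> N (c *: u + u' - (c *: v + v')) <= e.
  move=> a b; rewrite opprD addrACA -scalerBr (le_trans (bnormD _ _))//.
  by rewrite bnormZ [leRHS]eE lerD// ler_wpM2l// normc_ge0.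
exists (c *: d + d'); split; first exact: D_lin.
  exact: comb.
by rewrite T0_lin//; exact: comb.
Qed.

Let G_uniq x y y' : G x y -> G x y' -> y = y'.
Proof.
move=> h h'; have := G_le (G_lin (-1) h h').
rewrite !scaleN1r addNr bnorm0 mulr0 => le0; apply/eqP; rewrite eq_sym -subr_eq0.
by apply/eqP/bnorm_eq0/eqP; rewrite addrC eq_le le0 bnorm_ge0.
Qed.

Let G_D d : D d -> G d (T0 d).
Proof. by move=> Dd e e0; exists d; rewrite !subrr bnorm0 ltW. Qed.

Let G_ex x : exists y, G x y.
Proof.
pose r n : R := 2^-1 ^+ n.
have r0 n : 0 < r n by rewrite exprn_gt0// invr_gt0.
have /choice[d hd] : forall n, exists d, D d /\ N (x - d) <= r n.
  by move=> n; have [d] := D_dense x (r0 n); exists d.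
have rS n : r n.+1 = r n / 2 by rewrite /r exprSr.
have C2 : 0 < 4%:R * (C + 1) by rewrite mulr_gt0// ltr_wpDl.
(* Consecutive approximants differ by at most 2 r n, hence their images by 2 C r n, which is at most
   half of the chosen radius 4 (C + 1) r n. *)
have [n|n|n|y hy] := @nested_limit R E (fun n => T0 (d n))
    (fun n => 4%:R * (C + 1) * r n).
- by rewrite mulr_ge0 ?ltW.
- have -> : T0 (d n.+1) - T0 (d n) = T0 ((-1) *: d n + d n.+1).
    by rewrite T0_lin; [rewrite scaleN1r addrC|exact: (hd _).1|exact: (hd _).1].
  have Dd : D ((-1) *: d n + d n.+1) by apply: D_lin; exact: (hd _).1.
  apply: (le_trans (T0_le Dd)); rewrite scaleN1r.
  have h : N (- d n + d n.+1) <= r n + r n.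
    rewrite addrC -(subrKA x) (le_trans (bnormD _ _))// lerD ?(hd _).2//.
    rewrite bnormB (le_trans (hd _).2)// rS ler_pdivrMr//.
    by have := r0 n; lra.
  apply: (le_trans (ler_wpM2l C0 h)); have := r0 n; nra.
- by rewrite rS mulrA.
exists y => e e0.
have [n hn] : exists n : nat, 4%:R * (C + 1) / e < n%:R.
  by exists (Num.bound (4%:R * (C + 1) / e)); exact: archi_boundP (divr_ge0 (ltW C2) (ltW e0)).
have h : 4%:R * (C + 1) * r n <= e.
  rewrite /r exprVn ler_pdivrMr ?exprn_gt0// -ler_pdivrMl// mulrC ltW// (lt_le_trans hn)//.
  by rewrite -natrX ler_nat ltnW// ltn_expl.
exists (d n); split; first exact: (hd n).1; last exact: le_trans (hy n) h.
apply: le_trans (hd n).2 _; apply: le_trans h; have rn := r0 n.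
by have := mulr_ge0 C0 (ltW rn); move: (r n) rn => q; nra.
Qed.

Lemma dense_extension : exists T : bop E,
  (forall x, D x -> T x = T0 x) /\ opnorm_le T C.
Proof.
have /choice[T hT] := G_ex.
have Tl c x y : T (c *: x + y) = c *: T x + T y.
  exact: G_uniq (hT _) (G_lin c (hT x) (hT y)).
have Tb : forall x, N (T x) <= C * N x by move=> x; exact: G_le.
exists (Bop Tl (ex_intro2 _ _ C C0 Tb)); split => //= x Dx.
exact: G_uniq (hT x) (G_D Dx).
Qed.

End DenseExtension.

Section OrliczSpace.
Context {R : realType} {F : R -> R}.

Record half_sequence := HalfSequence {
  hseq :> int -> R[i];
  hseq_in : inL F hseq;
  hseq_neg : forall j, j < 0 -> hseq j = 0 }.

Variable yF : young F.

(** The dummy [let] makes the type depend on [yF], so that the vector space structure, whose closure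
    under sums rests on convexity, can be attached to it canonically. *)
Definition ospace : Type := let _ := yF in half_sequence.

Implicit Types (x y : ospace).

Lemma ospaceP (x y : ospace) : (forall j, hseq x j = hseq y j) -> x = y.
Proof.
case: x y => f f1 f2 [g g1 g2] /= /funext fg; subst g.
by congr HalfSequence; exact: Prop_irrelevance.
Qed.

Fact osp_lin_neg c (x y : half_sequence) j : j < 0 -> c * x j + y j = 0.
Proof. by move=> j0; rewrite !hseq_neg// mulr0 addr0. Qed.

Definition osp_lin c x y : ospace :=
  HalfSequence (inL_lin yF c (hseq_in x) (hseq_in y)) (osp_lin_neg c x y).

Definition osp_zero : ospace :=
  HalfSequence (inL0 yF) (fun (j : int) _ => erefl).
Definition osp_add x y : ospace := osp_lin 1 x y.
Definition osp_opp x : ospace := osp_lin (-1) x osp_zero.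
Definition osp_scale c x : ospace := osp_lin c x osp_zero.

HB.instance Definition _ := gen_eqMixin ospace.
HB.instance Definition _ := gen_choiceMixin ospace.

Fact osp_addA : associative osp_add.
Proof. by move=> x y z; apply: ospaceP => j /=; rewrite !mul1r addrA. Qed.
Fact osp_addC : commutative osp_add.
Proof. by move=> x y; apply: ospaceP => j /=; rewrite !mul1r addrC. Qed.
Fact osp_add0 : left_id osp_zero osp_add.
Proof. by move=> x; apply: ospaceP => j /=; rewrite mul1r add0r. Qed.
Fact osp_addN : left_inverse osp_zero osp_opp osp_add.
Proof.
by move=> x; apply: ospaceP => j /=; rewrite mul1r addr0 mulN1r addNr.
Qed.

HB.instance Definition _ :=
  GRing.isZmodule.Build ospace osp_addA osp_addC osp_add0 osp_addN.

Fact osp_scaleA a b x : osp_scale a (osp_scale b x) = osp_scale (a * b) x.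
Proof. by apply: ospaceP => j /=; rewrite !addr0 mulrA. Qed.
Fact osp_scale1 : left_id 1 osp_scale.
Proof. by move=> x; apply: ospaceP => j /=; rewrite mul1r addr0. Qed.
Fact osp_scaleDr : right_distributive osp_scale +%R.
Proof. by move=> a x y; apply: ospaceP => j /=; rewrite !addr0 !mul1r mulrDr. Qed.
Fact osp_scaleDl x : {morph osp_scale^~ x : a b / a + b}.
Proof. by move=> a b; apply: ospaceP => j /=; rewrite !addr0 mul1r mulrDl. Qed.

HB.instance Definition _ := GRing.Zmodule_isLmodule.Build R[i] ospace
  osp_scaleA osp_scale1 osp_scaleDr osp_scaleDl.

Lemma hseqD x y j : hseq (x + y) j = hseq x j + hseq y j.
Proof. by rewrite /= mul1r. Qed.

Lemma hseqZ c x j : hseq (c *: x) j = c * hseq x j.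
Proof. by rewrite /= addr0. Qed.

Lemma hseqN x j : hseq (- x) j = - hseq x j.
Proof. by rewrite /= addr0 mulN1r. Qed.

Lemma hseqB x y j : hseq (x - y) j = hseq x j - hseq y j.
Proof. by rewrite hseqD hseqN. Qed.

Definition onorm x : R := lux F (hseq x).

Fact onorm_ge0 x : 0 <= onorm x.
Proof. exact: lux_ge0. Qed.
Fact onorm_eq0 x : onorm x = 0 -> x = 0.
Proof. by move=> h; apply: ospaceP => j; exact: (lux_eq0 yF (hseq_in x) h). Qed.
Fact onormZ c x : onorm (c *: x) = normc c * onorm x.
Proof. by rewrite -luxZ; [congr lux; apply/funext => j; exact: hseqZ| |exact: hseq_in]. Qed.
Fact onormD x y : onorm (x + y) <= onorm x + onorm y.
Proof.
apply: le_trans (luxD yF (hseq_in x) (hseq_in y)).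
by rewrite /onorm (_ : hseq (x + y) = fun j => hseq x j + hseq y j)//; apply/funext => j; exact: hseqD.
Qed.

End OrliczSpace.

Section ComplexCompleteness.
Context {R : realType}.

Lemma real_cauchy_limit (u : nat -> R) :
    (forall e, 0 < e -> exists n, forall m k, (n <= m)%N -> (n <= k)%N ->
       `|u m - u k| < e) ->
  exists l, forall e, 0 < e -> exists n, forall m, (n <= m)%N -> `|u m - l| < e.
Proof.
move=> hu; have cu : cvgn u.
  apply/cauchy_cvgP/cauchy_exP => _/posnumP[e].
  have [n hn] := hu e%:num (gt0 e).
  exists (u n); exists n => //= m nm; exact: hn.
exists (limn u) => e e0.
have /cvgrPdist_lt/(_ _ e0)[n _ hn] : u @ \oo --> limn u by [].
by exists n => m nm; rewrite distrC; exact: hn.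
Qed.

Lemma complex_cauchy_limit (z : nat -> R[i]) :
    (forall e, 0 < e -> exists n, forall m k, (n <= m)%N -> (n <= k)%N ->
       normc (z m - z k) < e) ->
  exists l, forall e, 0 < e -> exists n, forall m, (n <= m)%N -> normc (z m - l) < e.
Proof.
move=> hz.
have [|a ha] := @real_cauchy_limit (fun n => complex.Re (z n)).
  move=> e /hz[n hn]; exists n => m k nm nk; rewrite -raddfB.
  exact: le_lt_trans (Re_le_normc _) (hn _ _ nm nk).
have [|b hb] := @real_cauchy_limit (fun n => complex.Im (z n)).
  move=> e /hz[n hn]; exists n => m k nm nk; rewrite -raddfB.
  exact: le_lt_trans (Im_le_normc _) (hn _ _ nm nk).
exists (a +i* b) => e e0; have e20 : 0 < e / 2 by rewrite divr_gt0.
have [n hn] := ha _ e20; have [n' hn'] := hb _ e20.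
exists (maxn n n') => m; rewrite geq_max => /andP[nm nm'].
apply: (le_lt_trans (normc_le_ReIm _)); rewrite (splitr e).
move: (hn _ nm) (hn' _ nm'); case: (z m) => p q /= *; exact: ltrD.
Qed.

End ComplexCompleteness.

Section OrliczComplete.
Context {R : realType} {F : R -> R}.
Variable yF : young F.

Fact ospace_complete (u : nat -> ospace yF) :
    (forall e, 0 < e -> exists n, forall m k, (n <= m)%N -> (n <= k)%N ->
       onorm (u m - u k) < e) ->
  exists l, forall e, 0 < e -> exists n, forall m, (n <= m)%N -> onorm (u m - l) < e.
Proof.
move=> hu; have K0 := coord_const_gt0 yF.
have /choice[l hl] : forall j, exists l : R[i], forall e, 0 < e ->
    exists n, forall m, (n <= m)%N -> normc (hseq (u m) j - l) < e.
  move=> j; apply: complex_cauchy_limit => e e0.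
  have [n hn] := hu _ (divr_gt0 e0 K0); exists n => m k nm nk.
  rewrite -hseqB; apply: le_lt_trans (lux_coord yF j (hseq_in (u m - u k))) _.
  by rewrite mulrC -ltr_pdivlMr//; exact: hn.
have lneg j : j < 0 -> l j = 0.
  move=> j0; apply/eqP; rewrite -normc_eq0 eq_le normc_ge0 andbT.
  apply: le_of_le_add_eps => e e0; have [n /(_ n (leqnn n))] := hl j e e0.
  by rewrite hseq_neg// sub0r normcN add0r => /ltW.
have adm e : 0 < e -> exists n, forall m, (n <= m)%N ->
    admissible F (fun j => hseq (u m) j - l j) e.
  move=> e0; have e20 : 0 < e / 2 by rewrite divr_gt0.
  have [n hn] := hu _ e20; exists n => m nm; split => // s us.
  (* A Fatou argument that avoids continuity of [F]: on the finite set [s], a late [u k] is so close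
     to the limit that |u m - l| <= 2 |u m - u k| coordinatewise. The factor 2 is absorbed by
     passing from e to e / 2. *)
  have [k [nk hk]] : exists k, (n <= k)%N /\ forall j, j \in s ->
      normc (hseq (u m) j - l j) / e <= normc (hseq (u m) j - hseq (u k) j) / (e / 2).
    have [k0 hk0] : exists k0, forall k, (k0 <= k)%N -> forall j, j \in s ->
        normc (hseq (u m) j - l j) / e <= normc (hseq (u m) j - hseq (u k) j) / (e / 2).
      elim: s {us} => [|j s [k0 IH]]; first by exists 0%N.
      have [d0|d0] := eqVneq (normc (hseq (u m) j - l j)) 0.
        exists k0 => k kk i; rewrite inE => /orP[/eqP ->|]; last exact: IH.
        by rewrite d0 mul0r divr_ge0 ?normc_ge0 ?ltW.
      have d1 : 0 < normc (hseq (u m) j - l j) by rewrite lt_neqAle normc_ge0 andbT eq_sym.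
      have [k1 hk1] := hl j _ (divr_gt0 d1 (ltr0n R 2)).
      exists (maxn k0 k1) => k; rewrite geq_max => /andP[kk0 kk1] i.
      rewrite inE => /orP[/eqP ->|]; last exact: IH.
      have -> : normc (hseq (u m) j - l j) / e = (normc (hseq (u m) j - l j) / 2) / (e / 2).
        by field; rewrite gt_eqF.
      rewrite ler_wpM2r ?invr_ge0 ?(ltW e20)//.
      have h1 := hk1 k kk1.
      have : normc (hseq (u m) j - l j) <=
          normc (hseq (u m) j - hseq (u k) j) + normc (hseq (u k) j - l j).
        by rewrite (le_trans _ (normcD _ _))// subrKA.
      lra.
    exists (maxn k0 n); rewrite leq_maxr; split => //; apply: hk0; exact: leq_maxl.
  have [_ h] := lux_lt yF (hseq_in (u m - u k)) (hn _ _ nm nk).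
  apply: le_trans (h s us); rewrite big_seq [leRHS]big_seq; apply: ler_sum => j js.
  apply: (young_le yF); first by rewrite divr_ge0 ?normc_ge0 ?ltW.
  by rewrite hseqB; exact: hk.
have lin : inL F l.
  have [n /(_ n (leqnn n)) h] := adm 1 ltr01.
  have := inL_lin yF (-1) (ex_intro _ _ h) (hseq_in (u n)).
  by congr inL; apply/funext => j; rewrite mulN1r opprB subrK.
exists (HalfSequence lin lneg) => e e0.
have e20 : 0 < e / 2 by rewrite divr_gt0.
have [n hn] := adm _ e20; exists n => m nm.
apply: (@le_lt_trans _ _ (e / 2)); last by rewrite ltr_pdivrMr//; lra.
rewrite /onorm (_ : hseq (u m - _ : ospace yF) = fun j => hseq (u m) j - l j).
  exact: lux_le (hn _ nm).
by apply/funext => j; exact: hseqB.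
Qed.

Definition orlicz_banach : banach R := Banach (@onorm_ge0 _ _ yF)
  (@onorm_eq0 _ _ yF) (@onormZ _ _ yF) (@onormD _ _ yF) ospace_complete.

End OrliczComplete.

(** * Convolution of finitely supported sequences *)

Section FiniteSupport.
Context {R : realType}.
Implicit Types (f g c : int -> R[i]).

Lemma S0P f : S0 f <-> exists2 s : seq int, uniq s & forall n, n \notin s -> f n = 0.
Proof.
split=> [/finite_seqP[s hs]|[s us hs]].
  exists (undup s) => [|n]; first exact: undup_uniq.
  rewrite mem_undup => ns; apply/eqP; apply: contraNT ns => fn.
  by have : [set k | f k != 0] n by []; rewrite hs.
apply: (@sub_finite_set _ _ [set` s]); last exact: finite_seq.
by move=> n /=; apply: contraNT => /hs ->.
Qed.

Lemma S0_lin a f g : S0 f -> S0 g -> S0 (fun n => a * f n + g n).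
Proof.
move=> /S0P[s _ hs] /S0P[t _ ht]; apply/S0P; exists (undup (s ++ t)).
  exact: undup_uniq.
by move=> n; rewrite mem_undup mem_cat negb_or => /andP[/hs -> /ht ->]; rewrite mulr0 addr0.
Qed.

Lemma S0_comp f (h : int -> int) k : (forall n, h (k n) = n) -> (forall n, k (h n) = n) ->
  S0 f -> S0 (fun n => f (h n)).
Proof.
move=> hk kh /S0P[s _ hs]; apply/S0P; exists (undup (map k s)); first exact: undup_uniq.
move=> n; rewrite mem_undup => ns; apply: hs; apply: contra ns => hn.
by apply/mapP; exists (h n).
Qed.

(** [conv a] is this convolution with [c] the Fourier coefficients of [a]; working with coefficient
    sequences makes differences of symbols termwise. *)
Definition convk c f : int -> R[i] := fun j =>
  \sum_(k \in [set: int]) c (j - k) * f k.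

Lemma convkE c f s : uniq s -> (forall n, n \notin s -> f n = 0) ->
  forall j, convk c f j = \sum_(k <- s) c (j - k) * f k.
Proof.
move=> us hs j; rewrite /convk [RHS]fsbig_seq//.
rewrite [RHS](fsbig_widen [set` s] [set: int])// => k [_ /negP ks].
by rewrite /= hs ?mulr0.
Qed.

Lemma convk_lin c a f g : S0 f -> S0 g ->
  convk c (fun n => a * f n + g n) = (fun j => a * convk c f j + convk c g j).
Proof.
move=> /S0P[s us hs] /S0P[t ut ht]; apply/funext => j.
have uu := undup_uniq (s ++ t).
have hu n : n \notin undup (s ++ t) -> f n = 0 /\ g n = 0.
  by rewrite mem_undup mem_cat negb_or => /andP[/hs -> /ht ->].
rewrite !(@convkE _ _ _ uu) => [|n /hu[_ ->]//|n /hu[-> _]//|n /hu[-> ->]].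
  rewrite mulr_sumr -big_split/=; apply: eq_bigr => k _.
  by rewrite mulrDr mulrCA.
by rewrite mulr0 addr0.
Qed.

Lemma convkB c d f : S0 f ->
  convk (fun n => c n - d n) f = (fun j => convk c f j - convk d f j).
Proof.
move=> /S0P[s us hs]; apply/funext => j; rewrite !(@convkE _ _ _ us)//.
by rewrite -sumrB; apply: eq_bigr => k _; rewrite mulrBl.
Qed.

Lemma convk_shift c f d : S0 f ->
  convk c (fun n => f (n - d)) = (fun j => convk c f (j - d)).
Proof.
move=> /S0P[s us hs]; apply/funext => j.
rewrite [RHS](@convkE _ _ _ us)// (@convkE _ _ (map (fun n => n + d) s)).
- rewrite big_map; apply: eq_bigr => k _; rewrite addrK; congr (c _ * _).
  by rewrite opprD addrA addrAC.
- by rewrite map_inj_uniq//; exact: addIr.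
- move=> n ns; apply: hs; apply: contra ns => h.
  by apply/mapP; exists (n - d); rewrite ?subrK.
Qed.

(** The bump acting on two-sided sequences, where the shifts are truly inverse to each other; the
    coefficients are those of [bumpE]. *)
Definition pz (w : R[i]) f : int -> R[i] := fun j =>
  w / 4%:R * f (j + 1) + (2^-1 * f j + w^-1 / 4%:R * f (j - 1)).

Lemma S0_pz w f : S0 f -> S0 (pz w f).
Proof.
move=> hf; apply: (S0_lin _ (f := fun j => f (j + 1))).
  by apply: (S0_comp (k := fun j => j - 1)) => // n; [exact: subrK|exact: addrK].
apply: S0_lin => //.
have := @S0_lin (w^-1 / 4%:R) (fun j => f (j - 1)) (fun=> 0).
under [X in _ -> _ -> S0 X]eq_fun do rewrite addr0; apply.
  by apply: (S0_comp (k := fun j => j + 1)) => // n; [exact: addrK|exact: subrK].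
by apply/S0P; exists [::].
Qed.

Lemma S0_iter_pz w N f : S0 f -> S0 (iter N (pz w) f).
Proof. by move=> hf; elim: N => //= N IH; exact: S0_pz. Qed.

End FiniteSupport.

Section SequenceOperators.
Context {R : realType} {F : R -> R}.
Implicit Types (f g : int -> R[i]) (l : R).
Variable yF : young F.

Lemma admissible_le_abs f g l : (forall n, normc (f n) <= normc (g n)) ->
  admissible F g l -> admissible F f l.
Proof.
move=> fg [l0 h]; split => //.
apply: modular_le_mono h => // n; first exact: normc_div_ge0.
by rewrite ler_wpM2r ?invr_ge0 ?(ltW l0).
Qed.

Lemma admissible_comp f (h : int -> int) l : injective h ->
  admissible F f l -> admissible F (fun n => f (h n)) l.
Proof.
move=> hi [l0 hm]; split => // s us.
have := hm (map h s); rewrite map_inj_uniq// => /(_ us).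
by rewrite big_map.
Qed.

Lemma lux_mono f g : inL F g -> (forall l, admissible F g l -> admissible F f l) ->
  lux F f <= lux F g.
Proof.
move=> hg h; apply: le_of_le_add_eps => e e0.
by apply/lux_le/h/lux_lt => //; rewrite ltrDl.
Qed.

Lemma ler_sum_seq_support (T : eqType) (G : T -> R) (s t : seq T) : uniq s ->
    (forall n, 0 <= G n) -> (forall n, n \in s -> n \notin t -> G n = 0) ->
  \sum_(n <- s) G n <= \sum_(n <- t) G n.
Proof.
elim: s t => [|x s IH] t /=; first by move=> _ G0 _; rewrite big_nil sumr_ge0.
move=> /andP[xs us] G0 h; rewrite big_cons.
have [xt|xt] := boolP (x \in t).
  rewrite (big_rem x xt)/= lerD2l; apply: IH => // n ns nt.
  apply: h; first by rewrite inE ns orbT.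
  apply: contra nt => nt; have := perm_mem (perm_to_rem xt) n.
  rewrite nt inE => /esym/orP[/eqP e|//].
  by rewrite e in ns; rewrite ns in xs.
rewrite (h x)// ?inE ?eqxx// add0r; apply: IH => // n ns nt.
by apply: h; rewrite // inE ns orbT.
Qed.

Lemma inL_S0 f : S0 f -> inL F f.
Proof.
move=> /S0P[s us hs].
pose M := \sum_(n <- s) F (normc (f n)).
have M0 : 0 <= M by rewrite sumr_ge0// => n _; rewrite young_ge0// normc_ge0.
have M1 : 0 < M + 1 by rewrite ltr_wpDl.
exists (M + 1); split => // t ut.
have h0 n : 0 <= normc (f n) / (M + 1) by exact: normc_div_ge0.
apply: (@le_trans _ _ (\sum_(n <- s) F (normc (f n) / (M + 1)))).
  apply: ler_sum_seq_support => // n; first by rewrite young_ge0.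
  by move=> _ /hs ->; rewrite ComplexField.Normc.normc0 mul0r (young0 yF).
apply: (@le_trans _ _ (\sum_(n <- s) (M + 1)^-1 * F (normc (f n)))).
  apply: ler_sum => n _; rewrite mulrC; apply: young_scale => //.
  - by rewrite invr_ge0 ltW.
  - by rewrite invf_le1// lerDr.
  - exact: normc_ge0.
by rewrite -mulr_sumr ler_pdivrMl// mulr1 lerDl.
Qed.

Definition restr (s : seq int) f : int -> R[i] := fun n => if n \in s then f n else 0.

Hypothesis delta2 : exists2 D, 0 <= D & forall t, 0 <= t -> F (2 * t) <= D * F t.

(** Under the doubling condition the modular is finite at every scale: the passage from scale l to
    scale e is dominated by k doublings with 2^k >= l / e. *)
Lemma modular_finite f e : inL F f -> 0 < e ->
  exists2 M, 0 <= M & modular_le F (fun n => normc (f n) / e) M.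
Proof.
move=> [l [l0 hl]] e0; have [D D0 hD] := delta2.
have [k hk] : exists k : nat, l / e <= 2 ^+ k.
  have [n hn] : exists n : nat, l / e < n%:R.
    by exists (Num.bound (l / e)); exact: archi_boundP (divr_ge0 (ltW l0) (ltW e0)).
  exists n; rewrite ltW// (lt_le_trans hn)// -natrX ler_nat ltnW//; exact: ltn_expl.
have hDk t : 0 <= t -> F (2 ^+ k * t) <= D ^+ k * F t.
  elim: {hk} k t => [|k IH] t t0; first by rewrite !expr0 !mul1r.
  rewrite exprS -mulrA (le_trans (hD _ _))//; first by rewrite mulr_ge0// exprn_ge0.
  by rewrite exprS -mulrA ler_wpM2l// IH.
exists (D ^+ k); first exact: exprn_ge0.
move=> s us; apply: (@le_trans _ _ (\sum_(n <- s) D ^+ k * F (normc (f n) / l))).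
  apply: ler_sum => n _; apply: (le_trans _ (hDk _ (normc_div_ge0 f n l0))).
  apply: (young_le yF); first exact: normc_div_ge0.
  have -> : normc (f n) / e = (l / e) * (normc (f n) / l).
    by field; rewrite !gt_eqF.
  by rewrite ler_wpM2r// normc_div_ge0.
by rewrite -mulr_sumr -[leRHS]mulr1 ler_wpM2l ?exprn_ge0// hl.
Qed.

Lemma restr_dense f e : inL F f -> 0 < e ->
  exists2 s, uniq s & lux F (fun n => f n - restr s f n) <= e.
Proof.
move=> hf e0; have [M M0 hM] := modular_finite hf e0.
pose G n := F (normc (f n) / e).
(* A finite set whose modular cannot be raised by more than 1; otherwise partial sums would grow by
   1 forever, past the bound M. Its complement has modular at most 1 at scale e, that is, norm at
   most e. *)
have [s us hs] : exists2 s, uniq s &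
    forall t, uniq t -> \sum_(n <- t) G n <= \sum_(n <- s) G n + 1.
  apply: contrapT => no.
  have step k : exists2 s, uniq s & k%:R <= \sum_(n <- s) G n.
    elim: k => [|k [s us hs]]; first by exists [::]; rewrite ?big_nil.
    have /existsNP[t /not_implyP[ut /negP]] :
        ~ forall t, uniq t -> \sum_(n <- t) G n <= \sum_(n <- s) G n + 1.
      by move=> h; apply: no; exists s.
    rewrite -ltNge => /ltW h; exists t => //.
    by rewrite -natr1 (le_trans _ h)// lerD2r.
  have [s us hs] := step (Num.bound (M + 1)).
  have h1 : M + 1 < (Num.bound (M + 1))%:R by apply: archi_boundP; rewrite addr_ge0.
  by have := le_trans hs (hM s us); have := h1; lra.
exists s => //; apply: lux_le; split => // t ut.
pose t' := [seq n <- t | n \notin s].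
have ts : uniq (t' ++ s).
  rewrite cat_uniq filter_uniq//= us andbT; apply/hasPn => n ns.
  by rewrite mem_filter ns.
have := hs _ ts; rewrite big_cat/= addrC lerD2l; apply: le_trans.
rewrite big_filter [leRHS]big_mkcond/=; apply: ler_sum => n _; rewrite /restr.
case: (n \in s); last by rewrite subr0.
by rewrite subrr ComplexField.Normc.normc0 mul0r (young0 yF).
Qed.

End SequenceOperators.

(** * Toeplitz operators *)

Section Toeplitz.
Context {R : realType} {F : R -> R}.
Variable yF : young F.
Hypothesis delta2 : exists2 D, 0 <= D & forall t, 0 <= t -> F (2 * t) <= D * F t.

Local Notation E := (orlicz_banach yF).
Implicit Types (x y : E) (f : int -> R[i]).

Lemma hseq_lin (c : R[i]) x y j : hseq (c *: x + y) j = c * hseq x j + hseq y j.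
Proof. by rewrite hseqD hseqZ. Qed.

Definition half (f : int -> R[i]) (hf : inL F f)
  (f0 : forall j, j < 0 -> f j = 0) : E := HalfSequence hf f0.

Fact shift_in x : inL F (fun j => hseq x (j - 1)).
Proof.
have [l hl] := hseq_in x; exists l.
by apply: (admissible_comp (f := hseq x) (h := fun j => j - 1)) => //; exact: addIr.
Qed.

Fact shift_neg x j : j < 0 -> hseq x (j - 1) = 0.
Proof. by move=> j0; rewrite hseq_neg//; lia. Qed.

Fact unshift_in x : inL F (Pplus (fun j => hseq x (j + 1))).
Proof.
have [l hl] := hseq_in x; exists l.
apply: (@admissible_le_abs _ _ yF _ (fun j => hseq x (j + 1))); last first.
  by apply: (admissible_comp (f := hseq x) (h := fun j => j + 1)) => //; exact: addIr.
move=> n; rewrite /Pplus; case: ifP => // _.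
by rewrite ComplexField.Normc.normc0 normc_ge0.
Qed.

Fact Pplus_neg f j : j < 0 -> Pplus f j = 0.
Proof. by rewrite /Pplus ltNge => /negPf ->. Qed.

Lemma Pplus_in f l : admissible F f l -> admissible F (Pplus f) l.
Proof.
apply: admissible_le_abs => // n; rewrite /Pplus; case: ifP => // _.
by rewrite ComplexField.Normc.normc0 normc_ge0.
Qed.

Definition shift_fun x : E := half (shift_in x) (shift_neg x).
Definition unshift_fun x : E := half (unshift_in x) (Pplus_neg (fun j => hseq x (j + 1))).

Fact shift_linear c x y : shift_fun (c *: x + y) = c *: shift_fun x + shift_fun y.
Proof.
by apply: ospaceP => j; rewrite [RHS]hseq_lin/= -hseq_lin.
Qed.

Fact unshift_linear c x y :
  unshift_fun (c *: x + y) = c *: unshift_fun x + unshift_fun y.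
Proof.
apply: ospaceP => j; rewrite [RHS]hseq_lin/= /Pplus; case: ifP => _.
  by rewrite -hseq_lin.
by rewrite mulr0 addr0.
Qed.

Fact shift_norm x : bnorm (shift_fun x) <= bnorm x.
Proof.
apply: (lux_mono yF) => [|l hl]; first exact: hseq_in.
by apply: (admissible_comp (f := hseq x) (h := fun j => j - 1)) => //; exact: addIr.
Qed.

Fact unshift_norm x : bnorm (unshift_fun x) <= bnorm x.
Proof.
apply: (lux_mono yF) => [|l hl]; first exact: hseq_in.
apply: Pplus_in.
by apply: (admissible_comp (f := hseq x) (h := fun j => j + 1)) => //; exact: addIr.
Qed.

Fact bop_of_norm1 (T : E -> E) : (forall x, bnorm (T x) <= bnorm x) ->
  exists2 C, 0 <= C & forall x, bnorm (T x) <= C * bnorm x.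
Proof. by move=> h; exists 1 => // x; rewrite mul1r. Qed.

Definition shiftV : bop E := Bop shift_linear (bop_of_norm1 shift_norm).
Definition shiftU : bop E := Bop unshift_linear (bop_of_norm1 unshift_norm).

Lemma shiftVE x j : hseq (shiftV x) j = hseq x (j - 1). Proof. by []. Qed.
Lemma shiftUE x j : hseq (shiftU x) j = Pplus (fun j => hseq x (j + 1)) j.
Proof. by []. Qed.

Lemma shiftUV : shiftU * shiftV = 1.
Proof.
apply: bopP => x; rewrite bop1E; apply: ospaceP => j /=; rewrite /Pplus.
by case: ifP => [_|/negbT]; [rewrite addrK|rewrite -ltNge => /(hseq_neg x) ->].
Qed.

Lemma shiftU_le1 : opnorm_le shiftU 1.
Proof. by split=> // x; rewrite mul1r; exact: unshift_norm. Qed.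

Lemma shiftV_le1 : opnorm_le shiftV 1.
Proof. by split=> // x; rewrite mul1r; exact: shift_norm. Qed.

Definition delta0 : int -> R[i] := fun j => (j == 0)%:R.

Fact delta0_S0 : S0 delta0.
Proof.
apply/S0P; exists [:: 0] => // n; rewrite inE /delta0.
by case: (n == 0).
Qed.

Fact delta0_neg j : j < 0 -> delta0 j = 0.
Proof. by move=> j0; rewrite /delta0 lt_eqF. Qed.

Definition unit0 : E := half (inL_S0 yF delta0_S0) delta0_neg.

Definition ev0 x : R[i] := hseq x 0.

Lemma ev0_linear c x y : ev0 (c *: x + y) = c * ev0 x + ev0 y.
Proof. exact: hseq_lin. Qed.

Lemma ev0_bounded : exists2 C, 0 <= C & forall x, normc (ev0 x) <= C * bnorm x.
Proof.
exists (coord_const F) => [|x]; first exact: ltW (coord_const_gt0 yF).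
exact: (lux_coord yF 0 (hseq_in x)).
Qed.

Lemma shift_decomposition x : x - shiftV (shiftU x) = ev0 x *: unit0.
Proof.
apply: ospaceP => j; rewrite hseqB hseqZ /= /Pplus /delta0 /ev0.
case: (ltgtP j 0) => [j0|j0|->] /=; rewrite ?subrr ?mulr0 ?mulr1.
- by rewrite (_ : (0 <= j - 1) = false) ?hseq_neg ?subr0//; lia.
- by rewrite (_ : (0 <= j - 1) = true) ?subrK ?subrr//; lia.
- by rewrite subr0.
Qed.

Lemma ev0_unit0 : ev0 unit0 = 1.
Proof. by rewrite /ev0 /= /delta0 eqxx. Qed.

Lemma ev0_shiftX x (j : nat) : ev0 ((shiftU ^+ j) x) = hseq x j%:Z.
Proof.
have h k : hseq ((shiftU ^+ j) x) k%:Z = hseq x (j + k)%N%:Z.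
  elim: j k => [|j IH] k; first by rewrite expr0 bop1E.
  rewrite exprS [LHS](_ : _ = hseq ((shiftU ^+ j) x) (k + 1)%N%:Z); last first.
    by rewrite /= /Pplus PoszD.
  by rewrite IH; congr (hseq x _); lia.
by rewrite /ev0 h addn0.
Qed.

Lemma ev0_sep x : (forall j, ev0 ((shiftU ^+ j) x) = 0) -> x = 0.
Proof.
move=> h; apply: ospaceP => -[j|j]; first by rewrite -ev0_shiftX h.
by rewrite !hseq_neg.
Qed.

Definition fin_seq : set E := [set x | S0 (hseq x)].

Lemma fin_seq_lin c x y : fin_seq x -> fin_seq y -> fin_seq (c *: x + y).
Proof.
move=> hx hy; have := S0_lin c hx hy; rewrite /fin_seq /=.
by congr S0; apply/funext => j; exact/esym/hseq_lin.
Qed.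

Lemma fin_seq_dense x e : 0 < e -> exists2 d, fin_seq d & bnorm (x - d) <= e.
Proof.
move=> e0; have [s us hs] := restr_dense yF delta2 (hseq_in x) e0.
have hS : S0 (restr s (hseq x)).
  by apply/S0P; exists s => // n ns; rewrite /restr (negPf ns).
have hneg j : j < 0 -> restr s (hseq x) j = 0.
  by move=> /(hseq_neg x); rewrite /restr => ->; case: ifP.
exists (half (inL_S0 yF hS) hneg) => //; apply: le_trans hs.
by rewrite /bnorm /= /onorm le_eqVlt; apply/orP; left; apply/eqP; congr lux; apply/funext => j; rewrite hseqB.
Qed.

Lemma eq_on_dense (S T : bop E) : (forall x, fin_seq x -> S x = T x) -> S = T.
Proof.
move=> h; apply: bopP => x; apply/eqP; rewrite -subr_eq0; apply/eqP/bnorm_eq0/eqP.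
rewrite eq_le bnorm_ge0 andbT; apply: le_of_le_add_eps => e e0; rewrite add0r.
have [C [C0 hC]] := opnorm_ex (S - T); have C1 : 0 < C + 1 by rewrite ltr_wpDl.
have [d Dd hd] := fin_seq_dense x (divr_gt0 e0 C1).
have -> : S x - T x = (S - T) (x - d).
  by rewrite bopB bop_subE [(S - T) d]bop_subE (h d)// subrr subr0.
apply: (le_trans (hC _)); apply: (le_trans (ler_wpM2l C0 hd)).
by rewrite mulrCA ler_piMr ?(ltW e0)// ler_pdivrMr// mul1r lerDl.
Qed.

Lemma opnorm_le_dense (T : bop E) C : 0 <= C ->
  (forall x, fin_seq x -> bnorm (T x) <= C * bnorm x) -> opnorm_le T C.
Proof.
move=> C0 h; split => // x; apply: le_of_le_add_eps => e e0.
have [D [D0 hD]] := opnorm_ex T; have DC : 0 < D + C + 1 by rewrite ltr_wpDl// addr_ge0.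
have [d Dd hd] := fin_seq_dense x (divr_gt0 e0 DC).
have -> : T x = T (x - d) + T d by rewrite -bopD subrK.
apply: (le_trans (bnormD _ _)); apply: (le_trans (lerD (hD _) (h _ Dd))).
have hd' : bnorm d <= bnorm x + e / (D + C + 1).
  by rewrite -(subrK x d) addrC (le_trans (bnormD _ _))// lerD2l bnormB.
apply: (le_trans (lerD (ler_wpM2l D0 hd) (ler_wpM2l C0 hd'))).
rewrite mulrDr addrCA lerD2l -mulrDl mulrCA ler_piMr ?(ltW e0)//.
by rewrite ler_pdivrMr// mul1r lerDl.
Qed.

Definition toeplitz (c : int -> R[i]) (A : bop E) : Prop :=
  forall x, fin_seq x -> hseq (A x) = Pplus (convk c (hseq x)).

Definition mult_le (T : (int -> R[i]) -> int -> R[i]) C : Prop :=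
  forall f, S0 f -> inL F (T f) /\ lux F (T f) <= C * lux F f.

Lemma toeplitz_exists c C : 0 <= C -> mult_le (convk c) C -> exists A, toeplitz c A.
Proof.
move=> C0 hc.
have /choice[T0 hT0] : forall x, exists y : E, fin_seq x ->
    hseq y = Pplus (convk c (hseq x)).
  move=> x; have [Sx|nSx] := pselect (fin_seq x); last by exists 0.
  have [[l hl] _] := hc _ Sx.
  by exists (half (ex_intro _ _ (Pplus_in hl)) (Pplus_neg (convk c (hseq x)))).
have [||A [hA _]] := @dense_extension R E fin_seq T0 C C0 fin_seq_lin fin_seq_dense.
- move=> a x y Dx Dy; apply: ospaceP => j; rewrite hT0; last exact: fin_seq_lin.
  rewrite hseq_lin !hT0// (_ : hseq _ = fun j => a * hseq x j + hseq y j); last first.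
    by apply/funext => k; exact: hseq_lin.
  by rewrite convk_lin// /Pplus; case: ifP => // _; rewrite mulr0 addr0.
- move=> x Dx; have [hi hn] := hc _ Dx; apply: le_trans hn.
  rewrite /bnorm /= /onorm hT0//; apply: (lux_mono yF) => // l; exact: Pplus_in.
by exists A => x Dx; rewrite hA// hT0.
Qed.

Lemma fin_seq_shiftV x : fin_seq x -> fin_seq (shiftV x).
Proof.
move=> h; apply: (S0_comp (f := hseq x) (h := fun j => j - 1) (k := fun j => j + 1)) => // n.
  exact: addrK.
exact: subrK.
Qed.

Lemma toeplitz_shift c A : toeplitz c A -> shiftU * A * shiftV = A.
Proof.
move=> hA; apply: eq_on_dense => x Dx; apply: ospaceP => j.
have -> : (shiftU * A * shiftV) x = shiftU (A (shiftV x)) by [].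
rewrite shiftUE hA; last exact: fin_seq_shiftV.
rewrite hA// /Pplus; case: ifP => // j0.
rewrite ifT; last by lia.
rewrite (_ : hseq (shiftV x) = fun j => hseq x (j - 1)) ?convk_shift ?addrK//.
Qed.

Lemma toeplitz_sub c d A B : toeplitz c A -> toeplitz d B ->
  toeplitz (fun n => c n - d n) (A - B).
Proof.
move=> hA hB x Dx; apply/funext => j; rewrite bop_subE hseqB hA// hB// convkB//.
by rewrite /Pplus; case: ifP => // _; rewrite subrr.
Qed.

Local Notation cbump w := (bump calkin_scal (cl shiftU) (cl shiftV) w).

(** The class is represented by [A * P ^+ n * shiftV ^+ n * shiftU ^+ n]. Pushing the support n
    places to the right first lets n applications of [P], each of width 1, stay clear of the
    boundary. The half-line operator then agrees with the two-sided convolution, whose bound [C]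
    carries over; both shifts have norm at most 1. *)
Lemma toeplitz_ess_le c A w n C : toeplitz c A -> w != 0 -> 0 <= C ->
  mult_le (fun f => convk c (iter n (pz w) f)) C ->
  ess_le (cl A * cbump w ^+ n) C.
Proof.
move=> hA w0 C0 hC.
pose P : bop E := bop_scal (w / 4%:R) * shiftU + bop_scal 2^-1 +
  bop_scal (w^-1 / 4%:R) * shiftV.
have PE : cl P = cbump w.
  rewrite bumpE//; last by rewrite -clM shiftUV.
    by rewrite !clD !clM.
  exact: calkin_scalC.
have cVU : cl shiftV * cl shiftU = 1 :> calkin E.
  rewrite -clM -cl1; apply/esym/clP; exists [:: unit0] => x /=.
  by exists (ev0 x); rewrite scale1r shift_decomposition subrr.
have cVUn : cl (shiftV ^+ n * shiftU ^+ n) = 1 :> calkin E.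
  rewrite clM !clX; elim: n {hC} => [|n IH]; first by rewrite mulr1.
  by rewrite exprSr exprS mulrA -[_ * cl shiftV * _]mulrA cVU mulr1.
exists (A * P ^+ n * shiftV ^+ n * shiftU ^+ n).
  by rewrite -mulrA clM cVUn mulr1 clM clX PE.
have Un : opnorm_le (shiftU ^+ n) 1.
  split => // x; rewrite mul1r; elim: n {hC cVUn} x => [|n IH] x; first by rewrite expr0 bop1E.
  by rewrite exprS /=; exact: le_trans (unshift_norm _) (IH _).
suff h : opnorm_le (A * P ^+ n * shiftV ^+ n) C.
  split => // x; apply: (le_trans (h.2 _)); rewrite ler_wpM2l//.
  by have := Un.2 x; rewrite mul1r.
apply: opnorm_le_dense => // x Dx.
have Vn m j : hseq ((shiftV ^+ m) x) j = hseq x (j - m%:Z).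
  elim: m j => [|m IH] j; first by rewrite expr0 bop1E subr0.
  by rewrite exprS /= IH; congr (hseq x _); lia.
(* Invariant: after k bumps the support lies in [n - k, +oo), so for k < n the backward shift has
   not yet discarded anything. *)
have key k : (k <= n)%N -> hseq ((P ^+ k * shiftV ^+ n) x) =
      iter k (pz w) (fun j => hseq x (j - n%:Z)) /\
    forall j, j < (n - k)%:Z -> hseq ((P ^+ k * shiftV ^+ n) x) j = 0.
  elim: k => [_|k IH kn].
    rewrite expr0 mul1r; split; first by apply/funext => j; rewrite Vn.
    by move=> j jn; rewrite Vn hseq_neg//; lia.
  have [e v] := IH (ltnW kn); rewrite iterS -e exprS -mulrA.
  set y := (P ^+ k * shiftV ^+ n) x in e v *.
  have PyE : hseq ((P * (P ^+ k * shiftV ^+ n)) x) = pz w (hseq y).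
    apply/funext => j; rewrite [LHS](_ : _ = hseq (w / 4%:R *: shiftU y +
      2^-1 *: y + (w^-1 / 4%:R) *: shiftV y) j)//.
    rewrite !hseqD !hseqZ /pz -addrA shiftUE shiftVE; congr (_ * _ + _).
    by rewrite /Pplus; case: ifP => // /negbT j0; rewrite v//; lia.
  rewrite PyE; split => // j jn; rewrite /pz !v ?mulr0 ?addr0//; lia.
have [e _] := key n (leqnn n).
have Sx : S0 (fun j => hseq x (j - n%:Z)).
  apply: (S0_comp (f := hseq x) (h := fun j => j - n%:Z) (k := fun j => j + n%:Z)) => // m.
    exact: addrK.
  exact: subrK.
have Dy : fin_seq ((P ^+ n * shiftV ^+ n) x).
  by rewrite /fin_seq /= e; exact: S0_iter_pz.
have -> : (A * P ^+ n * shiftV ^+ n) x = A ((P ^+ n * shiftV ^+ n) x) by rewrite -mulrA.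
have [hi hn] := hC _ Sx.
rewrite [leLHS](_ : _ = lux F (Pplus (convk c (iter n (pz w) (fun j => hseq x (j - n%:Z)))))); last first.
  by rewrite /bnorm /= /onorm hA// e.
apply: (@le_trans _ _ (lux F (convk c (iter n (pz w) (fun j => hseq x (j - n%:Z)))))).
  by apply: (lux_mono yF) => // l; exact: Pplus_in.
apply: (le_trans hn); rewrite ler_wpM2l//; apply: (lux_mono yF); first exact: hseq_in.
by move=> l hl; apply: (admissible_comp (f := hseq x) (h := fun j => j - n%:Z)) => //; exact: addIr.
Qed.

End Toeplitz.

(** * Interpolation *)

Section DyadicSums.
Context {R : realType}.
Implicit Types (x y : R).

Definition pow2 x : R := 2 `^ x.

Lemma pow2_gt0 x : 0 < pow2 x. Proof. exact: powR_gt0. Qed.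

Lemma pow2D x y : pow2 (x + y) = pow2 x * pow2 y.
Proof. by rewrite /pow2 powRD// pnatr_eq0 implybT. Qed.

Lemma pow2X x n : pow2 x ^+ n = pow2 (x * n%:R).
Proof. by rewrite /pow2 powRrM powR_mulrn// powR_ge0. Qed.

Lemma ler_pow2 x y : x <= y -> pow2 x <= pow2 y.
Proof. by move=> xy; apply: ler_powR => //; rewrite ler1n. Qed.

Lemma pow2_lt1 x : x < 0 -> pow2 x < 1.
Proof.
move=> x0; rewrite /pow2 /powR pnatr_eq0/= expR_lt1 pmulr_llt0//.
by rewrite ln_gt0// ltr1n.
Qed.

Lemma pow2_log x : 0 < x -> exists m, x = pow2 m.
Proof.
move=> x0; exists (ln x / ln 2); rewrite /pow2 /powR pnatr_eq0/= divfK ?lnK//.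
by rewrite gt_eqF// ln_gt0// ltr1n.
Qed.

Lemma sum_geometric_nat (r : R) (s : seq nat) : 0 <= r -> r < 1 -> uniq s ->
  \sum_(n <- s) r ^+ n <= (1 - r)^-1.
Proof.
move=> r0 r1 us; set m := (\max_(n <- s) n).+1.
have r1' : 0 < 1 - r by rewrite subr_gt0.
apply: (@le_trans _ _ (\sum_(n <- iota 0 m) r ^+ n)).
  apply: ler_sum_seq_support => // n; first exact: exprn_ge0.
  by rewrite mem_iota/= add0n /m ltnS => ns; rewrite (@leq_bigmax_seq _ s xpredT id n ns).
rewrite -[iota 0 m]/(index_iota 0 m) big_mkord.
rewrite -[leRHS]mul1r ler_pdivlMr// mulrC.
have := subrX1 r m; rewrite -opprB -[r - 1]opprB mulNr => /oppr_inj <-.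
by rewrite lerBlDr lerDl exprn_ge0.
Qed.

Lemma sum_geometric_int (r : R) (h : int -> nat) (P : pred int) (s : seq int) :
    0 <= r -> r < 1 -> uniq s -> {in P &, injective h} ->
  \sum_(k <- s | P k) r ^+ h k <= (1 - r)^-1.
Proof.
move=> r0 r1 us hi; rewrite -big_filter -(big_map h xpredT (fun n => r ^+ n)).
apply: sum_geometric_nat => //; rewrite map_inj_in_uniq ?filter_uniq// => x y.
by rewrite !mem_filter => /andP[xP _] /andP[yP _]; exact: hi.
Qed.

Definition dyadic_const (th : R) : R :=
  (1 - pow2 (- th))^-1 + (1 - pow2 (- (1 - th)))^-1.

(** The two bounds cross at the real m with 2^m = b / a, where both equal a^(1 - th) b^th. To either
    side of m the better bound decays geometrically, which gives the two series in
    [dyadic_const]. *)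
Lemma dyadic_sum (th a b : R) (I : seq int) (G : int -> R) :
    0 < th -> th < 1 -> 0 <= a -> 0 <= b -> uniq I ->
    (forall k, G k <= pow2 (k%:~R * th) * a) ->
    (forall k, G k <= pow2 (- (k%:~R * (1 - th))) * b) ->
  \sum_(k <- I) G k <= dyadic_const th * (a `^ (1 - th) * b `^ th).
Proof.
move=> t0 t1 a0 b0 uI Ga Gb; have t1' : 0 < 1 - th by rewrite subr_gt0.
have r1 : pow2 (- th) < 1 by rewrite pow2_lt1// oppr_lt0.
have r2 : pow2 (- (1 - th)) < 1 by rewrite pow2_lt1// oppr_lt0.
have C0 : 0 <= dyadic_const th.
  by rewrite addr_ge0// invr_ge0 subr_ge0 ltW.
have [b00|b0'] := eqVneq b 0.
  apply: (@le_trans _ _ 0); last by rewrite !mulr_ge0// powR_ge0.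
  by apply: sumr_le0 => k _; rewrite (le_trans (Gb k))// b00 mulr0.
have [a00|a0'] := eqVneq a 0.
  apply: (@le_trans _ _ 0); last by rewrite !mulr_ge0// powR_ge0.
  by apply: sumr_le0 => k _; rewrite (le_trans (Ga k))// a00 mulr0.
have {a0 a0'}a0 : 0 < a by rewrite lt_neqAle eq_sym a0'.
have {b0 b0'}b0 : 0 < b by rewrite lt_neqAle eq_sym b0'.
have [m mE] := pow2_log (divr_gt0 b0 a0).
have bE : b = a * pow2 m by rewrite -mE mulrC divfK// gt_eqF.
have QE : a `^ (1 - th) * b `^ th = a * pow2 (m * th).
  rewrite bE powRM ?(ltW a0) ?(ltW (pow2_gt0 _))// mulrA -powRD; last first.
    by rewrite (gt_eqF a0) implybT.
  by rewrite subrK powRr1 ?(ltW a0)// /pow2 -powRrM.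
rewrite QE; set Q := a * _; have Q0 : 0 < Q by rewrite mulr_gt0// pow2_gt0.
pose j : int := Num.floor m.
have jm : j%:~R <= m by exact: floor_le.
have mj : m < j%:~R + 1.
  by have := floorD1_gt m; rewrite rmorphD.
rewrite (bigID (fun k => k <= j))/= /dyadic_const mulrDl lerD//.
  apply: (@le_trans _ _ (\sum_(k <- I | k <= j) pow2 (- th) ^+ `|j - k| * Q)).
    apply: ler_sum => k kj; apply: (le_trans (Ga k)).
    rewrite /Q mulrCA [leLHS]mulrC ler_wpM2l ?(ltW a0)// pow2X -pow2D ler_pow2//.
    have -> : `|j - k|%:R = j%:~R - k%:~R :> R.
      by rewrite -rmorphB/= pmulrn; congr (_%:~R); move: j kj {jm mj}; clear; lia.
    by have := ler_wpM2l (ltW t0) jm; lra.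
  rewrite -mulr_suml ler_wpM2r ?(ltW Q0)//.
  apply: (@sum_geometric_int _ (fun k => `|j - k|%N) (fun k => k <= j)) => //.
    exact: ltW (pow2_gt0 _).
  by move=> x y; rewrite !unfold_in; move: j {jm mj} => j; clear; lia.
(* The exponent k - j - 1 starts at 0: as m < j + 1, the second bound at k = j + 1 is already below
   the common value. *)
apply: (@le_trans _ _ (\sum_(k <- I | ~~ (k <= j)) pow2 (- (1 - th)) ^+ absz (k - j - 1)%R * Q)).
  apply: ler_sum => k kj; apply: (le_trans (Gb k)).
  rewrite bE /Q mulrCA [leRHS]mulrCA ler_wpM2l ?(ltW a0)// pow2X -!pow2D ler_pow2//.
  have -> : (absz (k - j - 1)%R)%:R = k%:~R - j%:~R - 1 :> R.
    by rewrite -rmorphB/= -[1]/(1%:~R) -rmorphB/= pmulrn; congr (_%:~R); move: j kj {jm mj}; clear; lia.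
  by have := ler_wpM2l (ltW t1') (ltW mj); lra.
rewrite -mulr_suml ler_wpM2r ?(ltW Q0)//.
apply: (@sum_geometric_int _ (fun k => absz (k - j - 1)%R) (fun k => ~~ (k <= j))) => //.
  exact: ltW (pow2_gt0 _).
by move=> x y; rewrite !unfold_in; move: j {jm mj} => j; clear; lia.
Qed.

End DyadicSums.

(** * Interpolation of linear maps between Calderon products of Orlicz spaces *)

Section Interpolation.
Context {R : realType}.
Implicit Types (G : R -> R) (f : int -> R[i]).

(** Pair each choice of signs with the one that flips every sign but the k-th. The half-sum of the
    two signed sums is [w k] up to sign, so convexity bounds its value by their mean. *)
Lemma signs_average G n (w : 'I_n -> R[i]) (l : R) (k : 'I_n) : young G -> 0 < l ->
  G (normc (w k) / l) <= (2 ^+ n)^-1 *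
    \sum_(s : {ffun 'I_n -> bool}) G (normc (\sum_i (-1) ^+ s i * w i) / l).
Proof.
move=> yG l0; pose g (s : {ffun 'I_n -> bool}) := \sum_i (-1) ^+ s i * w i.
pose flip (s : {ffun 'I_n -> bool}) := [ffun i => if i == k then s i else ~~ s i].
have flipI : injective flip.
  apply: (can_inj (g := flip)) => s; apply/ffunP => i; rewrite !ffunE.
  by case: (i == k); rewrite ?negbK.
have gE s : g s + g (flip s) = 2 * ((-1) ^+ s k * w k).
  rewrite /g -big_split/= (bigD1 k)//= big1 => [|i ik].
    by rewrite addr0 ffunE eqxx mulr_natl mulr2n.
  by rewrite ffunE (negPf ik); case: (s i); rewrite !(expr0, expr1, mul1r, mulN1r) ?subrr ?addNr.
have pt s : G (normc (w k) / l) <=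
    2^-1 * G (normc (g s) / l) + (1 - 2^-1) * G (normc (g (flip s)) / l).
  have nn z : 0 <= normc z / l by rewrite divr_ge0 ?normc_ge0 ?ltW.
  have h0 : 0 <= 2^-1 :> R by rewrite invr_ge0.
  have h1 : 2^-1 <= 1 :> R by rewrite invf_le1// ler1n.
  apply: (le_trans _ (young_convex yG h0 h1 (nn _) (nn _))).
  apply: (young_le yG) => //; rewrite mulrA mulrA -mulrDl ler_wpM2r ?invr_ge0 ?(ltW l0)//.
  have -> : 1 - 2^-1 = 2^-1 :> R by field.
  rewrite -mulrDr ler_pdivlMl//.
  have -> : 2 * normc (w k) = normc (g s + g (flip s)).
    rewrite gE !normcM normcX normcN ComplexField.Normc.normc1 expr1n mul1r.
    by rewrite -[2 in RHS](rmorph_nat (real_complex R)) normc_real ger0_norm.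
  exact: normcD.
have := ler_sum (index_enum {ffun 'I_n -> bool}) (P := xpredT) (fun s _ => pt s).
rewrite sumr_const card_ffun card_bool card_ord big_split/= -!mulr_sumr.
rewrite -(reindex_inj flipI (F := fun s => G (normc (g s) / l)) (P := xpredT))/=.
rewrite -mulrDl addrC subrK mul1r -[_ *+ _]mulr_natl natrX => h.
by rewrite ler_pdivlMl// exprn_gt0.
Qed.

Variables (F F1 F2 : R -> R) (th C0 : R).
Hypothesis yF : young F.
Hypothesis yF1 : young F1.
Hypothesis yF2 : young F2.
Hypothesis th_gt0 : 0 < th.
Hypothesis th_lt1 : th < 1.
Hypothesis C0_gt0 : 0 < C0.

(* F is equivalent to the Calderon product F1 ^ (1 - th) F2 ^ th in terms of
   the inverse functions. *)
Hypothesis factor : forall x, 0 < x -> exists y z,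
  [/\ 0 < y, 0 < z, x = y `^ (1 - th) * z `^ th, F1 y <= F x & F2 z <= F x].
Hypothesis product_le : forall y z, 0 <= y -> 0 <= z ->
  F (y `^ (1 - th) * z `^ th / C0) <= F1 y + F2 z.

Variable T : (int -> R[i]) -> (int -> R[i]).
Hypothesis T_lin : forall a f g, S0 f -> S0 g ->
  T (fun n => a * f n + g n) = (fun n => a * T f n + T g n).

Let T0 : T (fun=> 0) = fun=> 0.
Proof.
have S00 : S0 (fun _ : int => 0 : R[i]) by apply/S0P; exists [::].
have := T_lin (-1) S00 S00; under [X in T X]eq_fun do rewrite mulr0 addr0.
by move=> ->; apply/funext => n; rewrite mulN1r addNr.
Qed.

Let T_sum (I : Type) (s : seq I) (c : I -> R[i]) (u : I -> int -> R[i]) :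
    (forall i, S0 (u i)) ->
  S0 (fun j => \sum_(i <- s) c i * u i j) /\
  T (fun j => \sum_(i <- s) c i * u i j) = (fun j => \sum_(i <- s) c i * T (u i) j).
Proof.
move=> hu; elim: s => [|i s [hS hT]].
  under eq_fun do rewrite big_nil; under [X in _ = X]eq_fun do rewrite big_nil.
  by split; last exact: T0; apply/S0P; exists [::].
under eq_fun do rewrite big_cons; split; first exact: S0_lin.
by rewrite T_lin// hT; apply/funext => j; rewrite big_cons.
Qed.

(** For the factorisation x = y^(1 - th) z^th the level k is the integer part of log2 (z / y).
    Rounding costs a factor 2^th < 2 in the first estimate and nothing in the second. *)
Let decompose x : 0 <= x -> exists k : int, exists y z,
  [/\ 0 <= y, 0 <= z, F1 y <= F x, F2 z <= F x &
    pow2 (- (k%:~R * th)) * x <= 2 * y /\ pow2 (k%:~R * (1 - th)) * x <= z].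
Proof.
rewrite le_eqVlt => /predU1P[<-|x0].
  by exists 0, 0, 0; rewrite !mulr0 (young0 yF1) (young0 yF2) (young0 yF).
have [y [z [y0 z0 xE F1y F2z]]] := factor x0.
have [m mE] := pow2_log (divr_gt0 z0 y0).
have zE : z = y * pow2 m by rewrite -mE mulrC divfK// gt_eqF.
have xE' : x = y * pow2 (m * th).
  rewrite xE zE powRM ?(ltW y0) ?(ltW (pow2_gt0 _))// mulrA -powRD; last first.
    by rewrite (gt_eqF y0) implybT.
  by rewrite subrK powRr1 ?(ltW y0)// /pow2 -powRrM.
exists (Num.floor m), y, z; split; rewrite ?(ltW y0) ?(ltW z0)//.
have km := floor_le m; have mk : m < (Num.floor m)%:~R + 1.
  by have := floorD1_gt m; rewrite rmorphD.
move: (Num.floor m)%:~R km mk => k km mk; split.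
  rewrite xE' mulrCA [leRHS]mulrC ler_wpM2l ?(ltW y0)// -pow2D.
  rewrite -[2 in leRHS]/(2%:R) -(_ : pow2 1 = 2 :> R); last by rewrite [LHS]powRr1.
  apply: ler_pow2; have : (m - k) * th <= 1 * 1.
    by apply: ler_pM; rewrite ?subr_ge0 ?(ltW th_gt0) ?(ltW th_lt1)//; lra.
  lra.
rewrite xE' zE mulrCA ler_wpM2l ?(ltW y0)// -pow2D ler_pow2//.
have h : 0 <= 1 - th by rewrite subr_ge0 ltW.
by have := ler_wpM2l h km; lra.
Qed.

Variables (K1 K2 : R).
Hypothesis K1_gt0 : 0 < K1.
Hypothesis K2_gt0 : 0 < K2.
Hypothesis T1 : mult_le (F := F1) T K1.
Hypothesis T2 : mult_le (F := F2) T K2.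

(** Of the factor 8, a factor 4 comes from the scales [4 * K1] and [4 * K2], since 4^(1 - th) 4^th =
    4, and a factor 2 from averaging the two modulars. *)
Definition interp_const : R :=
  8%:R * C0 * dyadic_const th * (K1 `^ (1 - th) * K2 `^ th).

Let th1_gt0 : 0 < 1 - th. Proof. by rewrite subr_gt0. Qed.

Let dyadic_gt0 : 0 < dyadic_const th.
Proof.
by rewrite addr_gt0// invr_gt0 subr_gt0 pow2_lt1// oppr_lt0.
Qed.

Let interp_const_gt0 : 0 < interp_const.
Proof. by rewrite /interp_const !mulr_gt0// ?powR_gt0// ?dyadic_gt0. Qed.

(* The sum of the signed dyadic pieces is bounded in both spaces, uniformly in
   the signs; averaging over the signs bounds every single piece, in the manner
   of Gustavsson and Peetre. *)
Let interp_normalized (x : int -> R[i]) : S0 x ->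
  modular_le F (fun n => normc (x n)) 1 -> admissible F (T x) interp_const.
Proof.
move=> Sx hx.
have /choice[kk /choice[y /choice[z yz]]] : forall n, exists k : int, exists y z,
    [/\ 0 <= y, 0 <= z, F1 y <= F (normc (x n)), F2 z <= F (normc (x n)) &
    pow2 (- (k%:~R * th)) * normc (x n) <= 2 * y /\
    pow2 (k%:~R * (1 - th)) * normc (x n) <= z].
  by move=> n; apply: decompose; exact: normc_ge0.
have [s us xs] := (S0P x).1 Sx.
pose I := undup (map kk s); pose N := size I.
have uI : uniq I by exact: undup_uniq.
pose kI (i : 'I_N) : int := nth 0 I i.
(* The dyadic pieces: [u i] keeps the coordinates of [x] of level [kI i]. The pieces have disjoint
   supports and sum to [x]. *)
pose u (i : 'I_N) n := if kk n == kI i then x n else 0.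
have Su i : S0 (u i).
  apply/S0P; exists s => // n ns; rewrite /u xs//; by case: ifP.
have sumu (c : 'I_N -> R[i]) n : n \in s ->
    exists2 i, kI i = kk n & \sum_i c i * u i n = c i * x n.
  move=> ns; have kn : kk n \in I by rewrite mem_undup map_f.
  have iN : (index (kk n) I < N)%N by rewrite index_mem.
  exists (Ordinal iN); first by rewrite /kI nth_index.
  rewrite (bigD1 (Ordinal iN))//= big1 => [|i ik].
    by rewrite addr0 /u /kI /= nth_index// eqxx.
  rewrite /u ifF ?mulr0//; apply/negP => /eqP e; move/negP: ik; apply.
  by apply/eqP/val_inj => /=; rewrite e index_uniq.
have sumu0 (c : 'I_N -> R[i]) n : n \notin s -> \sum_i c i * u i n = 0.
  by move=> ns; rewrite big1// => i _; rewrite /u xs// if_same mulr0.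
(* Signed weighted sums have norm at most 2, so their images have norm at most 2K; the remaining
   factor 2 makes the inequality strict, as [lux_lt] demands. *)
pose l1 := 4%:R * K1; pose l2 := 4%:R * K2.
have l1_gt0 : 0 < l1 by rewrite mulr_gt0.
have l2_gt0 : 0 < l2 by rewrite mulr_gt0.
(* Run once for each endpoint space. [B n] is the mean over all signs of the modular density at n:
   its sum is at most 1 because every choice of signs is admissible, and it dominates each single
   piece by [signs_average]. *)
have key G (yG : young G) K (e : int -> R) (b : int -> R) (l := 4%:R * K) :
    0 < K -> mult_le (F := G) T K -> (forall k, 0 < e k) ->
    (forall n, 0 <= b n) -> (forall n, G (b n) <= F (normc (x n))) ->
    (forall n, e (kk n) * normc (x n) <= 2 * b n) ->
  exists B : int -> R, [/\ forall n, 0 <= B n,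
    forall t, uniq t -> \sum_(n <- t) B n <= 1 &
    forall n i, G (e (kI i) * normc (T (u i) n) / l) <= B n].
  move=> K0 hT e0 b0 hb he; have l0 : 0 < l by rewrite mulr_gt0.
  pose c (sg : {ffun 'I_N -> bool}) (i : 'I_N) : R[i] := (-1) ^+ sg i * (e (kI i))%:C.
  have nc sg i : normc (c sg i) = e (kI i).
    rewrite normcM normcX normcN ComplexField.Normc.normc1 expr1n mul1r.
    by rewrite normc_real gtr0_norm.
  have adm sg : admissible G (fun j => \sum_i c sg i * T (u i) j) l.
    have [Sv Tv] := T_sum (index_enum 'I_N) (c sg) Su; rewrite -Tv.
    have av : admissible G (fun j => \sum_i c sg i * u i j) 2.
      split => // t ut; apply: le_trans (hx t ut); apply: ler_sum => n _.
      apply: (le_trans _ (hb n)); apply: (young_le yG).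
        by rewrite divr_ge0 ?normc_ge0.
      rewrite ler_pdivrMr// mulrC.
      have [/(sumu (c sg))[i ki ->]|/(sumu0 (c sg)) ->] := boolP (n \in s).
        by rewrite normcM nc ki.
      by rewrite ComplexField.Normc.normc0 mulr_ge0.
    have [hi hn] := hT _ Sv; apply: (lux_lt yG) => //.
    apply: (le_lt_trans hn); rewrite /l mulrC ltr_pM2r//.
    by apply: (le_lt_trans (lux_le av)); rewrite ltr_nat.
  exists (fun n => (2 ^+ N)^-1 * \sum_(sg : {ffun 'I_N -> bool})
     G (normc (\sum_i c sg i * T (u i) n) / l)); split.
  - move=> n; rewrite mulr_ge0 ?invr_ge0 ?exprn_ge0// sumr_ge0// => sg _.
    by apply: (young_ge0 yG); rewrite divr_ge0 ?normc_ge0 ?ltW.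
  - move=> t ut; rewrite -mulr_sumr exchange_big/= ler_pdivrMl ?exprn_gt0// mulr1.
    apply: (@le_trans _ _ (\sum_(sg : {ffun 'I_N -> bool}) 1)).
      by apply: ler_sum => sg _; exact: (adm sg).2.
    by rewrite sumr_const card_ffun card_bool card_ord -natrX.
  - move=> n i; have := signs_average (fun i => (e (kI i))%:C * T (u i) n) i yG l0.
    rewrite normcM normc_real gtr0_norm// => /le_trans; apply.
    rewrite ler_wpM2l ?invr_ge0 ?exprn_ge0//; apply: ler_sum => sg _.
    by rewrite le_eqVlt; apply/orP; left; apply/eqP; congr (G (normc _ / l)); apply: eq_bigr => j _; rewrite mulrA.
have y_ge0 n : 0 <= y n by have [] := yz n.
have z_ge0 n : 0 <= z n by have [] := yz n.
have F1y n : F1 (y n) <= F (normc (x n)) by have [] := yz n.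
have F2z n : F2 (z n) <= F (normc (x n)) by have [] := yz n.
have ey n : pow2 (- ((kk n)%:~R * th)) * normc (x n) <= 2 * y n.
  by have [_ _ _ _ []] := yz n.
have ez n : pow2 ((kk n)%:~R * (1 - th)) * normc (x n) <= 2 * z n.
  by have [_ _ _ _ [_ h]] := yz n; apply: (le_trans h); have := z_ge0 n; lra.
have [B1 [B1_ge0 B1_sum B1_le]] := key F1 yF1 K1
  (fun k => pow2 (- (k%:~R * th))) y K1_gt0 T1 (fun k => pow2_gt0 _) y_ge0 F1y ey.
have [B2 [B2_ge0 B2_sum B2_le]] := key F2 yF2 K2
  (fun k => pow2 (k%:~R * (1 - th))) z K2_gt0 T2 (fun k => pow2_gt0 _) z_ge0 F2z ez.
split=> // t ut.
apply: (@le_trans _ _ (\sum_(n <- t) 2^-1 * (B1 n + B2 n))); last first.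
  rewrite -mulr_sumr big_split/= ler_pdivrMl// mulr1.
  by rewrite (_ : 2 = 1 + 1 :> R)// lerD ?B1_sum ?B2_sum.
apply: ler_sum => n _.
(* Maxima, not sums, over the pieces: each entry satisfies the bound by [B1 n], hence so does the
   largest, and [dyadic_sum] needs no more than a uniform bound. *)
pose a := \big[Order.max/0]_(i < N) (pow2 (- ((kI i)%:~R * th)) * normc (T (u i) n) / l1).
pose b := \big[Order.max/0]_(i < N) (pow2 ((kI i)%:~R * (1 - th)) * normc (T (u i) n) / l2).
have nonneg e l (i : 'I_N) : 0 < l -> 0 <= pow2 e * normc (T (u i) n) / l.
  by move=> l0; rewrite divr_ge0 ?(ltW l0)// mulr_ge0 ?normc_ge0// ltW// pow2_gt0.
have [a0 aB] : 0 <= a /\ F1 a <= B1 n.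
  apply: (big_ind (fun q => 0 <= q /\ F1 q <= B1 n)).
  - by rewrite (young0 yF1).
  - by move=> p q [? ?] [? ?]; rewrite /Order.max; case: ifP.
  - by move=> i _; split; [exact: nonneg|exact: B1_le].
have [b0 bB] : 0 <= b /\ F2 b <= B2 n.
  apply: (big_ind (fun q => 0 <= q /\ F2 q <= B2 n)).
  - by rewrite (young0 yF2).
  - by move=> p q [? ?] [? ?]; rewrite /Order.max; case: ifP.
  - by move=> i _; split; [exact: nonneg|exact: B2_le].
have Tx : T x n = \sum_i 1 * T (u i) n.
  have [_ /(congr1 (fun f => f n)) <-] := T_sum (index_enum 'I_N) (fun=> 1) Su.
  congr (T _ n); apply/funext => j.
  have [/(sumu (fun=> 1))[i _ ->]|js] := boolP (j \in s); first by rewrite mul1r.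
  by rewrite sumu0// xs.
have Tx_le : normc (T x n) <= dyadic_const th * ((l1 * a) `^ (1 - th) * (l2 * b) `^ th).
  (* The pieces reindexed by their level k, with value 0 off [I], to match the form of
     [dyadic_sum]. *)
  pose G k := if (insub (index k I) : option 'I_N) is Some i then normc (T (u i) n) else 0.
  have GE (i : 'I_N) : G (kI i) = normc (T (u i) n).
    rewrite /G /kI index_uniq//.
    by case: insubP => [j _ ji|]; [congr (normc (T (u _) n)); exact: val_inj|rewrite ltn_ord].
  apply: (@le_trans _ _ (\sum_(k <- I) G k)).
    rewrite Tx (big_nth 0) big_mkord; apply: (le_trans (normc_sum _ _)).
    by apply: ler_sum => i _; rewrite mul1r GE.
  have la0 : 0 <= l1 * a := mulr_ge0 (ltW l1_gt0) a0.
  have lb0 : 0 <= l2 * b := mulr_ge0 (ltW l2_gt0) b0.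
  apply: dyadic_sum => //.
    move=> k; rewrite /G; case: insubP => [i _ iE|_]; last first.
      exact: mulr_ge0 (ltW (pow2_gt0 _)) la0.
    have kE : index k I = i by [].
    have -> : k = kI i by rewrite /kI -kE nth_index// -index_mem kE ltn_ord.
    have : pow2 (- ((kI i)%:~R * th)) * normc (T (u i) n) / l1 <= a.
      exact: (le_bigmax_cond _ (fun i => pow2 (- ((kI i)%:~R * th)) * normc (T (u i) n) / l1)).
    rewrite ler_pdivrMr// mulrC [a * _]mulrC => h.
    rewrite -ler_pdivrMl ?pow2_gt0//.
    by rewrite /pow2 -powRN mulrC.
  move=> k; rewrite /G; case: insubP => [i _ iE|_]; last first.
    exact: mulr_ge0 (ltW (pow2_gt0 _)) lb0.
  have kE : index k I = i by [].
  have -> : k = kI i by rewrite /kI -kE nth_index// -index_mem kE ltn_ord.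
  have : pow2 ((kI i)%:~R * (1 - th)) * normc (T (u i) n) / l2 <= b.
    exact: (le_bigmax_cond _ (fun i => pow2 ((kI i)%:~R * (1 - th)) * normc (T (u i) n) / l2)).
  rewrite ler_pdivrMr// [b * _]mulrC => h.
  by rewrite /pow2 powRN ler_pdivlMl ?powR_gt0.
have MT : normc (T x n) / interp_const <= 2^-1 * (a `^ (1 - th) * b `^ th / C0).
  rewrite ler_pdivrMr//; apply: (le_trans Tx_le).
  rewrite !powRM ?(ltW K1_gt0) ?(ltW K2_gt0) ?(ltW l1_gt0) ?(ltW l2_gt0)//.
  have e4 : 4%:R `^ (1 - th) * 4%:R `^ th = 4%:R :> R.
    by rewrite -powRD ?subrK ?powRr1// pnatr_eq0 implybT.
  rewrite le_eqVlt; apply/orP; left; apply/eqP; rewrite /interp_const.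
  move: e4; set p := 4%:R `^ (1 - th); set q := 4%:R `^ th => e4.
  set k1 := K1 `^ _; set k2 := K2 `^ _; set aa := a `^ _; set bb := b `^ _.
  set dd := dyadic_const th.
  have -> : dd * (p * k1 * aa * (q * k2 * bb)) = p * q * (dd * k1 * k2 * aa * bb) by ring.
  by rewrite e4; field; rewrite gt_eqF.
have h1 : 0 <= a `^ (1 - th) * b `^ th / C0.
  by rewrite divr_ge0 ?(ltW C0_gt0)// mulr_ge0// powR_ge0.
apply: (@le_trans _ _ (F (2^-1 * (a `^ (1 - th) * b `^ th / C0)))).
  by apply: (young_le yF) => //; rewrite divr_ge0 ?normc_ge0// ltW.
apply: (@le_trans _ _ (2^-1 * F (a `^ (1 - th) * b `^ th / C0))).
  by apply: (young_scale yF) => //; rewrite ?invr_ge0// invf_le1// ler1n.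
rewrite ler_wpM2l ?invr_ge0//; apply: (le_trans (product_le a0 b0)).
exact: lerD.
Qed.

Theorem interpolation : mult_le (F := F) T interp_const.
Proof.
have adm f l : S0 f -> admissible F f l -> admissible F (T f) (interp_const * l).
  move=> Sf [l0 hl].
  have S00 : S0 (fun _ : int => 0 : R[i]) by apply/S0P; exists [::].
  have lC : l%:C != 0 by rewrite -normc_eq0 normc_real normr_eq0 gt_eqF.
  pose x n := (l^-1)%:C * f n + 0.
  have Sx : S0 x by exact: (S0_lin (l^-1)%:C Sf S00).
  have nx n : normc (x n) = normc (f n) / l.
    by rewrite /x addr0 normcM normc_real ger0_norm ?invr_ge0 ?(ltW l0)// mulrC.
  have [|_ h] := interp_normalized Sx; first by move=> s us; under eq_bigr do rewrite nx; exact: hl.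
  split; first by rewrite mulr_gt0.
  move=> s us; apply: le_trans (h s us); apply: ler_sum => n _.
  have -> : T x = fun n => (l^-1)%:C * T f n + 0 by rewrite /x T_lin// T0.
  rewrite addr0 normcM normc_real ger0_norm ?invr_ge0 ?(ltW l0)//.
  by rewrite invfM mulrA mulrAC [l^-1 * _]mulrC.
move=> f Sf; have fi := inL_S0 yF Sf; split.
  by have [l hl] := fi; exists (interp_const * l); exact: adm.
apply: le_of_le_add_eps => e e0.
have -> : interp_const * lux F f + e = interp_const * (lux F f + e / interp_const).
  by field; rewrite gt_eqF.
by apply/lux_le/adm => //; apply: (lux_lt yF) => //; rewrite ltrDl divr_gt0.
Qed.

End Interpolation.

(** * Indices and the functions Phi_theta *)

Section HalfInverse.
Context {R : realType}.
Variable F : R -> R.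
Hypothesis F_inj : forall x y, 0 <= x -> 0 <= y -> F x = F y -> x = y.
Hypothesis F_surj : forall y, 0 <= y -> exists2 x, 0 <= x & F x = y.

Let F_injs : {in (`[0, +oo[%classic : set R) &, injective F}.
Proof.
move=> x y; rewrite !inE/= !in_itv/= !andbT => x0 y0; exact: F_inj.
Qed.

Lemma half_inverseK y : 0 <= y -> 0 <= half_inverse F y /\ F (half_inverse F y) = y.
Proof.
move=> /F_surj[x x0 <-]; rewrite /half_inverse pinvKV//.
by rewrite inE/= in_itv/= x0.
Qed.

Lemma half_inverse_of x : 0 <= x -> half_inverse F (F x) = x.
Proof. by move=> x0; rewrite /half_inverse pinvKV// inE/= in_itv/= x0. Qed.

End HalfInverse.

Section ConvexHalf.
Context {R : realType}.
Implicit Types (F : R -> R) (l x y : R).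

Lemma convex_half_le F l x y : convex_function (`[0, +oo[%classic : set R) F ->
  0 <= l -> l <= 1 -> 0 <= x -> 0 <= y ->
  F (l * x + (1 - l) * y) <= l * F x + (1 - l) * F y.
Proof.
move=> cF l0 l1 x0 y0; have := cF (Itv01 l0 l1) x y.
by rewrite !inE/= !in_itv/= x0 y0 !convRE/= => /(_ isT isT).
Qed.

Lemma concave_half_ge F l x y : concave_half F ->
  0 <= l -> l <= 1 -> 0 <= x -> 0 <= y ->
  l * F x + (1 - l) * F y <= F (l * x + (1 - l) * y).
Proof.
move=> cF l0 l1 x0 y0; have := convex_half_le cF l0 l1 x0 y0.
by rewrite !mulrN -opprD lerN2.
Qed.

Lemma concave_halfP F : (forall l x y, 0 <= l -> l <= 1 -> 0 <= x -> 0 <= y ->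
    l * F x + (1 - l) * F y <= F (l * x + (1 - l) * y)) -> concave_half F.
Proof.
move=> h t x y; rewrite !inE/= !in_itv/= !andbT => x0 y0.
by rewrite !convRE !mulrN -opprD lerN2; apply: h.
Qed.

End ConvexHalf.

(** * From one dilation inequality to power growth at all dilations *)

Section PowerBounds.
Context {R : realType}.
Implicit Types (F : R -> R) (s t u p q : R).

Lemma geometric_bracket (b s : R) : 1 < b -> 1 <= s ->
  exists n, b ^+ n <= s /\ s < b ^+ n.+1.
Proof.
move=> b1 s1; have b0 : 0 < b by exact: lt_trans b1.
have ex : exists n, s < b ^+ n.
  have d0 : 0 < b - 1 by rewrite subr_gt0.
  exists (Num.bound (s / (b - 1))).
  have : s / (b - 1) < (Num.bound (s / (b - 1)))%:R.
    by apply: archi_boundP; rewrite divr_ge0 ?(ltW d0)// (le_trans _ s1).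
  rewrite ltr_pdivrMr//; move: (Num.bound _) => n h; apply: (lt_le_trans h).
  elim: n {h} => [|n IH]; first by rewrite mul0r expr0.
  have bn : 1 <= b ^+ n by rewrite exprn_ege1// ltW.
  have h : b - 1 <= (b - 1) * b ^+ n by rewrite ler_peMr// ltW.
  by rewrite -natr1 exprS; move: IH h; set x := n%:R; set y := b ^+ n; lra.
case: (ex_minnP ex) => -[|n]; first by rewrite expr0 ltNge s1.
move=> hn min; exists n; split => //; rewrite leNgt; apply/negP => /min.
by rewrite ltnn.
Qed.

(** Iterate along powers of t: if t^n <= s < t^(n + 1), then n + 1 steps suffice, and the rounding
    accounts for the extra factor [t ^ q]. *)
Lemma power_upper F t q : young F -> 1 < t -> 0 < q ->
    (forall u, 0 < u -> F (t * u) <= t `^ q * F u) ->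
  forall s u, 1 <= s -> 0 < u -> F (s * u) <= t `^ q * (s `^ q * F u).
Proof.
move=> yF t1 q0 h s u s1 u0; have t0 : 0 < t by exact: lt_trans t1.
have s0 : 0 < s by exact: lt_le_trans s1.
have [n [ns sn]] := geometric_bracket t1 s1.
have iter m : F (t ^+ m * u) <= (t `^ q) ^+ m * F u.
  elim: m => [|m IH]; first by rewrite !expr0 !mul1r.
  rewrite exprS -mulrA (le_trans (h _ _))//; first by rewrite mulr_gt0// exprn_gt0.
  by rewrite exprS -mulrA ler_wpM2l ?powR_ge0.
apply: (le_trans _ (le_trans (iter n.+1) _)).
  by apply: (young_le yF); rewrite ?mulr_ge0 ?(ltW s0) ?(ltW u0)// ler_wpM2r ?(ltW u0)// ltW.
rewrite exprS -mulrA ler_wpM2l ?powR_ge0// ler_wpM2r//.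
  by apply: (young_ge0 yF); exact: ltW.
rewrite -powR_mulrn ?powR_ge0// powRAC powR_mulrn ?(ltW t0)//.
by apply: ge0_ler_powR; rewrite ?nnegrE ?exprn_ge0 ?(ltW q0) ?(ltW t0) ?(ltW s0).
Qed.

Lemma power_lower F t p : young F -> 0 < t -> t < 1 -> 0 < p ->
    (forall u, 0 < u -> F (t * u) <= t `^ p * F u) ->
  forall s u, 0 < s -> s <= 1 -> 0 < u -> F (s * u) <= (t `^ p)^-1 * (s `^ p * F u).
Proof.
move=> yF t0 t1 p0 h s u s0 s1 u0.
have b1 : 1 < t^-1 by rewrite invf_gt1.
have [|n [ns sn]] := geometric_bracket b1 (s := s^-1); first by rewrite invf_ge1.
have {}ns : s <= t ^+ n by rewrite -lef_pV2 ?posrE ?exprn_gt0// -exprVn.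
have {}sn : t ^+ n.+1 < s by rewrite -ltf_pV2 ?posrE ?exprn_gt0// -exprVn.
have iter m : F (t ^+ m * u) <= (t `^ p) ^+ m * F u.
  elim: m => [|m IH]; first by rewrite !expr0 !mul1r.
  rewrite exprS -mulrA (le_trans (h _ _))//; first by rewrite mulr_gt0// exprn_gt0.
  by rewrite exprS -mulrA ler_wpM2l ?powR_ge0.
apply: (le_trans _ (le_trans (iter n) _)).
  by apply: (young_le yF); rewrite ?mulr_ge0 ?(ltW s0) ?(ltW u0)// ler_wpM2r ?(ltW u0).
rewrite mulrA ler_wpM2r//; first by apply: (young_ge0 yF); exact: ltW.
rewrite ler_pdivlMl ?powR_gt0// -exprS.
rewrite -powR_mulrn ?powR_ge0// powRAC powR_mulrn ?(ltW t0)//.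
by apply: ge0_ler_powR; rewrite ?nnegrE ?exprn_ge0 ?(ltW p0) ?(ltW t0) ?(ltW s0)// ltW.
Qed.

End PowerBounds.

Section NFunctionFacts.
Context {R : realType}.
Variable Phi : R -> R.
Hypothesis hPhi : N_function Phi.

Lemma N_function_young : young Phi.
Proof.
have h0 : Phi 0 = 0 by apply/(N_eq0 hPhi).
have hlt s t : 0 <= s -> s < t -> Phi s < Phi t.
  move=> s0 st; apply: (N_increasing hPhi) => //; rewrite in_itv/= andbT//.
  by rewrite (le_trans s0)// ltW.
split => //.
- by move=> t t0; rewrite -h0 hlt.
- by move=> s t s0; rewrite le_eqVlt => /predU1P[->//|st]; rewrite ltW// hlt.
- by move=> l x y *; apply: convex_half_le => //; exact: N_convex.
Qed.

Let yF := N_function_young.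

Lemma N_function_lt s t : 0 <= s -> s < t -> Phi s < Phi t.
Proof.
move=> s0 st; apply: (N_increasing hPhi) => //; rewrite in_itv/= andbT//.
by rewrite (le_trans s0)// ltW.
Qed.

Lemma N_function_inj x y : 0 <= x -> 0 <= y -> Phi x = Phi y -> x = y.
Proof.
move=> x0 y0 e; apply/eqP; case: (ltgtP x y) => // h.
  by have := N_function_lt x0 h; rewrite e ltxx.
by have := N_function_lt y0 h; rewrite e ltxx.
Qed.

Lemma N_function_surj y : 0 <= y -> exists2 x, 0 <= x & Phi x = y.
Proof.
move=> y0; have P1 := young_gt0 yF ltr01.
(* Convexity gives [Phi b >= b * Phi 1], which exceeds y; the intermediate value theorem on [0, b]
   does the rest. *)
pose b := 1 + y / Phi 1.
have b1 : 1 <= b by rewrite lerDl divr_ge0// ltW.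
have b0 : 0 < b by exact: lt_le_trans b1.
have hb : y <= Phi b.
  have : Phi 1 <= b^-1 * Phi b.
    rewrite -[X in Phi X](mulVf (lt0r_neq0 b0)); apply: (young_scale yF).
    - by rewrite invr_ge0 ltW.
    - by rewrite invf_le1.
    - exact: ltW.
  rewrite ler_pdivlMl// => h; apply: le_trans h.
  by rewrite /b mulrDl mul1r divfK ?gt_eqF// lerDr ltW.
have cont : {within `[0, b], continuous Phi}.
  apply: continuous_subspaceW (N_continuous hPhi) => x /=.
  by rewrite !in_itv/= => /andP[-> _].
have [|c] := IVT (ltW b0) cont (v := y).
  by rewrite (young0 yF) ge_min y0 le_max hb orbT.
by rewrite in_itv/= => /andP[c0 _]; exists c.
Qed.

Lemma half_inverse_Phi y : 0 <= y ->
  0 <= half_inverse Phi y /\ Phi (half_inverse Phi y) = y.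
Proof. by apply: half_inverseK; [exact: N_function_inj|exact: N_function_surj]. Qed.

Lemma half_inverse_PhiK x : 0 <= x -> half_inverse Phi (Phi x) = x.
Proof. by apply: half_inverse_of; exact: N_function_inj. Qed.

Lemma MO_fun_power t q : 0 < t -> t != 1 ->
    (forall r : R, 0 < r -> MO_fun Phi t = r%:E -> ln r < q * ln t) -> MO_fun Phi t != +oo%E ->
  forall u, 0 < u -> Phi (t * u) <= t `^ q * Phi u.
Proof.
move=> t0 t1 hr fin u u0.
have Pu := young_gt0 yF u0.
have mem : ((Phi (t * u) / Phi u)%:E <= MO_fun Phi t)%E.
  by apply: ereal_sup_ubound; exists u => //=; rewrite in_itv/= u0.
have X0 : (0 < MO_fun Phi t)%E.
  apply: lt_le_trans mem; rewrite lte_fin divr_gt0//.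
  by apply: (young_gt0 yF); exact: mulr_gt0.
move: hr fin mem X0; case: (MO_fun Phi t) => [r| |]// hr _.
rewrite lee_fin lte_fin => h r0; rewrite -ler_pdivrMr//; apply: (le_trans h).
by rewrite -ler_ln ?posrE ?powR_gt0// ln_powR ltW// hr.
Qed.

(** The infimum defining the index provides a single dilation t with M(t) < t^q; [power_upper] then
    spreads the bound to all dilations. *)
Lemma beta_power q : (beta_index Phi < q%:E)%E ->
  exists2 t, 1 < t & forall u, 0 < u -> Phi (t * u) <= t `^ q * Phi u.
Proof.
move=> /ereal_inf_lt[y [t /=]]; rewrite in_itv/= andbT => t1 <- h.
have lt0 : 0 < ln t by rewrite ln_gt0.
exists t => // u u0; apply: MO_fun_power => //.
- exact: lt_trans t1.
- by rewrite gt_eqF.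
- move=> r r0 rE; move: h; rewrite rE inver gt_eqF//.
  by rewrite lne_EFin// -EFinM lte_fin ltr_pdivrMr.
- apply/eqP => e; move: h; rewrite e /= inver gt_eqF//.
  by rewrite gt0_mulye ?lte_fin ?invr_gt0.
Qed.

Lemma alpha_power p : (p%:E < alpha_index Phi)%E ->
  exists t, [/\ 0 < t, t < 1 & forall u, 0 < u -> Phi (t * u) <= t `^ p * Phi u].
Proof.
move=> /ereal_sup_gt[y [t /=]]; rewrite in_itv/= => /andP[t0 t1] <- h.
have lt0 : ln t < 0 by rewrite ln_lt0// t0.
exists t; split => // u u0; apply: MO_fun_power => //.
- by rewrite lt_eqF.
- move=> r r0 rE; move: h; rewrite rE inver lt_eqF//.
  by rewrite lne_EFin// -EFinM lte_fin ltr_ndivlMr.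
- apply/eqP => e; move: h; rewrite e /= inver lt_eqF//.
  by rewrite lt0_mulye ?lte_fin ?invr_lt0.
Qed.

End NFunctionFacts.

(** * The least concave majorant of a quasi-concave function and its inverse *)

Section LeastConcaveMajorant.
Context {R : realType}.
Variables (Psi : R -> R) (K : R).
Hypothesis Psi0 : Psi 0 = 0.
Hypothesis Psi_gt0 : forall t, 0 < t -> 0 < Psi t.
Hypothesis K_gt0 : 0 < K.
Hypothesis quasi_concave : forall t r, 0 < t -> 0 < r -> Psi r <= K * (1 + r / t) * Psi t.
Hypothesis Psi_small : forall e, 0 < e -> exists2 t, 0 < t & Psi t <= e.
Hypothesis Psi_large : forall M, exists2 t, 0 < t & M <= Psi t.

Local Notation L := (least_concave_majorant Psi).

(** Quasi-concavity says that this affine function of r dominates [Psi]. It is reset to 0 at the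
    origin because admissible majorants vanish there; lowering the endpoint value preserves
    concavity. *)
Let affine t r := if r == 0 then 0 else K * (1 + r / t) * Psi t.

Let affine_le t r : 0 < t -> 0 <= r -> affine t r <= K * (1 + r / t) * Psi t.
Proof.
move=> t0 r0; rewrite /affine; case: eqP => // _.
by rewrite !mulr_ge0 ?addr_ge0 ?divr_ge0 ?(ltW t0) ?(ltW K_gt0) ?(ltW (Psi_gt0 t0)).
Qed.

Let affine_majorant t : 0 < t -> concave_majorants Psi (affine t).
Proof.
move=> t0; have Pt := Psi_gt0 t0.
have pos r : 0 < r -> 0 < K * (1 + r / t) * Psi t.
  by move=> r0; rewrite !mulr_gt0// ltr_wpDr// ltW// divr_gt0.
split.
- apply: concave_halfP => l x y l0 l1 x0 y0.
  have l1' : 0 <= 1 - l by rewrite subr_ge0.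
  rewrite [leRHS]/affine; case: eqP => [e|_].
    have : l * x == 0 /\ (1 - l) * y == 0.
      move/eqP: e; rewrite paddr_eq0 ?mulr_ge0//; exact: andP.
    have z a b : a * b == 0 -> a * affine t b = 0.
      rewrite mulf_eq0 => /orP[/eqP ->|/eqP ->]; first by rewrite mul0r.
      by rewrite /affine eqxx mulr0.
    by move=> [/z -> /z ->]; rewrite addr0.
  apply: (le_trans (lerD (ler_wpM2l l0 (affine_le t0 x0)) (ler_wpM2l l1' (affine_le t0 y0)))).
  by rewrite le_eqVlt; apply/orP; left; apply/eqP; field; rewrite gt_eqF.
- move=> r; rewrite le_eqVlt /affine => /predU1P[<-|r0]; first by rewrite eqxx.
  by rewrite gt_eqF// ltW// pos.
- move=> r; rewrite le_eqVlt /affine => /predU1P[<-|r0]; first by rewrite eqxx.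
  by rewrite gt_eqF//; split=> [e|e]; [have := pos _ r0; rewrite e ltxx|rewrite e ltxx in r0].
- move=> r; rewrite le_eqVlt /affine => /predU1P[<-|r0]; first by rewrite eqxx Psi0.
  by rewrite gt_eqF// quasi_concave.
Qed.

Let vals t : set R := [set G t | G in concave_majorants Psi].

Let vals_neq0 t : vals t !=set0.
Proof. by exists (affine 1 t), (affine 1) => //; exact: affine_majorant. Qed.

Let L_ge t M : (forall G, concave_majorants Psi G -> M <= G t) -> M <= L t.
Proof. by move=> h; apply: (lb_le_inf (vals_neq0 t)) => _ [G hG <-]; exact: h. Qed.

Let L_le t G : 0 <= t -> concave_majorants Psi G -> L t <= G t.
Proof.
move=> t0 hG; apply: ge_inf; last by exists G.
by exists 0 => _ [H [_ H0 _ _] <-]; exact: H0.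
Qed.

Lemma lcm_ge t : 0 <= t -> Psi t <= L t.
Proof. by move=> t0; apply: L_ge => G [_ _ _]; exact. Qed.

(** The affine majorant attached to t takes the value [2 * K * Psi t] at t itself, so the majorant
    is equivalent to [Psi]. *)
Lemma lcm_le t : 0 < t -> L t <= 2 * K * Psi t.
Proof.
move=> t0; apply: (le_trans (L_le (ltW t0) (affine_majorant t0))).
rewrite /affine gt_eqF// divff ?gt_eqF// le_eqVlt; apply/orP; left; apply/eqP; ring.
Qed.

Lemma lcm0 : L 0 = 0.
Proof.
apply/eqP; rewrite eq_le; apply/andP; split; last by rewrite -{1}Psi0 lcm_ge.
by apply: (le_trans (L_le (lexx 0) (affine_majorant ltr01))); rewrite /affine eqxx.
Qed.

Lemma lcm_ge0 t : 0 <= t -> 0 <= L t.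
Proof. by move=> t0; apply: L_ge => G [_ G0 _ _]; exact: G0. Qed.

Lemma lcm_concave l x y : 0 <= l -> l <= 1 -> 0 <= x -> 0 <= y ->
  l * L x + (1 - l) * L y <= L (l * x + (1 - l) * y).
Proof.
move=> l0 l1 x0 y0; apply: L_ge => G hG; have [cG _ _ _] := hG.
apply: le_trans (concave_half_ge cG l0 l1 x0 y0).
by rewrite lerD// ler_wpM2l ?subr_ge0// L_le.
Qed.

(** If a concave function fails to increase once, it stays bounded from there on. Together with
    quasi-concavity below t this would bound [Psi], which takes arbitrarily large values. *)
Lemma lcm_lt s t : 0 <= s -> s < t -> L s < L t.
Proof.
move=> s0 st; rewrite ltNge; apply/negP => Lts.
have t0 : 0 < t by exact: le_lt_trans st.
have bounded T : t < T -> L T <= L t.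
  move=> tT; have sT : 0 < T - s by rewrite subr_gt0 (lt_trans st).
  pose l := (T - t) / (T - s).
  have l0 : 0 <= l by apply: divr_ge0 (ltW sT); rewrite subr_ge0 ltW.
  have l1 : l < 1 by rewrite ltr_pdivrMr// mul1r ltrD2l ltrN2.
  have T0 : 0 <= T by rewrite ltW// (lt_trans t0).
  have := lcm_concave l0 (ltW l1) s0 T0.
  have -> : l * s + (1 - l) * T = t by rewrite /l; field; rewrite gt_eqF.
  move=> h; have h' := ler_wpM2l l0 Lts.
  have : (1 - l) * L T <= (1 - l) * L t by lra.
  by rewrite ler_pM2l// subr_gt0.
have [T T0 hT] := Psi_large (L t + K * (1 + 1) * Psi t + 1).
have h2 : 0 <= K * (1 + 1) * Psi t.
  by rewrite !mulr_ge0 ?addr_ge0 ?(ltW K_gt0) ?(ltW (Psi_gt0 t0)).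
have [tT|Tt] := ltP t T.
  by have := bounded _ tT; have := lcm_ge (ltW T0); lra.
have := quasi_concave t0 T0.
have : K * (1 + T / t) * Psi t <= K * (1 + 1) * Psi t.
  rewrite ler_wpM2r ?(ltW (Psi_gt0 t0))// ler_wpM2l ?(ltW K_gt0)// lerD2l.
  by rewrite ler_pdivrMr ?mul1r.
have := lcm_ge0 (ltW t0); lra.
Qed.

Lemma lcm_le_mono s t : 0 <= s -> s <= t -> L s <= L t.
Proof. by move=> s0; rewrite le_eqVlt => /predU1P[->//|st]; rewrite ltW// lcm_lt. Qed.

Lemma lcm_inj x y : 0 <= x -> 0 <= y -> L x = L y -> x = y.
Proof.
move=> x0 y0 e; apply/eqP; case: (ltgtP x y) => // h.
  by have := lcm_lt x0 h; rewrite e ltxx.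
by have := lcm_lt y0 h; rewrite e ltxx.
Qed.

Let lcm_scale l t : 0 <= l -> l <= 1 -> 0 <= t -> l * L t <= L (l * t).
Proof.
move=> l0 l1 t0; have := lcm_concave l0 l1 t0 (lexx 0).
by rewrite lcm0 !mulr0 !addr0.
Qed.

(** The solution is the supremum of the sublevel set. Continuity is replaced by
    [l * L t <= L (l * t)], a consequence of concavity and [L 0 = 0], which compares nearby values
    from both sides; the dilation used is y / (y + e). *)
Lemma lcm_surj y : 0 <= y -> exists2 x, 0 <= x & L x = y.
Proof.
rewrite le_eqVlt => /predU1P[<-|y0]; first by exists 0; rewrite ?lcm0.
pose A : set R := [set s | 0 <= s /\ L s <= y].
have [T T0 hT] := Psi_large (y + 1).
have A_ub s : A s -> s <= T.
  move=> [s0 sy]; rewrite leNgt; apply/negP => /(lcm_lt (ltW T0)) h.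
  by have := lcm_ge (ltW T0); lra.
have [t1 t10 ht1] := Psi_small (divr_gt0 y0 (mulr_gt0 (ltr0n R 2) K_gt0)).
have At1 : A t1.
  split; first exact: ltW.
  apply: (le_trans (lcm_le t10)); rewrite mulrC -ler_pdivlMr// mulr_gt0//.
have hsup : has_sup A by split; [exists t1|exists T => s /A_ub].
pose t := sup A; have t1t : t1 <= t by apply: sup_upper_bound.
have t0 : 0 < t by exact: lt_le_trans t1t.
exists t; first exact: ltW.
apply/eqP; rewrite eq_le; apply/andP; split; apply: le_of_le_add_eps => e e0.
  have d0 : 0 < t * (e / (y + e)) by rewrite mulr_gt0// divr_gt0// addr_gt0.
  have [s [s0 sy] ts] := sup_adherent d0 hsup.
  rewrite -/t in ts.
  have ye : 0 < y + e by rewrite addr_gt0.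
  have st : s <= t by apply: sup_upper_bound.
  pose l := s / t.
  have l0 : 0 <= l by rewrite divr_ge0// ltW.
  have l1 : l <= 1 by rewrite ler_pdivrMr// mul1r.
  have := lcm_scale l0 l1 (ltW t0); rewrite /l divfK ?gt_eqF// => h.
  have hl : y / (y + e) <= l.
    rewrite /l ler_pdivlMr//.
    have -> : y / (y + e) * t = t - t * (e / (y + e)) by field; rewrite gt_eqF.
    exact: ltW.
  have : y / (y + e) * L t <= y.
    apply: le_trans sy; apply: le_trans h.
    by rewrite ler_wpM2r// lcm_ge0// ltW.
  rewrite mulrAC ler_pdivrMr// [y * L t]mulrC.
  by rewrite [y * _]mulrC ler_pM2r.
have te0 : 0 < y + e by rewrite addr_gt0.
pose s := t * ((y + e) / y).
have s0 : 0 < s by rewrite mulr_gt0// divr_gt0.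
have ts : t < s.
  by rewrite /s ltr_pMr// ltr_pdivlMr// mul1r ltrDl.
have ys : y < L s.
  rewrite ltNge; apply/negP => h; have As : A s by split => //; exact: ltW.
  have : s <= t by apply: sup_upper_bound.
  by rewrite leNgt ts.
have l0 : 0 <= y / (y + e) by rewrite divr_ge0 ?ltW.
have l1 : y / (y + e) <= 1 by rewrite ler_pdivrMr// mul1r lerDl ltW.
have := lcm_scale l0 l1 (ltW s0).
have -> : y / (y + e) * s = t by rewrite /s; field; rewrite !gt_eqF.
move=> h; have : y / (y + e) * y <= L t.
  by apply: le_trans h; rewrite ler_wpM2l// ltW.
rewrite mulrAC ler_pdivrMr// => h2.
rewrite -lerBlDr -(ler_pM2r te0); apply: le_trans h2.
have : 0 <= e * e by rewrite mulr_ge0// ltW.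
lra.
Qed.

Lemma half_inverse_lcm y : 0 <= y ->
  0 <= half_inverse L y /\ L (half_inverse L y) = y.
Proof. by apply: half_inverseK; [exact: lcm_inj|exact: lcm_surj]. Qed.

Lemma half_inverse_lcmK x : 0 <= x -> half_inverse L (L x) = x.
Proof. by apply: half_inverse_of; exact: lcm_inj. Qed.

Let lcm_le_inv x y : 0 <= x -> 0 <= y -> L x <= L y -> x <= y.
Proof.
move=> x0 y0 h; rewrite leNgt; apply/negP => /(lcm_lt y0).
by rewrite ltNge h.
Qed.

Lemma young_half_inverse_lcm : young (half_inverse L).
Proof.
split.
- by rewrite -{1}lcm0 half_inverse_lcmK.
- move=> t t0; have [i0 iE] := half_inverse_lcm (ltW t0).
  rewrite lt_neqAle i0 andbT eq_sym; apply/eqP => e.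
  by move: t0; rewrite -iE e lcm0 ltxx.
- move=> s t s0 st; have [i0 iE] := half_inverse_lcm s0.
  have [j0 jE] := half_inverse_lcm (le_trans s0 st).
  by apply: lcm_le_inv; rewrite // iE jE.
- move=> l x y l0 l1 x0 y0; have [i0 iE] := half_inverse_lcm x0.
  have [j0 jE] := half_inverse_lcm y0.
  have l1' : 0 <= 1 - l by rewrite subr_ge0.
  have [k0 kE] : 0 <= half_inverse L (l * x + (1 - l) * y) /\ _ :=
    half_inverse_lcm (addr_ge0 (mulr_ge0 l0 x0) (mulr_ge0 l1' y0)).
  apply: lcm_le_inv => //; first by rewrite addr_ge0// mulr_ge0.
  by rewrite kE -{1}iE -{1}jE; exact: lcm_concave.
Qed.

End LeastConcaveMajorant.

(** * Growth of [Psi_theta] and the Calderon factorisation of [Phi] *)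

Section PsiTheta.
Context {R : realType}.
Variables (Phi : R -> R) (th p q Cp Cq : R).
Hypothesis hPhi : N_function Phi.
Hypothesis th_gt0 : 0 < th.
Hypothesis th_lt1 : th < 1.
Hypothesis q_gt0 : 0 < q.
Hypothesis p_gt0 : 0 < p.
Hypothesis th_q : th / 2 < q^-1.
Hypothesis th_p : p^-1 <= 1 - th / 2.
Hypothesis Cp_gt0 : 0 < Cp.
Hypothesis Cq_gt0 : 0 < Cq.
Hypothesis upper : forall s u, 1 <= s -> 0 < u -> Phi (s * u) <= Cq * (s `^ q * Phi u).
Hypothesis lower : forall s u, 0 < s -> s <= 1 -> 0 < u ->
  Phi (s * u) <= Cp * (s `^ p * Phi u).

Local Notation g := (half_inverse Phi).
Local Notation Psi := (Psi_theta Phi th).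

Let yF := N_function_young hPhi.

Let g_gt0 t : 0 < t -> 0 < g t.
Proof.
move=> t0; have [g0 gE] := half_inverse_Phi hPhi (ltW t0).
rewrite lt_neqAle g0 andbT eq_sym; apply/eqP => e.
by move: t0; rewrite -gE e (young0 yF) ltxx.
Qed.

Let Phi_g t : 0 < t -> Phi (g t) = t.
Proof. by move=> t0; have [] := half_inverse_Phi hPhi (ltW t0). Qed.

Let g_le s t : 0 < s -> s <= t -> g s <= g t.
Proof.
move=> s0 st; have t0 := lt_le_trans s0 st; rewrite leNgt; apply/negP => h.
have := N_function_lt hPhi (ltW (g_gt0 t0)) h.
by rewrite !Phi_g// ltNge st.
Qed.

Let root_le (x y r : R) : 0 < r -> 0 <= x -> 0 <= y -> x `^ r <= y -> x <= y `^ r^-1.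
Proof.
move=> r0 x0 y0 h; rewrite -[x]powRr1// -(mulfV (lt0r_neq0 r0)) powRrM.
by apply: ge0_ler_powR; rewrite ?nnegrE ?powR_ge0 ?invr_ge0 ?(ltW r0).
Qed.

Let one_powR (x : R) : 1 `^ x = 1 :> R. Proof. by rewrite powR1. Qed.

Let powRV (x r : R) : 0 < x -> x^-1 `^ r = (x `^ r)^-1.
Proof. by move=> x0; rewrite -powR_inv1 ?(ltW x0)// -powRrM mulN1r powRN. Qed.

(** Inversion exchanges the roles: the lower type p of [Phi] becomes growth of order at most 1 / p
    for its inverse, and the upper type q becomes decay of order 1 / q below. *)
Let g_upper s t : 1 <= s -> 0 < t -> g (s * t) <= (Cp * s) `^ p^-1 * g t.
Proof.
move=> s1 t0; have s0 : 0 < s by exact: lt_le_trans s1.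
have st0 : 0 < s * t by exact: mulr_gt0.
have u0 := g_gt0 t0; have v0 := g_gt0 st0.
have uv : g t <= g (s * t) by apply: g_le => //; rewrite ler_peMl// ltW.
rewrite -ler_pdivrMr//; apply: root_le => //.
- by rewrite divr_ge0 ?(ltW v0) ?(ltW u0).
- by rewrite mulr_ge0 ?(ltW Cp_gt0) ?(ltW s0).
have r0 : 0 < g t / g (s * t) by rewrite divr_gt0.
have r1 : g t / g (s * t) <= 1 by rewrite ler_pdivrMr// mul1r.
have := lower r0 r1 v0; rewrite divfK ?gt_eqF// !Phi_g//.
have -> : (g t / g (s * t)) `^ p = ((g (s * t) / g t) `^ p)^-1.
  by rewrite -powRV ?divr_gt0// invf_div.
set w := _ `^ p; have w0 : 0 < w by rewrite powR_gt0// divr_gt0.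
move=> h; have : t * w <= Cp * s * t.
  move: h; rewrite mulrCA ler_pdivlMl//; lra.
by rewrite mulrC ler_pM2r.
Qed.

Let g_lower s t : 0 < s -> s <= 1 -> 0 < t -> g (s * t) <= (Cq * s) `^ q^-1 * g t.
Proof.
move=> s0 s1 t0; have st0 : 0 < s * t by exact: mulr_gt0.
have v0 := g_gt0 t0; have u0 := g_gt0 st0.
have uv : g (s * t) <= g t by apply: g_le => //; rewrite ler_piMl// ltW.
rewrite -ler_pdivrMr//; apply: root_le => //.
- by rewrite divr_ge0 ?(ltW v0) ?(ltW u0).
- by rewrite mulr_ge0 ?(ltW Cq_gt0) ?(ltW s0).
have r1 : 1 <= g t / g (s * t) by rewrite ler_pdivlMr// mul1r.
have := upper r1 u0; rewrite divfK ?gt_eqF// !Phi_g//.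
have -> : (g t / g (s * t)) `^ q = ((g (s * t) / g t) `^ q)^-1.
  by rewrite -powRV ?divr_gt0// invf_div.
set w := _ `^ q; have w0 : 0 < w by rewrite powR_gt0// divr_gt0.
move=> h; have : t * w <= Cq * s * t.
  move: h; rewrite mulrCA ler_pdivlMl//; lra.
by rewrite mulrC ler_pM2r.
Qed.

Let e_gt0 : 0 < (1 - th)^-1. Proof. by rewrite invr_gt0 subr_gt0. Qed.

Lemma Psi_theta0 : Psi 0 = 0. Proof. by rewrite /Psi_theta eqxx. Qed.

Let PsiE t : 0 < t -> Psi t = (g t * t `^ (- (th / 2))) `^ (1 - th)^-1.
Proof. by move=> t0; rewrite /Psi_theta gt_eqF. Qed.

Lemma Psi_theta_gt0 t : 0 < t -> 0 < Psi t.
Proof. by move=> t0; rewrite PsiE// powR_gt0// mulr_gt0 ?g_gt0// powR_gt0. Qed.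

Let Psi_scale (C r s t : R) : 0 < C -> 0 < s -> 0 < t ->
  g (s * t) <= (C * s) `^ r * g t ->
  Psi (s * t) <= C `^ (r / (1 - th)) * s `^ ((r - th / 2) / (1 - th)) * Psi t.
Proof.
move=> C0 s0 t0 h; have st0 := mulr_gt0 s0 t0.
rewrite !PsiE// !powRrM -!powRM ?powR_ge0 ?mulr_ge0 ?powR_ge0 ?(ltW (g_gt0 _))//.
apply: ge0_ler_powR; rewrite ?nnegrE ?(ltW e_gt0) ?mulr_ge0 ?powR_ge0 ?(ltW (g_gt0 _))//.
rewrite [(s * t) `^ _]powRM ?(ltW s0) ?(ltW t0)//.
rewrite [s `^ (r - _)]powRB ?(gt_eqF s0) ?implybT//.
rewrite powRM ?(ltW C0) ?(ltW s0)// in h.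
rewrite [s `^ (- _)]powRN.
have st' : 0 <= (s `^ (th / 2))^-1 * t `^ (- (th / 2)).
  by rewrite mulr_ge0 ?invr_ge0 ?powR_ge0.
apply: (le_trans (ler_wpM2r st' h)).
by rewrite le_eqVlt; apply/orP; left; apply/eqP; ring.
Qed.

Let K0 := Cq `^ (q^-1 / (1 - th)).
Let k0 := (q^-1 - th / 2) / (1 - th).
Let K1 := Cp `^ (p^-1 / (1 - th)).
Let K0_gt0 : 0 < K0. Proof. exact: powR_gt0. Qed.
Let K1_gt0 : 0 < K1. Proof. exact: powR_gt0. Qed.
Let k0_gt0 : 0 < k0. Proof. by rewrite mulr_gt0// subr_gt0. Qed.

(** The exponent [k0] is positive exactly because th / 2 < 1 / q; this is the origin of the
    constraint on theta by the upper index. *)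
Let Psi_lower s t : 0 < s -> s <= 1 -> 0 < t -> Psi (s * t) <= K0 * s `^ k0 * Psi t.
Proof. by move=> s0 s1 t0; apply: Psi_scale => //; exact: g_lower. Qed.

(** The exponent (1 / p - th / 2) / (1 - th) is at most 1 exactly when 1 / p <= 1 - th / 2, the
    constraint on theta by the lower index. At most linear growth is what quasi-concavity
    requires. *)
Let Psi_upper s t : 1 <= s -> 0 < t -> Psi (s * t) <= K1 * s * Psi t.
Proof.
move=> s1 t0; have s0 := lt_le_trans ltr01 s1.
apply: (le_trans (Psi_scale Cp_gt0 s0 t0 (g_upper s1 t0))).
rewrite ler_wpM2r ?(ltW (Psi_theta_gt0 t0))// ler_wpM2l ?(ltW K1_gt0)//.
rewrite -[leRHS]powRr1 ?(ltW s0)//; apply: ler_powR => //.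
by rewrite ler_pdivrMr ?subr_gt0// mul1r; move: th_p; lra.
Qed.

Lemma Psi_theta_quasi_concave t r : 0 < t -> 0 < r ->
  Psi r <= (K0 + K1) * (1 + r / t) * Psi t.
Proof.
move=> t0 r0; have Pt := Psi_theta_gt0 t0.
have rt0 : 0 < r / t by rewrite divr_gt0.
rewrite -{1}[r](divfK (lt0r_neq0 t0)).
have [r1|/ltW r1] := leP (r / t) 1.
  apply: (le_trans (Psi_lower rt0 r1 t0)); rewrite ler_wpM2r ?(ltW Pt)//.
  have h : (r / t) `^ k0 <= 1.
    rewrite -[leRHS](one_powR k0).
    by apply: ge0_ler_powR; rewrite ?nnegrE ?(ltW k0_gt0) ?(ltW rt0).
  apply: ler_pM; rewrite ?powR_ge0 ?(ltW K0_gt0) ?lerDl ?(ltW K1_gt0)//.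
  by rewrite (le_trans h)// lerDl ltW.
apply: (le_trans (Psi_upper r1 t0)); rewrite ler_wpM2r ?(ltW Pt)//.
by apply: ler_pM; rewrite ?(ltW K1_gt0) ?(ltW rt0) ?lerDr ?(ltW K0_gt0).
Qed.

Let small_power x : 0 < x -> exists s, [/\ 0 < s, s <= 1 & s `^ k0 <= x].
Proof.
move=> x0; pose y := Num.min 1 x.
have y0 : 0 < y by rewrite lt_min ltr01.
have y1 : y <= 1 by rewrite ge_min lexx.
exists (y `^ k0^-1); split; first exact: powR_gt0.
  rewrite -[leRHS](one_powR k0^-1).
  by apply: ge0_ler_powR; rewrite ?nnegrE ?invr_ge0 ?(ltW y0) ?(ltW k0_gt0).
by rewrite -powRrM mulVf ?gt_eqF// powRr1 ?(ltW y0)// ge_min lexx orbT.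
Qed.

Lemma Psi_theta_small e : 0 < e -> exists2 t, 0 < t & Psi t <= e.
Proof.
move=> e0; have P1 := Psi_theta_gt0 (@ltr01 R).
have [s [s0 s1 hs]] := small_power (divr_gt0 e0 (mulr_gt0 K0_gt0 P1)).
exists s => //; have := Psi_lower s0 s1 ltr01; rewrite mulr1 => /le_trans; apply.
by move: hs; rewrite ler_pdivlMr ?mulr_gt0// mulrCA mulrA.
Qed.

Lemma Psi_theta_large M : exists2 t, 0 < t & M <= Psi t.
Proof.
have P1 := Psi_theta_gt0 (@ltr01 R).
have M0 : 0 < `|M| + 1 by rewrite ltr_wpDl.
have [s [s0 s1 hs]] := small_power (divr_gt0 P1 (mulr_gt0 K0_gt0 M0)).
exists s^-1; first by rewrite invr_gt0.
have t0 : 0 < s^-1 by rewrite invr_gt0.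
have := Psi_lower s0 s1 t0; rewrite (mulfV (lt0r_neq0 s0)) => h.
have Pt := Psi_theta_gt0 t0.
have : Psi 1 <= Psi 1 / (`|M| + 1) * Psi s^-1.
  apply: (le_trans h); rewrite ler_wpM2r ?(ltW Pt)//.
  rewrite (ler_pdivlMr _ _ M0) [K0 * _]mulrC -mulrA.
  rewrite -(ler_pdivlMr _ _ (mulr_gt0 K0_gt0 M0)); exact: hs.
rewrite mulrAC (ler_pdivlMr _ _ M0) (ler_pM2l P1) => h2.
apply: le_trans h2; apply: (le_trans (ler_norm M)); rewrite lerDl; exact: ler01.
Qed.

(** The definition of [Psi_theta] solved for the inverse of [Phi]. As the square root inverts the
    square, this displays [Phi] as a Calderon product with second factor t^2. *)
Lemma half_inverse_factor t : 0 < t -> g t = Psi t `^ (1 - th) * Num.sqrt t `^ th.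
Proof.
move=> t0; have -> : Num.sqrt t `^ th = t `^ (th / 2).
  by rewrite -powR12_sqrt ?(ltW t0)// -powRrM mulrC.
rewrite PsiE// -powRrM mulVf ?gt_eqF ?subr_gt0//.
rewrite powRr1 ?mulr_ge0 ?powR_ge0 ?(ltW (g_gt0 t0))//.
by rewrite -mulrA -powRD ?(gt_eqF t0) ?implybT// addNr powRr0 mulr1.
Qed.

Let K := K0 + K1.
Let K_gt0 : 0 < K. Proof. exact: addr_gt0. Qed.

Let L_le := lcm_le Psi_theta0 Psi_theta_gt0 K_gt0 Psi_theta_quasi_concave.
Let L_ge := lcm_ge Psi_theta0 Psi_theta_gt0 K_gt0 Psi_theta_quasi_concave.
Let L_mono := lcm_le_mono Psi_theta0 Psi_theta_gt0 K_gt0 Psi_theta_quasi_concave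
  Psi_theta_large.
Let L_inv := half_inverse_lcm Psi_theta0 Psi_theta_gt0 K_gt0 Psi_theta_quasi_concave
  Psi_theta_small Psi_theta_large.
Let L_invK := half_inverse_lcmK Psi_theta0 Psi_theta_gt0 K_gt0 Psi_theta_quasi_concave
  Psi_theta_large.

Lemma Phi_theta_young : young (Phi_theta Phi th).
Proof.
exact: young_half_inverse_lcm Psi_theta0 Psi_theta_gt0 K_gt0 Psi_theta_quasi_concave
  Psi_theta_small Psi_theta_large.
Qed.

Lemma Phi_theta_factor x : 0 < x -> exists y z, [/\ 0 < y, 0 < z,
  x = y `^ (1 - th) * z `^ th, Phi_theta Phi th y <= Phi x & z ^+ 2 <= Phi x].
Proof.
move=> x0; have t0 := young_gt0 yF x0.
exists (Psi (Phi x)), (Num.sqrt (Phi x)); split.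
- exact: Psi_theta_gt0.
- by rewrite sqrtr_gt0.
- by rewrite -half_inverse_factor// half_inverse_PhiK// ltW.
- rewrite -[leRHS](L_invK (ltW t0)); apply: (young_le Phi_theta_young).
    exact: ltW (Psi_theta_gt0 _).
  by apply: L_ge; exact: ltW.
- by rewrite sqr_sqrtr// ltW.
Qed.

Definition Phi_theta_const : R := (2 * K) `^ (1 - th).

Lemma Phi_theta_const_gt0 : 0 < Phi_theta_const.
Proof. by rewrite powR_gt0// mulr_gt0. Qed.

Lemma Phi_theta_product_le y z : 0 <= y -> 0 <= z ->
  Phi (y `^ (1 - th) * z `^ th / Phi_theta_const) <= Phi_theta Phi th y + z ^+ 2.
Proof.
move=> y0 z0; have [s0 sE] := L_inv y0.
rewrite -/(Phi_theta Phi th y) in s0; set s := Phi_theta _ _ _ in s0 *.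
(* At the common level m both factors are controlled, y by [2 * K * Psi m] and z by the square root
   of m, and the factorisation recombines them into the inverse of [Phi] at m. *)
pose m := s + z ^+ 2; have m0 : 0 <= m by rewrite addr_ge0// exprn_ge0.
have C0 := Phi_theta_const_gt0.
have zm : z <= Num.sqrt m.
  by rewrite -[z]ger0_norm// -sqrtr_sqr ler_wsqrtr// lerDr.
have th1 : 0 <= 1 - th by rewrite subr_ge0 ltW.
have [m00|m00] := eqVneq m 0.
  have z00 : z = 0.
    by apply/eqP; rewrite -sqrf_eq0 eq_le sqr_ge0 andbT -[leRHS]m00 lerDr.
  by rewrite z00 powR0 ?gt_eqF// mulr0 mul0r (young0 yF) expr0n addr0.
have {m00}m1 : 0 < m by rewrite lt_neqAle eq_sym m00.
have Pm := Psi_theta_gt0 m1.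
have ym : y <= 2 * K * Psi m.
  rewrite -sE; apply: le_trans (L_le m1).
  by apply: L_mono => //; rewrite lerDl sqr_ge0.
have le_g : y `^ (1 - th) * z `^ th / Phi_theta_const <= g m.
  rewrite ler_pdivrMr// half_inverse_factor// mulrAC [_ * Phi_theta_const]mulrC.
  rewrite -powRM ?(ltW Pm) ?mulr_ge0 ?(ltW K_gt0)//.
  apply: ler_pM; rewrite ?powR_ge0//; apply: ge0_ler_powR; rewrite ?nnegrE ?sqrtr_ge0 ?(ltW th_gt0)//.
  by rewrite !mulr_ge0 ?(ltW Pm) ?(ltW K_gt0).
apply: (@le_trans _ _ (Phi (g m))); last by rewrite Phi_g.
by apply: (young_le yF) => //; rewrite divr_ge0 ?(ltW C0)// mulr_ge0 ?powR_ge0.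
Qed.

End PsiTheta.

Section PhiTheta.
Context {R : realType}.
Variables (Phi : R -> R) (th : R).
Hypothesis hPhi : N_function Phi.
Hypothesis hind : [/\ (1 < alpha_index Phi)%E, (alpha_index Phi <= beta_index Phi)%E &
  (beta_index Phi < +oo)%E].
Hypothesis hth : 0 < th < theta_max Phi.

Lemma young_sqr : young (fun t : R => t ^+ 2).
Proof.
split => [|t t0|s t s0 st|l x y l0 l1 x0 y0]; first by rewrite expr0n.
- exact: exprn_gt0.
- by rewrite lerXn2r ?nnegrE// (le_trans s0).
- rewrite -subr_ge0.
  have -> : l * x ^+ 2 + (1 - l) * y ^+ 2 - (l * x + (1 - l) * y) ^+ 2 =
     l * (1 - l) * (x - y) ^+ 2 by ring.
  by rewrite mulr_ge0 ?sqr_ge0// mulr_ge0// subr_ge0.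
Qed.

Let indices : exists a b : R, [/\ alpha_index Phi = a%:E, beta_index Phi = b%:E, 1 < a & a <= b].
Proof.
have [a1 ab b1] := hind.
have aE : alpha_index Phi = (fine (alpha_index Phi))%:E.
  by rewrite fineK// fin_real// (lt_trans (ltNyr 1) a1) (le_lt_trans ab b1).
have bE : beta_index Phi = (fine (beta_index Phi))%:E.
  by rewrite fineK// fin_real// b1 andbT (lt_le_trans (lt_trans (ltNyr 1) a1) ab).
exists (fine (alpha_index Phi)), (fine (beta_index Phi)); split => //.
  by rewrite -lte_fin -aE.
by rewrite -lee_fin -aE -bE.
Qed.

Let exponents : exists a b : R, [/\ alpha_index Phi = a%:E, beta_index Phi = b%:E,
  [/\ 0 < a & 0 < b], [/\ 0 < th & th < 1] & [/\ th / 2 < b^-1 & a^-1 < 1 - th / 2]].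
Proof.
have [a [b [aE bE a1 ab]]] := indices; exists a, b.
have a0 : 0 < a by exact: lt_trans a1.
have b0 : 0 < b by exact: lt_le_trans ab.
move: hth; rewrite /theta_max aE bE /= => /andP[th0].
rewrite mulrC -ltr_pdivrMr// lt_min => /andP[h1 h2].
have ba : b^-1 <= a^-1 by rewrite lef_pV2.
split => //; split => //; lra.
Qed.

Lemma N_function_delta2 : exists2 D, 0 <= D & forall t, 0 <= t -> Phi (2 * t) <= D * Phi t.
Proof.
have yF := N_function_young hPhi.
have [a [b [aE bE [a0 b0] _ _]]] := exponents.
have [|t t1 h] := @beta_power _ _ hPhi (b + 1); first by rewrite bE lte_fin ltrDl.
have b1 : 0 < b + 1 by exact: addr_gt0.
exists (t `^ (b + 1) * 2 `^ (b + 1)) => [|u]; first by rewrite mulr_ge0 ?powR_ge0.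
rewrite le_eqVlt => /predU1P[<-|u0]; first by rewrite !mulr0 (young0 yF) mulr0.
by rewrite -mulrA; apply: power_upper => //; rewrite ler1n.
Qed.

Lemma Phi_theta_interpolates : [/\ young (Phi_theta Phi th), 0 < th, th < 1,
  (forall x, 0 < x -> exists y z, [/\ 0 < y, 0 < z,
     x = y `^ (1 - th) * z `^ th, Phi_theta Phi th y <= Phi x & z ^+ 2 <= Phi x]) &
  exists2 C, 0 < C & forall y z, 0 <= y -> 0 <= z ->
     Phi (y `^ (1 - th) * z `^ th / C) <= Phi_theta Phi th y + z ^+ 2].
Proof.
have yF := N_function_young hPhi.
have [a [b [aE bE [a0 b0] [th0 th1] [hb ha]]]] := exponents.
have th2 : 0 < th / 2 by rewrite divr_gt0.
have th3 : 0 < 1 - th / 2 by lra.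
have bq : b < (th / 2)^-1 by rewrite -[b]invrK ltf_pV2 ?posrE ?invr_gt0.
have pa : (1 - th / 2)^-1 < a by rewrite -[a]invrK ltf_pV2 ?posrE ?invr_gt0.
(* Midpoints: q lies strictly between the upper index and 2 / th, p strictly between 1 / (1 - th /
   2) and the lower index. The indices themselves need not be attained as growth exponents. *)
pose q := (b + (th / 2)^-1) / 2; pose p := ((1 - th / 2)^-1 + a) / 2.
have ip0 : 0 < (1 - th / 2)^-1 by rewrite invr_gt0.
have q1 : b < q by rewrite /q; lra.
have q2 : q < (th / 2)^-1 by rewrite /q; lra.
have p1 : p < a by rewrite /p; lra.
have p2 : (1 - th / 2)^-1 < p by rewrite /p; lra.
have q0 : 0 < q by exact: lt_trans q1.
have p0 : 0 < p by exact: lt_trans p2.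
have thq : th / 2 < q^-1 by rewrite -[th / 2]invrK ltf_pV2 ?posrE ?invr_gt0.
have thp : p^-1 <= 1 - th / 2.
  by rewrite -[1 - th / 2]invrK lef_pV2 ?posrE ?invr_gt0// ltW.
have [|t t1 ht] := @beta_power _ _ hPhi q; first by rewrite bE lte_fin.
have [|s [s0 s1 hs]] := @alpha_power _ _ hPhi p; first by rewrite aE lte_fin.
have upper := power_upper yF t1 q0 ht.
have lower := power_lower yF s0 s1 p0 hs.
have Cp0 : 0 < (s `^ p)^-1 by rewrite invr_gt0 powR_gt0.
have Cq0 : 0 < t `^ q by rewrite powR_gt0// (lt_trans _ t1).
split => //.
- by apply: (@Phi_theta_young R Phi th p q (s `^ p)^-1 (t `^ q)); eassumption.
- by apply: (@Phi_theta_factor R Phi th p q (s `^ p)^-1 (t `^ q)); eassumption.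
exists (Phi_theta_const th p q (s `^ p)^-1 (t `^ q)).
  by apply: (@Phi_theta_const_gt0 R th p q (s `^ p)^-1 (t `^ q)); eassumption.
by apply: (@Phi_theta_product_le R Phi th p q (s `^ p)^-1 (t `^ q)); eassumption.
Qed.

End PhiTheta.

(** * Trigonometric polynomials and the bound on l^2 *)

Section TrigonometricPolynomials.
Context {R : realType}.
Implicit Types (x y : R) (l : seq (R * R * int)) (j : int).
Local Notation mu := (@lebesgue_measure R).

(** Coefficient lists of cosines, sines and frequencies: differentiation acts on the list, so all
    derivatives and primitives stay explicit. *)
Definition trig l y : R :=
  \sum_(p <- l) (p.1.1 * cos (p.2%:~R * y) + p.1.2 * sin (p.2%:~R * y)).

Definition dtrig l : seq (R * R * int) :=
  [seq (p.1.2 * p.2%:~R, - p.1.1 * p.2%:~R, p.2) | p <- l].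

Lemma trig_is_derive l y : is_derive y 1 (trig l) (trig (dtrig l) y).
Proof.
elim: l => [|[[a b] j] l IH].
  have -> : trig (dtrig [::]) y = 0 by rewrite /trig big_nil.
  have -> : trig [::] = cst 0 by apply/funext => x; rewrite /trig big_nil.
  exact: is_derive_cst.
have -> : trig ((a, b, j) :: l) = (fun x => a * cos (j%:~R * x) + b * sin (j%:~R * x)) \+ trig l.
  by apply/funext => x; rewrite /trig big_cons.
have -> : trig (dtrig ((a, b, j) :: l)) y =
   (b * j%:~R * cos (j%:~R * y) + - a * j%:~R * sin (j%:~R * y)) + trig (dtrig l) y.
  by rewrite /trig big_cons.
apply: is_deriveD.
have hj : is_derive y 1 (fun x : R => j%:~R * x) j%:~R.
  by apply: is_derive_eq; rewrite ?scaler0 ?addr0 ?add0r /GRing.scale/= ?mulr1.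
have hc : is_derive y 1 (fun x : R => cos (j%:~R * x)) (- sin (j%:~R * y) * j%:~R).
  exact: (@is_derive1_comp _ cos (fun x => j%:~R * x)).
have hs : is_derive y 1 (fun x : R => sin (j%:~R * x)) (cos (j%:~R * y) * j%:~R).
  exact: (@is_derive1_comp _ sin (fun x => j%:~R * x)).
have ha := is_deriveZ a hc; have hb := is_deriveZ b hs.
have hab := is_deriveD ha hb; apply: (is_derive_eq hab).
by rewrite /GRing.scale/=; ring.
Qed.

Lemma derive1n_trig n l : derive1n n (trig l) = trig (iter n dtrig l).
Proof.
elim: n => [//|n IH]; rewrite derive1nS IH; apply/funext => y.
rewrite derive1E; exact: (derive_val (is_derive := trig_is_derive _ _)).
Qed.

Lemma derivable_trig l y : derivable (trig l) y 1.
Proof. by have [] := trig_is_derive l y. Qed.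

Lemma continuous_trig l : continuous (trig l).
Proof.
by move=> y; apply/differentiable_continuous/derivable1_diffP/derivable_trig.
Qed.

Lemma cis_2piz j : cis (j%:~R * (2 * pi)) = 1 :> R[i].
Proof.
rewrite mulr_natl; case: j => n; last rewrite NegzE mulrNz mulNr cisN.
  by rewrite -pmulrn mulr_natl -cisX cis2pi expr1n.
by rewrite -pmulrn mulr_natl -cisX cis2pi expr1n invr1.
Qed.

Lemma trig_periodic l y : trig l (y + 2 * pi) = trig l y.
Proof.
apply: eq_bigr => p _; rewrite mulrDr.
have := cisD (p.2%:~R * y) (p.2%:~R * (2 * pi)).
by rewrite cis_2piz mulr1 => -[-> ->].
Qed.

Lemma trig_integrable l : mu.-integrable `[- pi, pi] (EFin \o trig l).
Proof.
apply: continuous_compact_integrable; first exact: segment_compact.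
by apply: continuous_subspaceT => x; exact: continuous_trig.
Qed.

Lemma trig_Rintegral l :
  \int[mu]_(x in `[- pi, pi]) trig l x = 2 * pi * \sum_(p <- l | p.2 == 0) p.1.1.
Proof.
have pi0 := pi_gt0 R.
elim: l => [|[[a b] j] l IH].
  rewrite (_ : Rintegral _ _ _ = \int[mu]_(x in `[- pi, pi]) 0); last by apply: eq_Rintegral => x _; rewrite /trig big_nil.
  by rewrite Rintegral_cst//= mul0r big_nil mulr0.
have -> : trig ((a, b, j) :: l) = (fun x => trig [:: (a, b, j)] x + trig l x).
  by apply/funext => x; rewrite /trig !big_cons big_nil addr0.
rewrite RintegralD//; [|exact: trig_integrable|exact: trig_integrable].
rewrite IH big_cons/=; case: eqP => [->|/eqP j0].
  rewrite [RHS]mulrDr; congr (_ + _).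
  rewrite (_ : Rintegral _ _ _ = \int[mu]_(x in `[- pi, pi]) a); last first.
    by apply: eq_Rintegral => x _; rewrite /trig big_cons big_nil/= mul0r cos0 sin0 mulr1 mulr0 !addr0.
  rewrite Rintegral_cst//= lebesgue_measure_itv/= lte_fin ifT; last by lra.
  by rewrite -EFinD/= opprK mulrC; congr (_ * _); ring.
rewrite [X in X + _](_ : _ = 0) ?add0r//.
have jR : j%:~R != 0 :> R by rewrite intr_eq0.
(* An explicit primitive for nonzero frequency; being periodic, it takes equal values at both
   ends. *)
pose G := [:: (- b / j%:~R, a / j%:~R, j)].
have dG : dtrig G = [:: (a, b, j)].
  by rewrite /dtrig /=; congr [:: (_, _, _)]; field.
rewrite /Rintegral (@continuous_FTC2 _ _ (trig G)).
- by rewrite -EFinB/= -(trig_periodic G (- pi)) (_ : - pi + 2 * pi = pi) ?subrr//; ring.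
- by lra.
- by apply: continuous_subspaceT => x; exact: continuous_trig.
- split.
  + by move=> x _; exact: derivable_trig.
  + by apply: cvg_at_right_filter; exact: continuous_trig.
  + by apply: cvg_at_left_filter; exact: continuous_trig.
- by move=> x _; rewrite derive1E (derive_val (is_derive := trig_is_derive _ _)) dG.
Qed.

End TrigonometricPolynomials.

Section ComplexTrigonometricPolynomials.
Context {R : realType}.
Implicit Types (x y : R) (l m : seq (R[i] * int)) (c f : int -> R[i])
  (u : (R -> R[i]) -> R[i]).
Local Notation mu := (@lebesgue_measure R).

Definition tpoly l x : R[i] := \sum_(p <- l) p.1 * cis (p.2%:~R * x).

Lemma Re_tpoly l :
  (fun x => complex.Re (tpoly l x)) = trig [seq (complex.Re p.1, - complex.Im p.1, p.2) | p <- l].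
Proof.
apply/funext => x; rewrite /tpoly /trig big_map.
elim: l => [|[[a b] j] l IH]; first by rewrite !big_nil.
rewrite !big_cons raddfD/= IH; congr (_ + _).
by rewrite mulNr.
Qed.

Lemma Im_tpoly l :
  (fun x => complex.Im (tpoly l x)) = trig [seq (complex.Im p.1, complex.Re p.1, p.2) | p <- l].
Proof.
apply/funext => x; rewrite /tpoly /trig big_map.
elim: l => [|[[a b] j] l IH]; first by rewrite !big_nil.
rewrite !big_cons raddfD/= IH; congr (_ + _).
by rewrite addrC.
Qed.

Lemma tpoly_test l : test_function (tpoly l).
Proof.
split=> [x|n x].
  apply/eqP; rewrite eq_complex; apply/andP; split; apply/eqP.
    by have := trig_periodic [seq (complex.Re p.1, - complex.Im p.1, p.2) | p <- l] x; rewrite -Re_tpoly.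
  by have := trig_periodic [seq (complex.Im p.1, complex.Re p.1, p.2) | p <- l] x; rewrite -Im_tpoly.
by rewrite Re_tpoly Im_tpoly !derive1n_trig; split; exact: derivable_trig.
Qed.

Lemma tpoly_Rintegral l :
  \int[mu]_(x in `[- pi, pi]) complex.Re (tpoly l x) =
  2 * pi * complex.Re (\sum_(p <- l | p.2 == 0) p.1).
Proof. by rewrite Re_tpoly trig_Rintegral big_map raddf_sum. Qed.

Lemma tpoly_integrable l :
  mu.-integrable `[- pi, pi] (EFin \o (fun x => complex.Re (tpoly l x))).
Proof. by rewrite Re_tpoly; exact: trig_integrable. Qed.

Lemma tpoly_bounded l : exists M, forall x, normc (tpoly l x) <= M.
Proof.
exists (\sum_(p <- l) normc p.1) => x; apply: (le_trans (normc_sum _ _)).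
by apply: ler_sum => p _; rewrite normcM normc_cis mulr1.
Qed.

Lemma measurable_tpoly l : measurable_fun setT (fun x => complex.Re (tpoly l x)) /\
  measurable_fun setT (fun x => complex.Im (tpoly l x)).
Proof.
by rewrite Re_tpoly Im_tpoly; split; apply: continuous_measurable_fun => x; exact: continuous_trig.
Qed.

Definition tprod l m : seq (R[i] * int) := [seq (p.1 * q.1, p.2 + q.2) | p <- l, q <- m].

Lemma tpoly_prod l m x : tpoly (tprod l m) x = tpoly l x * tpoly m x.
Proof.
rewrite /tpoly big_allpairs_dep big_distrl/=; apply: eq_bigr => p _.
by rewrite big_distrr/=; apply: eq_bigr => q _; rewrite intrD mulrDl cisD mulrACA.
Qed.

Definition tconj l : seq (R[i] * int) := [seq (conjc p.1, - p.2) | p <- l].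

Lemma tpoly_conj l x : tpoly (tconj l) x = conjc (tpoly l x).
Proof.
rewrite /tpoly big_map; elim: l => [|p l IH]; first by rewrite !big_nil conjc0.
rewrite !big_cons IH -[RHS]/((conjc : {additive R[i] -> R[i]}) _) raddfD/=.
congr (_ + _); rewrite intrN mulNr /cis cosN sinN.
by case: p.1 => a b /=; simpc; congr (_ +i* _); ring.
Qed.

Definition that (s : seq int) f : seq (R[i] * int) := [seq (f k, k) | k <- s].

Definition linear_on_tests u : Prop := forall (a : R[i]) g h,
  test_function g -> test_function h -> u (fun x => a * g x + h x) = a * u g + u h.

(** The sign flip arises because Fourier coefficients pair [u] with exp(- i j x), whereas [tpoly] is
    written in exp(i j x). *)
Lemma linear_tpoly u l : linear_on_tests u ->
  u (tpoly l) = (2 * pi)%:C * \sum_(p <- l) p.1 * fourier_coef u (- p.2).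
Proof.
move=> hu; have pi0 := pi_gt0 R.
have pic : (2 * pi)%:C != 0 :> R[i].
  by rewrite eq_complex/= eqxx andbT; lra.
elim: l => [|[z j] l IH].
  rewrite big_nil mulr0; have e : tpoly [::] = (fun=> 0) by apply/funext => x; rewrite /tpoly big_nil.
  have t0 := tpoly_test [::]; have := hu (-1) _ _ t0 t0.
  rewrite e (_ : (fun _ : R => _) = (fun=> 0)); last by apply/funext => x; rewrite mulr0 addr0.
  by rewrite mulN1r addNr.
have te : test_function (expmi (- j) : R -> R[i]).
  have -> : expmi (- j) = tpoly [:: (1, j)] :> (R -> R[i]); last exact: tpoly_test.
  apply/funext => x; rewrite /tpoly big_cons big_nil addr0 mul1r /expmi /cis.
  by rewrite intrN mulNr cosN sinN opprK.
rewrite (_ : tpoly ((z, j) :: l) = fun x => z * expmi (- j) x + tpoly l x); last first.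
  apply/funext => x; rewrite /tpoly big_cons; congr (_ * _ + _).
  by rewrite /expmi /cis intrN mulNr cosN sinN opprK.
rewrite (hu z _ _ te (tpoly_test l)) IH big_cons [RHS]mulrDr; congr (_ + _) => /=.
rewrite /fourier_coef mulrCA; congr (_ * _); rewrite mulrA -rmorphM/= mulfV ?mul1r//.
by apply: contraNneq pic => ->.
Qed.

End ComplexTrigonometricPolynomials.

(** * Parseval and convolution bounds on l^2 *)

Section FourierBound.
Context {R : realType}.
Implicit Types (x y e : R) (w : R[i]) (c f : int -> R[i]) (s t : seq int)
  (u : (R -> R[i]) -> R[i]) (d : R -> R[i]).
Local Notation mu := (@lebesgue_measure R).

Lemma Re_conjc_mul (z : R[i]) : complex.Re (conjc z * z) = normc z ^+ 2.
Proof. by rewrite sqr_normcE; case: z => a b /=; ring. Qed.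

Lemma Re_sqr_tpoly s f x :
  normc (tpoly (that s f) x) ^+ 2 =
  complex.Re (tpoly (tprod (tconj (that s f)) (that s f)) x).
Proof. by rewrite tpoly_prod tpoly_conj Re_conjc_mul. Qed.

Lemma parseval s f : uniq s ->
  \int[mu]_(x in `[- pi, pi]) (normc (tpoly (that s f) x) ^+ 2) =
  2 * pi * \sum_(k <- s) normc (f k) ^+ 2.
Proof.
move=> us; under eq_Rintegral do rewrite Re_sqr_tpoly.
rewrite tpoly_Rintegral; congr (_ * _).
rewrite big_mkcond big_allpairs_dep !big_map raddf_sum.
apply: eq_big_seq => j js; rewrite big_map (bigD1_seq j)//= addNr eqxx.
rewrite big1 ?addr0 ?Re_conjc_mul// => k kj.
by rewrite addrC subr_eq0 (negbTE kj).
Qed.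

Lemma parseval_integrable s f :
  mu.-integrable `[- pi, pi] (EFin \o (fun x => normc (tpoly (that s f) x) ^+ 2)).
Proof.
by apply: eq_integrable (tpoly_integrable (tprod (tconj (that s f)) (that s f))) => // x _;
  rewrite /= -Re_sqr_tpoly.
Qed.

Lemma integrable_lin a b (g h : R -> R) :
  mu.-integrable `[- pi, pi] (EFin \o g) -> mu.-integrable `[- pi, pi] (EFin \o h) ->
  mu.-integrable `[- pi, pi] (EFin \o (fun x => a * g x + b * h x)).
Proof.
move=> ig ih.
have -> : EFin \o (fun x => a * g x + b * h x) =
    ((fun x => a%:E * (EFin \o g) x) \+ (fun x => b%:E * (EFin \o h) x))%E by [].
by apply: integrableD => //; apply: integrableZl.
Qed.

(** The Fourier series of f, written as a convolution with a character and evaluated at 0, so that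
    the translation rules of [convk] compute its behaviour under [pz]. *)
Definition fhat f x : R[i] := convk (fun n => cis (- (n%:~R * x))) f 0.

Lemma fhatE s f x : uniq s -> (forall n, n \notin s -> f n = 0) ->
  fhat f x = tpoly (that s f) x.
Proof.
move=> us hs; rewrite /fhat (convkE _ us hs) /tpoly big_map; apply: eq_bigr => k _.
by rewrite sub0r intrN mulNr opprK mulrC.
Qed.

Lemma convk_character f x j : S0 f ->
  convk (fun n => cis (- (n%:~R * x))) f j = cis (- (j%:~R * x)) * fhat f x.
Proof.
move=> /S0P[s us hs]; rewrite /fhat !(convkE _ us hs) mulr_sumr; apply: eq_bigr => k _.
rewrite mulrA -cisD; congr (cis _ * _).
by rewrite !rmorphB/=; ring.
Qed.

Definition symb w x : R[i] := w / 4%:R * cis (- x) + (2^-1 + w^-1 / 4%:R * cis x).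

Lemma fhat_pz w f x : S0 f -> fhat (pz w f) x = symb w x * fhat f x.
Proof.
move=> hf.
have hm : S0 (fun j => f (j - 1)).
  by apply: (S0_comp (k := fun j => j + 1)) hf => n; [exact: addrK|exact: subrK].
have hp : S0 (fun j => f (j - - 1)).
  by apply: (S0_comp (k := fun j => j + - 1)) hf => n; [exact: addrK|exact: subrK].
have h0 : S0 (fun=> 0 : R[i]) by apply/S0P; exists [::].
have hs0 := S0_lin (w^-1 / 4%:R) hm h0.
have -> : pz w f = fun j => w / 4%:R * f (j - - 1) +
    (2^-1 * f j + (w^-1 / 4%:R * f (j - 1) + 0)).
  by apply/funext => j; rewrite addr0 opprK.
rewrite /fhat (convk_lin _ _ hp (S0_lin _ hf hs0)) (convk_lin _ _ hf hs0) (convk_lin _ _ hm h0).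
rewrite (convk_shift _ _ hf) (convk_shift _ _ hf) !(convk_character _ _ hf).
rewrite (convk_character _ _ h0) (fhatE (s := [::]) _ _ (f := fun=> 0))// /tpoly big_nil.
rewrite mulr0 addr0 /symb !sub0r opprK mul1r mulN1r opprK mul0r oppr0 cis0 mul1r.
by rewrite !mulrDl !mulrA.
Qed.

Lemma fhat_iter_pz w f x N : S0 f -> fhat (iter N (pz w) f) x = symb w x ^+ N * fhat f x.
Proof.
move=> hf; elim: N => [|N IH]; first by rewrite expr0 mul1r.
by rewrite /= fhat_pz ?IH ?exprS ?mulrA//; exact: S0_iter_pz.
Qed.

Lemma bounded_measurable_integrable (g : R -> R) (M : R) : measurable_fun setT g ->
  (forall x, `|g x| <= M) -> mu.-integrable `[- pi, pi] (EFin \o g).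
Proof.
move=> mg gM; apply: measurable_bounded_integrable => //.
- by rewrite /= lebesgue_measure_itv/=; case: ifP => _; rewrite ?ltry// -EFinB ltry.
- exact: measurable_funS mg.
- exists M; split; first exact: num_real.
  by move=> N MN x _; apply: (le_trans (gM x)); exact: ltW.
Qed.

(* Only trigonometric polynomials are tested, so that [d] may be changed on a null set. *)
Definition bounded_symbol u d M : Prop :=
  [/\ measurable_fun setT (fun x => complex.Re (d x)),
      measurable_fun setT (fun x => complex.Im (d x)),
      forall x, normc (d x) <= M &
      forall l, complex.Re (u (tpoly l)) =
        \int[mu]_(x in `[- pi, pi]) complex.Re (d x * tpoly l x)].

Lemma Re_mulE (z z' : R[i]) :
  complex.Re (z * z') = complex.Re z * complex.Re z' - complex.Im z * complex.Im z'.
Proof. by case: z => ? ?; case: z'. Qed.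

Lemma measurable_Re_mul d l :
  measurable_fun setT (fun x => complex.Re (d x)) ->
  measurable_fun setT (fun x => complex.Im (d x)) ->
  measurable_fun setT (fun x => complex.Re (d x * tpoly l x)).
Proof.
move=> mRe mIm; have [mWR mWI] := measurable_tpoly l.
by under eq_fun do rewrite Re_mulE; apply: measurable_funB; apply: measurable_funM.
Qed.

Lemma bounded_symbol_integrable u d M l : bounded_symbol u d M ->
  mu.-integrable `[- pi, pi] (EFin \o (fun x => complex.Re (d x * tpoly l x))).
Proof.
move=> [mRe mIm dM _]; have [WM hWM] := tpoly_bounded l.
apply: (@bounded_measurable_integrable _ (M * WM)); first exact: measurable_Re_mul.
move=> x; apply: (le_trans (Re_le_normc _)); rewrite normcM.
by apply: ler_pM; rewrite ?normc_ge0.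
Qed.

(* [S = \sum_(j in t) |c_j|^2] is [(2 pi)^-1 Re u W] for [W = conj Q * (iter pz f)^],
   [Q] the polynomial with coefficients [c_j]; as [|d W| <= e |f^| |Q|], AM-GM gives
   [2 pi S <= \int (|Q|^2 + e^2 |f^|^2) / 2 = 2 pi (S + e^2 \sum |f_k|^2) / 2]. *)
Lemma convk_sum_le u d w N e M f s t : linear_on_tests u -> bounded_symbol u d M ->
  0 < e -> (forall x, x \in `[- pi, pi] -> normc (d x) * normc (symb w x) ^+ N <= e) ->
  uniq s -> (forall n, n \notin s -> f n = 0) -> uniq t ->
  \sum_(j <- t) normc (convk (fourier_coef u) (iter N (pz w) f) j) ^+ 2 <=
  e ^+ 2 * \sum_(k <- s) normc (f k) ^+ 2.
Proof.
move=> hu du e0 de us hs ut; have pi0 := pi_gt0 R.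
have hf : S0 f by apply/S0P; exists s.
have /S0P[s' us' hs'] := S0_iter_pz w N hf.
pose psi := iter N (pz w) f; pose c := convk (fourier_coef u) psi.
rewrite -/psi -/c in hs' *.
pose S := \sum_(j <- t) normc (c j) ^+ 2; pose X := \sum_(k <- s) normc (f k) ^+ 2.
pose W := tprod (tconj (that t c)) (that s' psi).
have uW : complex.Re (u (tpoly W)) = 2 * pi * S.
  rewrite linear_tpoly// big_allpairs_dep !big_map.
  rewrite (_ : \sum_(_ <- t) _ = \sum_(j <- t) conjc (c j) * c j); last first.
    apply: eq_bigr => j _; rewrite big_map /c (convkE _ us' hs') mulr_sumr.
    apply: eq_bigr => k _ /=; rewrite opprD opprK -mulrA; congr (_ * _).
    by rewrite mulrC.
  rewrite (_ : forall z : R[i], complex.Re ((2 * pi)%:C * z) = 2 * pi * complex.Re z).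
    by rewrite raddf_sum; congr (_ * _); apply: eq_bigr => j _; exact: Re_conjc_mul.
  by case=> a b /=; rewrite mul0r subr0.
suff : 2 * pi * S <= 2 * pi * (2^-1 * (S + e ^+ 2 * X)).
  by rewrite ler_pM2l ?mulr_gt0// -/S -/X; lra.
have iQ := parseval_integrable t c; have iF := parseval_integrable s f.
have [_ _ _ ud] := du; rewrite -uW ud.
have -> : 2 * pi * (2^-1 * (S + e ^+ 2 * X)) =
    \int[mu]_(x in `[- pi, pi]) (2^-1 * normc (tpoly (that t c) x) ^+ 2 +
       2^-1 * e ^+ 2 * normc (tpoly (that s f) x) ^+ 2).
  have iZ a g : mu.-integrable `[- pi, pi] (EFin \o g) ->
      mu.-integrable `[- pi, pi] (EFin \o (fun x => a * g x)).
    move=> ig; apply: eq_integrable (integrable_lin a 0 ig ig) => //= x _.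
    by rewrite mul0r addr0.
  rewrite RintegralD ?RintegralZl//; [|exact: iZ|exact: iZ].
  rewrite !parseval// -/S -/X; ring.
apply: le_Rintegral => //.
- exact: bounded_symbol_integrable du.
- exact: integrable_lin.
move=> x xI; apply: (le_trans (ler_norm _)); apply: (le_trans (Re_le_normc _)).
rewrite tpoly_prod tpoly_conj -(fhatE _ us' hs') (fhat_iter_pz _ _ _ hf) (fhatE _ us hs).
rewrite !normcM normcX; set A := tpoly _ x; set B := tpoly _ x.
have -> : normc (conjc A) = normc A by rewrite /A; case: tpoly => a b /=; rewrite sqrrN.
have A0 := normc_ge0 A; have B0 := normc_ge0 B.
have /(ler_wpM2r (mulr_ge0 A0 B0)) h := de x xI.
have h2 := sqr_ge0 (normc A - e * normc B).
nra.
Qed.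

Lemma mult_le_sqr u d w N e M : linear_on_tests u -> bounded_symbol u d M ->
  0 < e -> (forall x, x \in `[- pi, pi] -> normc (d x) * normc (symb w x) ^+ N <= e) ->
  mult_le (F := fun t : R => t ^+ 2) (fun f => convk (fourier_coef u) (iter N (pz w) f)) e.
Proof.
move=> hu du e0 de f f0; have yS := @young_sqr R.
have adm l : admissible (fun t : R => t ^+ 2) f l ->
    admissible (fun t : R => t ^+ 2) (convk (fourier_coef u) (iter N (pz w) f)) (e * l).
  move=> [l0 hl]; split; first exact: mulr_gt0.
  move=> t ut; have /S0P[s us hs] := f0.
  under eq_bigr do rewrite expr_div_n.
  rewrite -mulr_suml ler_pdivrMr ?exprn_gt0 ?mulr_gt0// mul1r.
  apply: le_trans (convk_sum_le hu du e0 de us hs ut) _.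
  rewrite exprMn ler_pM2l ?exprn_gt0//; have := hl s us.
  under eq_bigr do rewrite expr_div_n.
  by rewrite -mulr_suml ler_pdivrMr ?exprn_gt0// mul1r.
have fin := inL_S0 yS f0; split; first by have [l /adm hl] := fin; exists (e * l).
rewrite -ler_pdivrMl//; apply: le_of_le_add_eps => r r0.
rewrite ler_pdivrMl//; apply/lux_le/adm/(lux_lt yS fin).
by rewrite ltrDl.
Qed.

End FourierBound.

(** * Local distance *)

Section LocalSymbols.
Context {R : realType}.
Implicit Types (x y e r tau : R) (w : R[i]) (u v : (R -> R[i]) -> R[i]) (d f h : R -> R[i]).
Local Notation mu := (@lebesgue_measure R).

Lemma lebesgue_measure_translate c (A : set R) : measurable A ->
  pushforward mu ((fun x => x + c) : R -> measurableTypeR R) A = mu A.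
Proof.
move=> mA; have mf : measurable_fun setT (fun x : R => x + c : measurableTypeR R).
  by apply: measurable_funD.
apply/esym/lebesgue_measure_unique => //= _ [[a b]] _ <-.
rewrite /pushforward (_ : _ @^-1` _ = `](a - c), (b - c)]%classic); last first.
  by apply/seteqP; split => x /=; rewrite !in_itv/= ltrBlDr lerBrDr.
rewrite !lebesgue_measure_itv/= !lte_fin ltrD2r; case: ifP => // _.
by rewrite -!EFinB; congr (_%:E); ring.
Qed.

(** A neighbourhood of tau may leave [- pi, pi]; estimates on it are carried back by the periods,
    which requires null sets to be translation invariant. *)
Lemma ae_translate c (P : R -> Prop) :
  (\forall x \ae mu, P x) -> \forall x \ae mu, P (x + c).
Proof.
move=> [A [mA A0 PA]]; exists ((fun x => x + c) @^-1` A); split.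
- by rewrite -[X in measurable X]setTI; apply: measurable_funD.
- by rewrite -A0 -(lebesgue_measure_translate c mA).
- by move=> x /= nP; exact: PA.
Qed.

Lemma ae_imply (P Q : R -> Prop) : (forall x, P x -> Q x) ->
  (\forall x \ae mu, P x) -> \forall x \ae mu, Q x.
Proof.
by move=> PQ [A [mA A0 PA]]; exists A; split=> // x nQ; apply: PA => /= /PQ.
Qed.

Lemma ae_and (P Q : R -> Prop) :
  (\forall x \ae mu, P x) -> (\forall x \ae mu, Q x) -> \forall x \ae mu, P x /\ Q x.
Proof.
move=> [A [mA A0 PA]] [B [mB B0 QB]]; exists (A `|` B); split.
- exact: measurableU.
- by rewrite -A0; exact: measureU0.
- by move=> x /= /not_andP[/PA|/QB]; [left|right].
Qed.

(** Setting d to 0 on the exceptional null set makes an almost everywhere property hold everywhere,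
    and the pairings with trigonometric polynomials are unchanged. *)
Lemma bounded_symbol_cut u d M (P : R -> R[i] -> Prop) :
  measurable_fun setT (fun x => complex.Re (d x)) ->
  measurable_fun setT (fun x => complex.Im (d x)) ->
  (forall l, complex.Re (u (tpoly l)) =
    \int[mu]_(x in `[- pi, pi]) complex.Re (d x * tpoly l x)) ->
  (\forall x \ae mu, P x (d x)) -> (forall x, P x 0) ->
  (forall x z, P x z -> normc z <= M) ->
  exists d', [/\ bounded_symbol u d' M, forall x, P x (d' x) &
    \forall x \ae mu, d' x = d x].
Proof.
move=> mRe mIm ud [A [mA A0 PA]] P0 PM.
pose d' x := if x \in A then 0 else d x.
have mi : measurable_fun setT (\1_(~` A) : R -> R).
  by apply: measurable_indic; exact: measurableC.
have dE (g : R[i] -> R) x : g 0 = 0 -> g (d' x) = g (d x) * \1_(~` A) x.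
  move=> g0; rewrite /d' indicE in_setC; case: (x \in A); last by rewrite mulr1.
  by rewrite mulr0.
have Pd' x : P x (d' x).
  rewrite /d'; case: ifPn => // xA; apply: contrapT => nP.
  by move: xA; rewrite notin_setE; apply; exact: PA.
exists d'; split=> //; last first.
  exists A; split=> // x /= nE; apply: contrapT => xA; apply: nE.
  by rewrite /d' memNset.
have mRe' : measurable_fun setT (fun x => complex.Re (d' x)).
  rewrite (_ : (fun x => _) = (fun x => complex.Re (d x) * \1_(~` A) x)).
    exact: measurable_funM.
  by apply/funext => x; exact: (dE (fun z => complex.Re z)).
have mIm' : measurable_fun setT (fun x => complex.Im (d' x)).
  rewrite (_ : (fun x => _) = (fun x => complex.Im (d x) * \1_(~` A) x)).
    exact: measurable_funM.
  by apply/funext => x; exact: (dE (fun z => complex.Im z)).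
split=> // [x|l]; first exact: PM (Pd' x).
rewrite ud; congr fine; apply: ae_eq_integral => //.
- by apply/measurable_EFinP; apply: measurable_funS (measurable_Re_mul l mRe mIm).
- by apply/measurable_EFinP; apply: measurable_funS (measurable_Re_mul l mRe' mIm').
exists A; split=> // x /= nP; apply: contrapT => xA; apply: nP => _.
by rewrite /d' memNset.
Qed.

Lemma ae_Linfty_norm (D : set R) f e : (Linfty_norm D f <= e%:E)%E ->
  \forall x \ae mu, D x -> normc (f x) <= e.
Proof.
move=> /ess_supP; apply: filterS => x /=; rewrite lee_fin patchE.
by move=> h /mem_set xD; move: h; rewrite xD.
Qed.

Lemma Linfty_bounded_symbol f u : Linfty_periodic f -> represents f u ->
  exists d M, bounded_symbol u d M /\ \forall x \ae mu, d x = f x.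
Proof.
move=> [per mRe mIm fin] fu.
have [M hM] : exists M, \forall x \ae mu, normc (f x) <= M.
  have : exists M : R, (Linfty_norm setT f <= M%:E)%E.
    case: (Linfty_norm _ _) fin => [M _|//|_]; [by exists M; rewrite lexx|by exists 0; rewrite leNye].
  by move=> [M /ae_Linfty_norm hM]; exists M; apply: ae_imply hM => x; apply.
have fM : \forall x \ae mu, normc (f x) <= `|M|.
  by apply: ae_imply hM => x h; apply: le_trans h (ler_norm M).
have fl l : complex.Re (u (tpoly l)) =
    \int[mu]_(x in `[- pi, pi]) complex.Re (f x * tpoly l x).
  by rewrite fu//; exact: tpoly_test.
have P0 (x : R) : normc (0 : R[i]) <= `|M| by rewrite ComplexField.Normc.normc0.
have [d' [bd _ dE]] := @bounded_symbol_cut u f `|M| (fun=> fun z => normc z <= `|M|)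
  mRe mIm fl fM P0 (fun _ _ zM => zM).
by exists d', `|M|.
Qed.

Lemma bounded_symbol_sub u v d f M N : bounded_symbol u d M -> bounded_symbol v f N ->
  bounded_symbol (fun g => u g - v g) (fun x => d x - f x) (M + N).
Proof.
move=> hu hv; have [mRe mIm dM ud] := hu; have [mRe' mIm' fN vf] := hv.
have ReB (z z' : R[i]) : complex.Re (z - z') = complex.Re z - complex.Re z'.
  by case: z => ? ?; case: z'.
have ImB (z z' : R[i]) : complex.Im (z - z') = complex.Im z - complex.Im z'.
  by case: z => ? ?; case: z'.
split=> [||x|l].
- rewrite (_ : (fun x => _) = (fun x => complex.Re (d x) - complex.Re (f x))).
    exact: measurable_funB.
  by apply/funext => x; exact: ReB.
- rewrite (_ : (fun x => _) = (fun x => complex.Im (d x) - complex.Im (f x))).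
    exact: measurable_funB.
  by apply/funext => x; exact: ImB.
- by apply: (le_trans (normcD _ _)); rewrite lerD ?normcN.
rewrite ReB ud vf; under [RHS]eq_Rintegral do rewrite mulrBl ReB.
rewrite RintegralB//; exact: bounded_symbol_integrable.
Qed.

End LocalSymbols.

Section Localisation.
Context {R : realType}.
Implicit Types (x y e r tau : R) (w : R[i]) (u v a b : (R -> R[i]) -> R[i]) (d f h : R -> R[i]).
Local Notation mu := (@lebesgue_measure R).

Lemma symb_cis tau x : symb (cis tau) x = ((1 + cos (x - tau)) / 2)%:C.
Proof.
rewrite /symb -cisN mulrAC -cisD [_ * cis x]mulrAC -cisD.
rewrite (addrC (- tau)) -(opprB x tau).
rewrite /cis cosN sinN; set p := cos _; set q := sin _.
rewrite (_ : 4%:R^-1 = (4^-1)%:C :> R[i]); last by rewrite fmorphV rmorph_nat.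
rewrite (_ : 2^-1 = (2^-1)%:C :> R[i]); last by rewrite fmorphV rmorph_nat.
by simpc; congr (_ +i* _); field.
Qed.

Lemma normc_symb tau x : normc (symb (cis tau) x) = (1 + cos (x - tau)) / 2.
Proof.
have h := cos_geN1 (x - tau).
by rewrite symb_cis normc_real ger0_norm//; lra.
Qed.

(** For y in [- 2 pi, 2 pi] only the lattice points - 2 pi, 0 and 2 pi matter; evenness and
    periodicity reduce to [r, pi], where the cosine decreases. *)
Lemma cos_le_of_far r y : 0 < r -> r <= 1 -> `|y| <= 2 * pi ->
  r <= `|y| -> r <= `|y - 2 * pi| -> r <= `|y + 2 * pi| -> cos y <= cos r.
Proof.
move=> r0 r1 y2; have pi2 := pi_ge2 R.
wlog y0 : y y2 / 0 <= y.
  move=> hw; case: (leP 0 y) => [|y0]; first exact: hw.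
  move=> h1 h2 h3; have := hw (- y); rewrite normrN cosN => /(_ y2).
  by rewrite oppr_ge0 ltW//; apply=> //; [rewrite -opprD normrN|rewrite addrC -opprB normrN].
rewrite ger0_norm// => h1 h2 _.
have hc z : r <= z -> z <= pi -> cos z <= cos r.
  rewrite le_eqVlt => /predU1P[<-//|rz] zpi.
  by apply/ltW; rewrite ltr_cos// in_itv/=; apply/andP; split; lra.
case: (leP y pi) => ypi; first exact: hc.
have y2' : y - 2 * pi <= 0 by move: y2; rewrite ger0_norm//; lra.
rewrite ler0_norm// in h2.
rewrite -cosN (_ : cos (- y) = cos (2 * pi - y)); first by apply: hc; lra.
by rewrite (_ : 2 * pi - y = - y + pi + pi) ?cosDpi ?opprK//; ring.
Qed.

(** An infimum over the empty set is [+oo], so a finite distance forces [a] to be an essentially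
    bounded function. This is how the symbol of [a] is obtained. *)
Lemma dist_at_fin tau a b : (dist_at tau a b < +oo)%E ->
  exists2 f, Linfty_periodic f & represents f a.
Proof.
move=> hd; apply: contrapT => nf; move: hd; rewrite /dist_at.
rewrite (_ : [set d | _] = set0) ?ereal_inf0 ?ltxx//.
by apply/seteqP; split=> // d [f [h [[pf fa] _ _]]]; apply: nf; exists f.
Qed.

Lemma exists_expr_le (q M e : R) : 0 <= q -> q < 1 -> 0 <= M -> 0 < e ->
  exists N : nat, M * q ^+ N <= e.
Proof.
move=> q0 q1 M0 e0; have q1' : `|q| < 1 by rewrite ger0_norm.
have := cvg_expr q1' => /cvgr0Pnorm_lt /(_ (e / (M + 1))).
have M1 : 0 < M + 1 by lra.
move=> /(_ (divr_gt0 e0 M1))[N _ /(_ N (leqnn N))] /=.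
rewrite ger0_norm ?exprn_ge0// => h; exists N.
have := h; rewrite ltr_pdivlMr// => /ltW; apply: le_trans.
by rewrite mulrC ler_wpM2l ?exprn_ge0//; lra.
Qed.

Lemma dist_at_mult_le tau a b e : - pi <= tau < pi ->
  linear_on_tests a -> linear_on_tests b -> dist_at tau a b = 0%E -> 0 < e ->
  exists N, mult_le (F := fun t : R => t ^+ 2)
    (fun phi => convk (fun n => fourier_coef a n - fourier_coef b n)
                      (iter N (pz (cis tau)) phi)) e.
Proof.
move=> /andP[tau1 tau2] la lb ab e0; have pi0 := pi_gt0 R.
have : (dist_at tau a b < e%:E)%E by rewrite ab lte_fin.
move=> /ereal_inf_lt[_ [f [h [[pf fa] [ph hb] ->]]]].
move=> /ereal_inf_lt[_ [[c1 c2] /= /andP[ct1 ct2] <-]] /ltW/ae_Linfty_norm near.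
have near_shift c : (forall x, f (x + c) = f x) -> (forall x, h (x + c) = h x) ->
    \forall x \ae mu, x + c \in `]c1, c2[ -> normc (f x - h x) <= e.
  move=> fc hc; have := ae_translate c near; apply: ae_imply => x.
  by rewrite fc hc.
have [perf _ _ _] := pf; have [perh _ _ _] := ph.
have near0 := near_shift 0 (fun x => congr1 f (addr0 x)) (fun x => congr1 h (addr0 x)).
have near1 := near_shift _ perf perh.
have near2 := near_shift (- (2 * pi)) (fun x => esym (etrans (congr1 f (esym (subrK _ x))) (perf _)))
  (fun x => esym (etrans (congr1 h (esym (subrK _ x))) (perh _))).
(* Small enough that the r-neighbourhood of tau lies in the given interval and that r <= pi. *)
pose r := Num.min 1 (Num.min (tau - c1) (c2 - tau)).
have r0 : 0 < r by rewrite !lt_min ltr01/= !subr_gt0 ct1.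
have r1 : r <= 1 by rewrite ge_min lexx.
have rc1 : r <= tau - c1 by rewrite !ge_min lexx orbT.
have rc2 : r <= c2 - tau by rewrite !ge_min lexx !orbT.
have in_u x : `|x - tau| < r -> x \in `]c1, c2[.
  by rewrite ltr_norml in_itv/= => /andP[? ?]; apply/andP; split; lra.
have [df [Mf [bf dfE]]] := Linfty_bounded_symbol pf fa.
have [dh [Mh [bh dhE]]] := Linfty_bounded_symbol ph hb.
have bd := bounded_symbol_sub bf bh.
pose M := Mf + Mh; pose q := (1 + cos r) / 2.
(* On one period each point is either a periodic translate of a point near tau, where the difference
   is at most e, or far, where each bump contributes at most the factor q < 1. *)
pose P x (z : R[i]) := normc z <= M /\
  (x \in `[- pi, pi] -> normc z <= e \/ cos (x - tau) <= cos r).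
have [mRe mIm dM ud] := bd.
have M0 : 0 <= M by apply: le_trans (dM 0); exact: normc_ge0.
have aeP : \forall x \ae mu, P x (df x - dh x).
  have := ae_and (ae_and dfE dhE) (ae_and near0 (ae_and near1 near2)).
  apply: ae_imply => x [[fE hE] [n0 [n1 n2]]]; split; first exact: dM.
  rewrite in_itv/= => /andP[x1 x2].
  rewrite fE hE; have [i0|i0] := ltP `|x - tau| r.
    by left; apply: n0; rewrite addr0 in_u.
  have [i1|i1] := ltP `|x + 2 * pi - tau| r; first by left; apply: n1; exact: in_u.
  have [i2|i2] := ltP `|x - 2 * pi - tau| r; first by left; apply: n2; exact: in_u.
  right; apply: cos_le_of_far => //.
  - by rewrite ler_norml; apply/andP; split; lra.
  - by rewrite addrAC.
  - by rewrite addrAC.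
have P0 x : P x 0.
  by split; [|left]; rewrite ComplexField.Normc.normc0// ltW.
have [d [bd' Pd _]] := @bounded_symbol_cut _ (fun g => a g - b g) (fun x => df x - dh x) M P
  mRe mIm ud aeP P0 (fun _ _ Pz => proj1 Pz).
have cr : cos r < 1.
  by rewrite -cos0 ltr_cos// in_itv/=; have := pi_ge2 R; lra.
have cr1 := cos_geN1 r.
have [N hN] : exists N : nat, M * q ^+ N <= e.
  by apply: exists_expr_le => //; rewrite /q; lra.
have lab : linear_on_tests (fun g => a g - b g).
  by move=> c g k tg tk; rewrite la// lb//; ring.
exists N.
have <- : fourier_coef (fun g => a g - b g) = (fun n => fourier_coef a n - fourier_coef b n).
  by apply/funext => n; rewrite /fourier_coef mulrBr.
apply: mult_le_sqr lab bd' e0 _ => x xI; rewrite normc_symb.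
have c1' := cos_geN1 (x - tau); have c2' := cos_le1 (x - tau).
have s0 : 0 <= (1 + cos (x - tau)) / 2 by lra.
have [dxM /(_ xI)[dxe|far]] := Pd x.
  rewrite -[leRHS]mulr1 ler_pM ?normc_ge0 ?exprn_ge0//.
  by apply: exprn_ile1 => //; lra.
by apply: le_trans hN; rewrite ler_pM ?normc_ge0 ?exprn_ge0// lerXn2r ?nnegrE /q; lra.
Qed.

Lemma mult_le_sqr_of_symbol a f : linear_on_tests a -> Linfty_periodic f -> represents f a ->
  exists2 M, 0 < M & mult_le (F := fun t : R => t ^+ 2) (convk (fourier_coef a)) M.
Proof.
move=> la pf fa; have [d [M [bd _]]] := Linfty_bounded_symbol pf fa.
have [_ _ dM _] := bd; have M0 : 0 <= M by apply: le_trans (dM 0); exact: normc_ge0.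
exists (M + 1); first by lra.
apply: (mult_le_sqr (N := 0) (w := 1) la bd); first by lra.
by move=> x _; rewrite expr0 mulr1; have := dM x; lra.
Qed.

End Localisation.

(** * Multipliers and Wiener-Hopf operators *)

Section Multipliers.
Context {R : realType} {F : R -> R}.
Variable yF : young F.
Implicit Types (c d f : int -> R[i]) (w : R[i]) (K L : R).

Lemma mult_le_mono (T : (int -> R[i]) -> int -> R[i]) K L : K <= L ->
  mult_le (F := F) T K -> mult_le (F := F) T L.
Proof.
move=> KL hT f /hT[h1 h2]; split=> //; apply: (le_trans h2).
by rewrite ler_wpM2r ?lux_ge0.
Qed.

Lemma mult_le_sub c d K L : mult_le (F := F) (convk c) K -> mult_le (F := F) (convk d) L ->
  mult_le (F := F) (convk (fun n => c n - d n)) (K + L).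
Proof.
move=> hc hd f Sf; have [c1 c2] := hc f Sf; have [d1 d2] := hd f Sf.
rewrite convkB//.
rewrite (_ : (fun j => _) = fun j => convk c f j + (-1) * convk d f j); last first.
  by apply/funext => j; rewrite mulN1r.
have d1' := inLZ yF (-1) d1; split; first exact: inLD.
apply: (le_trans (luxD yF c1 d1')); rewrite mulrDl lerD//.
by rewrite luxZ// normcN ComplexField.Normc.normc1 mul1r.
Qed.

Lemma lux_translate f n : inL F f -> inL F (fun j => f (j + n)) /\
  lux F (fun j => f (j + n)) <= lux F f.
Proof.
move=> hf; have adm l : admissible F f l -> admissible F (fun j => f (j + n)) l.
  by apply: (admissible_comp (h := fun j => j + n)) => //; exact: addIr.
by split; [have [l /adm hl] := hf; exists l|exact: lux_mono].
Qed.

Lemma lux_pz w f : normc w = 1 -> inL F f -> inL F (pz w f) /\ lux F (pz w f) <= lux F f.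
Proof.
move=> w1 hf; have [i1 l1] := lux_translate 1 hf; have [i2 l2] := lux_translate (-1) hf.
have i3 := inLZ yF (w^-1 / 4%:R) i2; have i4 := inL_lin yF 2^-1 hf i3.
have n4 : normc (4%:R^-1 : R[i]) = 4^-1.
  rewrite (_ : 4%:R^-1 = (4^-1)%:C :> R[i]); last by rewrite fmorphV rmorph_nat.
  by rewrite normc_real ger0_norm.
have n2 : normc (2^-1 : R[i]) = 2^-1.
  rewrite (_ : 2^-1 = (2^-1)%:C :> R[i]); last by rewrite fmorphV rmorph_nat.
  by rewrite normc_real ger0_norm.
have wV : normc w^-1 = 1.
  have w0 : w != 0 by rewrite -normc_eq0 w1 oner_eq0.
  by rewrite -[LHS]mul1r -[in LHS]w1 -normcM mulfV// ComplexField.Normc.normc1.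
split; first exact: inL_lin.
(* The three translates contribute 1/4 + 1/2 + 1/4 = 1, on any Orlicz space. *)
have z1 := luxZ yF (w / 4%:R) i1; have z2 := luxZ yF 2^-1 hf; have z3 := luxZ yF (w^-1 / 4%:R) i2.
rewrite normcM w1 n4 in z1; rewrite n2 in z2; rewrite normcM wV n4 in z3.
have h1 := luxD yF (inLZ yF (w / 4%:R) i1) i4.
have h2 := luxD yF (inLZ yF 2^-1 hf) i3.
apply: (le_trans h1); rewrite z1; apply: (le_trans (lerD (lexx _) h2)).
by rewrite z2 z3; lra.
Qed.

Lemma mult_le_iter_pz c w n K : 0 <= K -> normc w = 1 -> mult_le (F := F) (convk c) K ->
  mult_le (F := F) (fun f => convk c (iter n (pz w) f)) K.
Proof.
move=> K0 w1 hc f Sf; have [h1 h2] := hc _ (S0_iter_pz w n Sf); split=> //.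
apply: (le_trans h2); rewrite ler_wpM2l//.
elim: n {h1 h2} => [//|n IH]; apply: le_trans IH.
by rewrite iterS; apply: (lux_pz w1 _).2; apply: inL_S0 => //; exact: S0_iter_pz.
Qed.

Lemma multiplier_mult_le (a : (R -> R[i]) -> R[i]) : multiplier F a ->
  exists2 K, 0 < K & mult_le (F := F) (convk (fourier_coef a)) K.
Proof.
move=> [_ aL afin].
have [K K0 hK] : exists2 K, 0 < K & (mult_norm F a <= K%:E)%E.
  case: (mult_norm F a) afin => [k _|//|_]; last by exists 1; rewrite ?ltr01 ?leNye.
  by exists (`|k| + 1); [exact: ltr_wpDl|rewrite lee_fin (le_trans (ler_norm k))// lerDl].
exists K => // f Sf; have cL : inL F (convk (fourier_coef a) f) by apply/(inLP yF)/aL.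
split=> //; have fL := inL_S0 yF Sf.
have [f0|f0] := eqVneq (lux F f) 0.
  have fz : f = fun=> 0 by apply/funext => j; exact: (lux_eq0 yF fL f0).
  rewrite f0 mulr0 (_ : convk _ f = fun=> 0) ?lux0//.
  by apply/funext => j; rewrite (convkE (s := [::]) _ (f := f))// ?big_nil// => n _; rewrite fz.
have lf : 0 < lux F f by rewrite lt_neqAle eq_sym f0 lux_ge0.
have : (lPhi_norm F (Defs.conv a f) / lPhi_norm F f <= K%:E)%E.
  apply: le_trans hK; apply: ereal_sup_ubound; exists f => //; split=> //= fz.
  by move: f0; rewrite fz lux0// eqxx.
rewrite (lPhi_normE cL) (lPhi_normE fL) inver (negbTE f0) -EFinM lee_fin ler_pdivrMr//.
Qed.

End Multipliers.

(** * Correspondence between maps on sequences and operators on the Banach space *)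

Section FredholmBridge.
Context {R : realType} {F : R -> R}.
Variable yF : young F.

Local Notation E := (orlicz_banach yF).
Implicit Types (x y : E) (s : seq E) (phi : int -> R[i]) (a : (R -> R[i]) -> R[i])
  (A : bop E) (T : (int -> R[i]) -> int -> R[i]).

Lemma lPhi_plusP phi : lPhi_plus F phi <-> exists x : E, hseq x = phi.
Proof.
split=> [[f /(inLP yF) [l hl] <-]|[x <-]].
  exists (half yF (ex_intro _ l (Pplus_in yF hl)) (Pplus_neg f)).
  by [].
exists (hseq x); first by apply/(inLP yF); exact: hseq_in.
apply/funext => j; rewrite /Pplus; case: ifPn => //; rewrite -ltNge => j0.
by rewrite hseq_neg.
Qed.

Lemma fin_seq_S0plus x : fin_seq x -> S0plus (hseq x).
Proof.
move=> hx; exists (hseq x) => //.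
apply/funext => j; rewrite /Pplus; case: ifPn => //; rewrite -ltNge => j0.
by rewrite hseq_neg.
Qed.

Lemma S0plus_fin_seq phi : S0plus phi -> exists2 x : E, fin_seq x & hseq x = phi.
Proof.
move=> [f Sf <-]; have [l hl] := inL_S0 yF Sf.
exists (half yF (ex_intro _ l (Pplus_in yF hl)) (Pplus_neg f)) => //.
move/S0P: Sf => [s us hs]; apply/S0P; exists s => // n ns.
by rewrite /= /Pplus hs// if_same.
Qed.

Lemma bop_of_wiener_hopf a T : is_wiener_hopf F a T ->
  exists2 A : bop E, toeplitz (fourier_coef a) A & forall x : E, hseq (A x) = T (hseq x).
Proof.
move=> [[Tin Tlin [C Tb]] TS].
have hin x : lPhi_plus F (hseq x) by apply/lPhi_plusP; exists x.
have /choice[A hA] : forall x, exists y, hseq y = T (hseq x).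
  by move=> x; apply/lPhi_plusP/Tin.
have Al c x y : A (c *: x + y) = c *: A x + A y.
  apply: ospaceP => j; rewrite hA [RHS]hseq_lin !hA.
  rewrite (_ : hseq (c *: x + y) = fun j => c * hseq x j + hseq y j); last first.
    by apply/funext => i; exact: hseq_lin.
  by rewrite Tlin.
have Ab x : bnorm (A x) <= `|C| * bnorm x.
  have := Tb _ (hin x); rewrite -hA !lPhi_normE; [|exact: hseq_in|exact: hseq_in].
  rewrite -EFinM lee_fin => h; apply: (le_trans h).
  by rewrite ler_wpM2r ?ler_norm// lux_ge0.
exists (Bop Al (ex_intro2 _ _ `|C| (normr_ge0 C) Ab)) => [x Dx|x]; last exact: hA.
by rewrite /= hA (TS _ (fin_seq_S0plus Dx)).
Qed.

(** The sequences [v i] may lie outside the space, so a spanning list has to be extracted from [K]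
    itself: one [v i] is eliminated at a time by subtracting multiples of an element whose
    coefficient there is nonzero. *)
Lemma spanned_of_lin_comb n (v : 'I_n -> int -> R[i]) (K : E -> Prop) :
    (forall c x y, K x -> K y -> K (c *: x + y)) ->
    (forall x, K x -> exists c, hseq x = lin_comb c v) ->
  exists s, forall x, K x -> spanned s x.
Proof.
elim: n v K => [|n IH] v K Klin Kv.
  exists [::] => x /Kv[c xE]; apply: ospaceP => j.
  by rewrite xE /lin_comb big_ord0.
pose v' i := v (lift ord0 i).
have [[x0 Kx0 [c0 x0E c00]]|no] := pselect (exists2 x0, K x0 &
    exists2 c, hseq x0 = lin_comb c v & c ord0 != 0); last first.
  apply: (IH v' K Klin) => x Kx; have [c xE] := Kv x Kx; exists (fun i => c (lift ord0 i)).
  rewrite xE; apply/funext => j; rewrite /lin_comb big_ord_recl.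
  have [->|c0] := eqVneq (c ord0) 0; first by rewrite mul0r add0r.
  by case: no; exists x => //; exists c.
pose K' x := K x /\ exists c, hseq x = lin_comb c v'.
have [|x [_ ?]//|s hs] := IH v' K'.
  move=> b x y [Kx [c xE]] [Ky [d yE]]; split; first exact: Klin.
  exists (fun i => b * c i + d i); apply/funext => j; rewrite hseq_lin xE yE /lin_comb.
  by rewrite mulr_sumr -big_split/=; apply: eq_bigr => i _; rewrite mulrDl mulrA.
exists (x0 :: s) => x Kx /=; have [c xE] := Kv x Kx.
pose t := c ord0 / c0 ord0; exists t; apply: hs; split.
  by rewrite addrC -scaleNr; exact: Klin.
exists (fun i => c (lift ord0 i) - t * c0 (lift ord0 i)); apply/funext => j.
rewrite hseqB hseqZ xE x0E /lin_comb !big_ord_recl mulrDr mulrA /t mulfVK//.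
rewrite opprD addrACA subrr add0r mulr_sumr -sumrB; apply: eq_bigr => i _.
by rewrite mulrBl mulrA.
Qed.

Lemma spanned_lin_comb s x : spanned s x ->
  exists c, hseq x = lin_comb c (fun i : 'I_(size s) => hseq (nth 0 s i)).
Proof.
elim: s x => [|v s IH] x /=.
  by move=> ->; exists (fun=> 0); apply/funext => j; rewrite /lin_comb big_ord0.
move=> [b /IH[c xE]]; exists (fun i => oapp c b (unlift ord0 i)).
apply/funext => j; rewrite /lin_comb big_ord_recl unlift_none /=.
have e : hseq (x - b *: v) j = lin_comb c (fun i : 'I_(size s) => hseq (nth 0 s i)) j.
  by rewrite xE.
rewrite hseqB hseqZ in e; rewrite (canRL (subrK _) e) addrC; congr (_ + _); rewrite /lin_comb; apply: eq_bigr => i _.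
by rewrite liftK.
Qed.

Lemma spanned_sum n (w : 'I_n -> E) (c : 'I_n -> R[i]) (l : seq 'I_n) :
  spanned (map w l) (\sum_(i <- l) c i *: w i).
Proof.
elim: l => [|i l IH] /=; first by rewrite big_nil.
by exists (c i); rewrite big_cons addrC addKr.
Qed.

Lemma hseq_sum n (w : 'I_n -> E) (c : 'I_n -> R[i]) :
  hseq (\sum_i c i *: w i) = lin_comb c (fun i => hseq (w i)).
Proof.
apply/funext => j; rewrite /lin_comb.
elim: (index_enum _) => [|i l IH]; first by rewrite !big_nil.
by rewrite !big_cons hseqD hseqZ IH.
Qed.

Lemma fredholm_bop A T : (forall x, hseq (A x) = T (hseq x)) ->
  fredholm (lPhi_plus F) T -> fin_ker A /\ cofin_range A.
Proof.
move=> AT [[n [v kv]] [m [w [wL wT]]]].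
have hin x : lPhi_plus F (hseq x) by apply/lPhi_plusP; exists x.
split.
  apply: (spanned_of_lin_comb (v := v)) => [c x y Ax Ay|x Ax].
    by rewrite bop_linear Ax Ay scaler0 addr0.
  by apply: kv => //; rewrite -AT Ax; apply/funext => j.
have /choice[w' w'E] : forall i, exists x, hseq x = w i by move=> i; apply/lPhi_plusP.
exists (map w' (index_enum _)) => y.
have [phi [c [/lPhi_plusP[x <-] yE]]] := wT _ (hin y).
exists x; rewrite (_ : y - A x = \sum_i c i *: w' i); first exact: spanned_sum.
apply: ospaceP => j; rewrite hseqB yE AT addrC addKr hseq_sum.
by congr (lin_comb c _ j); apply/funext => i; rewrite w'E.
Qed.

(** Wiener-Hopf operators are total maps on sequences, so an operator on the Banach space is
    continued by 0 outside it. *)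
Definition extend_zero A phi : int -> R[i] :=
  if pselect (exists x : E, hseq x = phi) is left e then hseq (A (projT1 (cid e))) else fun=> 0.

Lemma extend_zeroE A x : extend_zero A (hseq x) = hseq (A x).
Proof.
rewrite /extend_zero; case: pselect => [e|[]]; last by exists x.
by case: cid => y /= yx; congr (hseq (A _)); apply: ospaceP => j; rewrite yx.
Qed.

Lemma wiener_hopf_of_bop a A : toeplitz (fourier_coef a) A ->
  is_wiener_hopf F a (extend_zero A).
Proof.
move=> hA; split; last first.
  by move=> _ /S0plus_fin_seq[x Dx <-]; rewrite extend_zeroE hA.
split.
- by move=> _ /lPhi_plusP[x <-]; rewrite extend_zeroE; apply/lPhi_plusP; exists (A x).
- move=> c _ _ /lPhi_plusP[x <-] /lPhi_plusP[y <-]; rewrite !extend_zeroE.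
  rewrite (_ : (fun j => c * hseq x j + hseq y j) = hseq (c *: x + y)); last first.
    by apply/funext => j; rewrite hseq_lin.
  by rewrite extend_zeroE bop_linear; apply/funext => j; exact: hseq_lin.
have [C C0 hC] := bop_bounded A.
exists C => _ /lPhi_plusP[x <-]; rewrite extend_zeroE !lPhi_normE; [|exact: hseq_in|exact: hseq_in].
by rewrite -EFinM lee_fin; exact: hC.
Qed.

Lemma bop_fredholm A : fin_ker A -> cofin_range A -> fredholm (lPhi_plus F) (extend_zero A).
Proof.
move=> [s hs] [t ht]; split.
  exists (size s), (fun i => hseq (nth 0 s i)) => _ /lPhi_plusP[x <-].
  rewrite extend_zeroE => Ax; apply/spanned_lin_comb/hs/ospaceP => j.
  by rewrite Ax.
exists (size t), (fun i => hseq (nth 0 t i)); split=> [i|_ /lPhi_plusP[y <-]].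
  by apply/lPhi_plusP; exists (nth 0 t i).
have [x /spanned_lin_comb[c yE]] := ht y.
exists (hseq x), c; split; first by apply/lPhi_plusP; exists x.
by apply/funext => j; rewrite extend_zeroE -yE hseqB addrC subrK.
Qed.

End FredholmBridge.

Section LocalPrinciple.
Context {R : realType}.
Variables (Phi : R -> R) (th : R).
Hypothesis hPhi : N_function Phi.
Hypothesis hind : [/\ (1 < alpha_index Phi)%E, (alpha_index Phi <= beta_index Phi)%E &
              (beta_index Phi < +oo)%E].
Hypothesis hth : 0 < th < theta_max Phi.
Implicit Types (c f : int -> R[i]) (w : R[i]) (a : (R -> R[i]) -> R[i]).

Lemma iter_pz_lin w n (z : R[i]) f g :
  iter n (pz w) (fun j => z * f j + g j) =
  (fun j => z * iter n (pz w) f j + iter n (pz w) g j).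
Proof.
elim: n => [//|n IH]; rewrite !iterS IH; apply/funext => j; rewrite /pz; ring.
Qed.

Lemma interpolated_mult_le K1 : 0 < K1 -> exists2 B, 0 <= B & forall c w n K2,
    0 < K2 -> normc w = 1 -> mult_le (F := Phi_theta Phi th) (convk c) K1 ->
    mult_le (F := fun t : R => t ^+ 2) (fun f => convk c (iter n (pz w) f)) K2 ->
  mult_le (F := Phi) (fun f => convk c (iter n (pz w) f)) (B * K2 `^ th).
Proof.
have [yF1 th0 th1 factor [C0 C00 product]] := Phi_theta_interpolates hPhi hind hth.
have yF := N_function_young hPhi.
move=> K10; exists `|8%:R * C0 * dyadic_const th * K1 `^ (1 - th)| => // c w n K2 K20 w1 h1 h2.
have lin : forall (z : R[i]) f g, S0 f -> S0 g ->
    convk c (iter n (pz w) (fun j => z * f j + g j)) =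
    (fun j => z * convk c (iter n (pz w) f) j + convk c (iter n (pz w) g) j).
  by move=> z f g Sf Sg; rewrite iter_pz_lin convk_lin//; exact: S0_iter_pz.
have h1' := mult_le_iter_pz yF1 n (ltW K10) w1 h1.
have := @interpolation R Phi _ _ th C0 yF yF1 young_sqr th0 th1 C00 factor product
  (fun f => convk c (iter n (pz w) f)) lin K1 K2 K10 K20 h1' h2.
move=> h; refine (mult_le_mono _ h); rewrite /interp_const mulrA ler_wpM2r ?powR_ge0//.
exact: ler_norm.
Qed.

Lemma interpolated_small K1 e : 0 < K1 -> 0 < e -> exists2 K2, 0 < K2 & forall c w n,
    normc w = 1 -> mult_le (F := Phi_theta Phi th) (convk c) K1 ->
    mult_le (F := fun t : R => t ^+ 2) (fun f => convk c (iter n (pz w) f)) K2 ->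
  mult_le (F := Phi) (fun f => convk c (iter n (pz w) f)) e.
Proof.
move=> K10 e0; have [B B0 hB] := interpolated_mult_le K10.
have [_ th0 _ _ _] := Phi_theta_interpolates hPhi hind hth.
have B1 : 0 < B + 1 by exact: ltr_wpDl.
have q0 : 0 < e / (B + 1) by exact: divr_gt0.
(* Solves [B * K2 ^ th <= e]; positivity of theta is what makes the l^2 factor effective. *)
exists ((e / (B + 1)) `^ th^-1) => [|c w n w1 h1 h2]; first exact: powR_gt0.
have := hB c w n _ (powR_gt0 th^-1 q0) w1 h1 h2.
move=> h; refine (mult_le_mono _ h).
rewrite -powRrM mulVf ?gt_eqF// (powRr1 (ltW q0)).
rewrite mulrA ler_pdivrMr// mulrC ler_wpM2l ?(ltW e0)//.
by rewrite lerDl.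
Qed.

Lemma wiener_hopf_local_principle a : multiplier (Phi_theta Phi th) a ->
    (forall tau : R, - pi <= tau < pi -> exists b,
       [/\ multiplier (Phi_theta Phi th) b, dist_at tau a b = 0%E &
           wiener_hopf_fredholm Phi b]) ->
  wiener_hopf_fredholm Phi a.
Proof.
move=> ma hloc; have pi0 := pi_gt0 R.
have yF := N_function_young hPhi.
have d2 := N_function_delta2 hPhi hind hth.
have [yF1 _ _ _ _] := Phi_theta_interpolates hPhi hind hth.
have [Ka Ka0 hKa] := multiplier_mult_le yF1 ma.
have [[la _] _ _] := ma.
(* The hypothesis at the single point 0 already shows, through finiteness of the distance, that [a]
   is an essentially bounded function. *)
have [|b0 [_ d0 _]] := hloc 0; first by rewrite pi0 oppr_le0 ltW.
have [|f pf fa] := @dist_at_fin R 0 a b0; first by rewrite d0.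
have [M M0 hM] := mult_le_sqr_of_symbol la pf fa.
have [B B0 hB] := interpolated_mult_le Ka0.
have n1 : normc (1 : R[i]) = 1 by exact: ComplexField.Normc.normc1.
(* Interpolation with n = 0 bumps yields boundedness of the Wiener-Hopf operator on the space of
   [Phi] itself. *)
have [A hA] := toeplitz_exists yF d2 (mulr_ge0 B0 (powR_ge0 M th))
  (hB (fourier_coef a) 1 0%N M M0 n1 hKa hM).
have /choice[At hAt] : forall t : R, exists At : bop (orlicz_banach yF), - pi <= t < pi ->
    [/\ fin_ker At, cofin_range At & exists b,
      [/\ multiplier (Phi_theta Phi th) b, dist_at t a b = 0%E & toeplitz (fourier_coef b) At]].
  move=> t; have [tI|tI] := boolP (- pi <= t < pi); last by exists 0.
  have [b [mb db [T hT fT]]] := hloc t tI.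
  have [At hAt AtE] := bop_of_wiener_hopf yF hT.
  have [kA rA] := fredholm_bop AtE fT.
  by exists At => _; split=> //; exists b.
have [kA rA] : fin_ker A /\ cofin_range A.
  apply: (toeplitz_local_principle (shiftUV yF) (shiftU_le1 yF) (shiftV_le1 yF)
    (@ev0_linear _ _ yF) (ev0_bounded yF) (@shift_decomposition _ _ yF) (ev0_unit0 yF)
    (@ev0_sep _ _ yF) (A := A) (At := At)).
  - exact: toeplitz_shift d2 _ _ hA.
  - by move=> t /hAt[_ _ [b [_ _ hb]]]; exact: toeplitz_shift d2 _ _ hb.
  - by move=> t /hAt[].
  move=> t tI e e0; have [_ _ [b [mb db hb]]] := hAt t tI.
  have [Kb Kb0 hKb] := multiplier_mult_le yF1 mb; have [[lb _] _ _] := mb.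
  have hab := mult_le_sub yF1 hKa hKb.
  (* The bound [Ka + Kb] may depend on the point t; this is harmless because the number of bumps is
     chosen afterwards. *)
  have [K2 K20 hK2] := interpolated_small (addr_gt0 Ka0 Kb0) e0.
  have [n hn] := dist_at_mult_le tI la lb db K20.
  exists n; apply: (toeplitz_ess_le d2 (toeplitz_sub hA hb) (cis_neq0 t) (ltW e0)).
  exact: hK2 (normc_cis t) hab hn.
exists (extend_zero A); first exact: wiener_hopf_of_bop.
exact: bop_fredholm.
Qed.

End LocalPrinciple.

Theorem theorem1p1 (R : realType) (Phi : R -> R)
  (hPhi : N_function Phi)
  (hind : [/\ (1 < alpha_index Phi)%E, (alpha_index Phi <= beta_index Phi)%E &
              (beta_index Phi < +oo)%E])
  (a : (R -> R[i]) -> R[i])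
  (ha : multiplier_angle Phi a)
  (hloc : forall tau : R, - pi <= tau < pi ->
    exists atau : (R -> R[i]) -> R[i],
      [/\ multiplier_square Phi atau,
          dist_at tau a atau = 0%E &
          wiener_hopf_fredholm Phi atau]) :
  wiener_hopf_fredholm Phi a.
Proof.
(* The theta provided by the union is fixed once; each local representative lies in the
   intersection, hence in the multiplier space for this theta. *)
have [th thI ma] := ha.
have hth : 0 < th < theta_max Phi by move: thI; rewrite /= in_itv.
apply: (wiener_hopf_local_principle hPhi hind hth ma) => tau /hloc[b [mb db fb]].
exists b; split; [exact: mb th thI|exact: db|exact: fb].
Qed.
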